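(* Let $\{q_k:k\ge 0\}$ be a non-increasing sequence of nonnegative numbers with $q_0>0$, let $Q_n=\sum_{k=0}^{n-1}q_k$, and let $t_n^{\kappa}f=\frac1{Q_n}\sum_{k=1}^{n}q_{n-k}S_k^{\kappa}f$ be the associated Nörlund means with respect to the Walsh–Kaczmarz system, with maximal operator $t^{*,\kappa}f=\sup_{n\ge 1}|t_n^{\kappa}f|$. (a) Let $0<\alpha<1$ and suppose that $$\frac{q_0n^{\alpha}}{Q_n}=O(1),\qquad \frac{q_n-q_{n+1}}{n^{\alpha-2}}=O(1)\qquad\text{as } n\to\infty .$$ Then $t^{*,\kappa}$ is bounded from the Hardy space $H_{1/(1+\alpha)}(G)$ to the space $L_{1/(1+\alpha),\infty}(G)$. (b) Let $0<\alpha\le1$, $0<p<1/(1+\alpha)$, and suppose that there is a constant $c>0$ such that $$\frac{q_0}{Q_n}\ge\frac{c}{n^{\alpha}}\qquad\text{for all sufficiently large } n .$$ Then there exists a martingale $f\in H_p(G)$ such that $$\sup_{n\ge1}\frac{\|t_n^{\kappa}f\|_{L_{p,\infty}}}{\|f\|_{H_p}}=\infty .$$ (c) Let $0<\alpha\le1$ and suppose that $$\limsup_{n\to\infty}\frac{q_0n^{\alpha}}{Q_n}=\infty .$$ Then there exists a martingale $f\in H_{1/(1+\alpha)}(G)$ such that $$\sup_{n\ge1}\frac{\|t_n^{\kappa}f\|_{L_{1/(1+\alpha),\infty}}}{\|f\|_{H_{1/(1+\alpha)}}}=\infty .$$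
   Context: $\mathbf N=\{0,1,2,\dots\}$. $G=\prod_{k=0}^{\infty}\mathbb Z_2$ is the Walsh group: elements are $x=(x_0,x_1,\dots)$ with $x_k\in\{0,1\}$, the operation is coordinatewise addition mod 2, and $\mu$ is the normalized Haar (product) measure. Dyadic intervals: $I_n(x)=\{y\in G: y_i=x_i,\ 0\le i<n\}$, $I_0(x)=G$. $F_n$ is the $\sigma$-algebra generated by the dyadic intervals of measure $2^{-n}$. Rademacher functions: $r_k(x)=(-1)^{x_k}$. For $n\ge1$ with binary expansion $n=\sum_i n_i2^i$, $n_i\in\{0,1\}$, let $|n|=\max\{j:n_j\ne0\}$. Walsh–Kaczmarz functions: $\kappa_0=1$ and $\kappa_n(x)=r_{|n|}(x)\prod_{k=0}^{|n|-1}\big(r_{|n|-1-k}(x)\big)^{n_k}$ for $n\ge1$. Martingales $f=(f^{(n)},n\in\mathbf N)$ are taken with respect to $(F_n)$. $f^*=\sup_n|f^{(n)}|$, and for $0<p<\infty$, $H_p(G)$ is the space of martingales with $\|f\|_{H_p}:=\|f^*\|_p<\infty$, where $\|g\|_p^p=\int_G|g|^p\,d\mu$. Also $\|g\|_{L_{p,\infty}}^p=\sup_{\lambda>0}\lambda^p\mu(|g|>\lambda)$. An operator $T$ is bounded from $H_p$ to $L_{p,\infty}$ if there is a constant $C$ with $\|Tf\|_{L_{p,\infty}}\le C\|f\|_{H_p}$ for all $f\in H_p$. For a martingale $f$: $\widehat f^{\kappa}(i)=\lim_{n\to\infty}\int_G f^{(n)}\kappa_i\,d\mu$ and $S_M^{\kappa}f=\sum_{i=0}^{M-1}\widehat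 f^{\kappa}(i)\kappa_i$. *)

(* Defs.v *)
From HB Require Import structures.
From mathcomp Require Import all_boot all_order all_algebra.
From mathcomp Require Import all_classical all_reals all_analysis.
From mathcomp Require Import measurable_realfun.

Set Implicit Arguments.
Unset Strict Implicit.
Unset Printing Implicit Defensive.

Import Order.TTheory GRing.Theory Num.Theory.
Import numFieldNormedType.Exports.

Local Open Scope classical_set_scope.
Local Open Scope ring_scope.

Definition dyadic_interval (n : nat) (x : nat -> bool) : set (nat -> bool) :=
  [set y | forall i, (i < n)%N -> y i = x i].

Definition dyadic_intervals (n : nat) : set (set (nat -> bool)) :=
  range (dyadic_interval n).

(* The measurable sets are the product sigma-algebra, i.e. the one generated by
   the dyadic intervals of all ranks. *)
Definition walsh_group : measurableType _ :=
  g_sigma_algebraType (\bigcup_n dyadic_intervals n).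

Definition walsh_add (x y : walsh_group) : walsh_group := fun k => x k (+) y k.

Section haar_measure.
Context {R : realType}.

Definition binary_digits (t : R) : walsh_group :=
  fun k => odd (Num.truncn (2 ^+ k.+1 * t)).

Let measurable_truncn (c : R) (j : nat) :
  measurable [set t : measurableTypeR R | Num.truncn (c * t) = j].
Proof.
have ml i : measurable [set t : measurableTypeR R | (Num.truncn (c * t) <= i)%N].
  under eq_set => t do rewrite truncn_le_nat.
  rewrite -[X in measurable X]setTI.
  exact: (@measurable_fun_ltr _ _ _ setT ( *%R c) (cst i.+1%:R)).
case: j => [|j].
  rewrite (_ : [set _ | _] = [set t | (Num.truncn (c * t) <= 0)%N]) //.
  by apply/seteqP; split => t /=; [move=> -> | rewrite leqn0 => /eqP].
rewrite [X in measurable X](_ : _ =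
  [set t | (Num.truncn (c * t) <= j.+1)%N] `\`
  [set t | (Num.truncn (c * t) <= j)%N]); first exact: measurableD.
apply/seteqP; split => t /=; first by move=> ->; rewrite leqnn ltnn.
by case=> h1 /negP; rewrite -ltnNge => h2; apply/eqP; rewrite eqn_leq h1.
Qed.

Let measurable_binary_digits :
  measurable_fun [set: measurableTypeR R] (binary_digits : measurableTypeR R -> _).
Proof.
apply: (@measurability _ _ (measurableTypeR R) walsh_group setT binary_digits
  (\bigcup_n dyadic_intervals n)) => //.
move=> _ [_ [n _ [x _ <-]] <-].
rewrite setTI [X in measurable X](_ : _ = \bigcap_(i in `I_n)
  \bigcup_(j in [set j | odd j = x i])
    [set t : measurableTypeR R | Num.truncn (2 ^+ i.+1 * t) = j]).
  by apply: bigcap_measurableType => i _; apply: bigcup_measurable.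
apply/seteqP; split => t /=.
  by move=> h i /= /h hi; exists (Num.truncn (2 ^+ i.+1 * t)).
by move=> h i /h [j /= <- <-].
Qed.

HB.instance Definition _ := isMeasurableFun.Build _ _ _ _
  (binary_digits : measurableTypeR R -> walsh_group) measurable_binary_digits.

(* The normalized Haar measure, constructed as the law of the sequence of binary
   digits of a uniform random variable on [0, 1]; it is characterized by
   [haar_dyadic_interval], [haar_unique] and [haar_invariant]. *)
Definition haar : probability walsh_group R :=
  distribution (uniform_prob (@ltr01 R))
    (binary_digits : {mfun measurableTypeR R >-> walsh_group}).


Let code (n : nat) (x : nat -> bool) : nat :=
  iteri n (fun k c => c.*2 + x k)%N 0%N.

Let code_lt n x : (code n x < 2 ^ n)%N.
Proof.
elim: n => [//|n IH]; rewrite /code /= -/(code n x) expnS mul2n.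
rewrite -(leq_double _.+1) doubleS in IH.
by case: (x n); rewrite ?addn1 ?addn0 // (leq_trans _ IH).
Qed.

Let truncn_half (s : R) : 0 <= s -> (Num.truncn (2 * s))./2 = Num.truncn s.
Proof.
move=> s0; apply/esym/eqP; rewrite truncn_eq //.
have := truncn_itv (mulr_ge0 (ler0n R 2) s0).
set m := Num.truncn _ => /andP[h1 h2].
have e := odd_double_half m.
have b1 : ((m./2).*2%:R <= m%:R :> R) by rewrite ler_nat -{2}e leq_addl.
have b2 : (m.+1%:R <= (m./2).+1.*2%:R :> R).
  by rewrite ler_nat -{1}e doubleS -addnS; case: (odd m).
rewrite -!muln2 !natrM !(mulrC _ 2%:R) in b1 b2.
rewrite -(@ler_pM2l _ 2) // -(@ltr_pM2l _ 2 _ s) //.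
by rewrite (le_trans b1 h1) (lt_le_trans h2 b2).
Qed.

Let binary_digits_code (n : nat) (x : nat -> bool) (t : R) :
  0 <= t < 1 ->
  dyadic_interval n x (binary_digits t) <-> Num.truncn (2 ^+ n * t) = code n x.
Proof.
move=> /andP[t0 t1]; elim: n => [|n IH].
  rewrite expr0 mul1r; split => // _; apply/eqP.
  by rewrite truncn_eq // t0 t1.
have h : (Num.truncn (2 ^+ n.+1 * t))./2 = Num.truncn (2 ^+ n * t).
  by rewrite exprS -mulrA truncn_half // mulr_ge0 // exprn_ge0.
have e := odd_double_half (Num.truncn (2 ^+ n.+1 * t)).
rewrite /code /= -/(code n x); split.
  move=> H; have /IH Hn : dyadic_interval n x (binary_digits t).
    by move=> i /ltnW; exact: H.
  by rewrite -e h Hn -(H n (ltnSn n)) addnC.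
move=> H; rewrite H addnC in h e.
have hn : Num.truncn (2 ^+ n * t) = code n x by rewrite -h half_bit_double.
move/IH : hn => hn i; rewrite ltnS leq_eqVlt => /orP[/eqP ->|/hn //].
by rewrite /binary_digits H oddD odd_double /= oddb.
Qed.

Lemma measurable_dyadic_interval (n : nat) (x : nat -> bool) :
  measurable (dyadic_interval n x : set walsh_group).
Proof. by apply: sub_sigma_algebra; exists n => //; exists x. Qed.

Lemma haar_dyadic_interval (n : nat) (x : nat -> bool) :
  haar (dyadic_interval n x) = (2 ^- n)%:E.
Proof.
rewrite /haar /distribution /pushforward /= /uniform_prob integral_uniform_pdf.
set A := (X in integral _ X).
have mA : measurable (A : set (measurableTypeR R)).
  apply: measurableI; last exact: measurable_itv.
  rewrite -[X in measurable X]setTI.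
  by apply: measurable_binary_digits => //; exact: measurable_dyadic_interval.
rewrite (eq_integral (fun=> 1%:E)); last first.
  move=> t; rewrite inE => -[_ /=].
  by rewrite in_itv /= /uniform_pdf => ->; rewrite subr0 invr1.
rewrite integral_cst //= mul1e.
pose c := code n x; pose I := `[c%:R / 2 ^+ n, c.+1%:R / 2 ^+ n[ : interval R.
have p0 : 0 < 2 ^+ n :> R by rewrite exprn_gt0.
have cn : c.+1%:R / 2 ^+ n <= 1 :> R.
  by rewrite ler_pdivrMr // mul1r -natrX ler_nat code_lt.
have AI : A = [set` I] `|` (A `&` [set 1]).
  apply/seteqP; split => t.
    move=> [Ht]; rewrite /= in_itv /= => /andP[t0 t1].
    have [tn1|tn1] := eqVneq t 1; [right|left].
      by split; [split; [exact: Ht|rewrite /= in_itv /= t0 t1]|exact: tn1].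
    have t01 : 0 <= t < 1 by rewrite t0 lt_neqAle tn1 t1.
    move/(binary_digits_code n x t01)/eqP: Ht.
    rewrite truncn_eq; last by rewrite mulr_ge0 // ltW.
    by rewrite /= in_itv /= ler_pdivrMr // ltr_pdivlMr // !(mulrC t).
  case=> [|[]//]; rewrite /= in_itv /= => /andP[h1 h2].
  have t0 : 0 <= t by rewrite (le_trans _ h1) // divr_ge0 // ltW.
  have t1 : t < 1 by rewrite (lt_le_trans h2).
  split; last by rewrite /= in_itv /= t0 ltW.
  apply/(binary_digits_code n x) => //; first by rewrite t0.
  apply/eqP; rewrite truncn_eq; last by rewrite mulr_ge0 // ltW.
  by rewrite !(mulrC _ t) -ler_pdivrMr // h1 -ltr_pdivlMr.
rewrite AI measureU0 /=.
- rewrite lebesgue_measure_itv /= lte_fin ltr_pM2r ?invr_gt0 // ltr_nat ltnSn.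
  by rewrite -EFinB -mulrBl -natrB // subSnn mul1r.
- exact: measurable_itv.
- by apply: measurableI => //; exact: measurable_set1.
- apply: (@subset_measure0 _ (measurableTypeR R) R lebesgue_measure _ [set 1]).
  + by apply: measurableI => //; exact: measurable_set1.
  + exact: measurable_set1.
  + by move=> ? [].
  + exact: lebesgue_measure_set1.
Qed.

Lemma haar_unique (mu : {measure set walsh_group -> \bar R}) :
  (forall n x, mu (dyadic_interval n x) = (2 ^- n)%:E) ->
  forall A, measurable A -> mu A = haar A.
Proof.
move=> Hmu; pose G : set (set walsh_group) :=
  \bigcup_n dyadic_intervals n `|` [set set0].
have mG : @measurable _ walsh_group = <<s G >>.
  apply/seteqP; split; first by apply: sub_sigma_algebra2; left.
  apply: smallest_sub; first exact: sigma_algebra_measurable.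
  by move=> _ [[n _ [x _ <-]]|->] //; exact: measurable_dyadic_interval.
have GT : G setT.
  left; exists 0%N => //; exists (fun=> false) => //.
  by apply/seteqP; split.
apply: (measure_unique G (fun=> setT)) => //.
- move=> _ _ [[n _ [x _ <-]]|->] [[m _ [y _ <-]]|->]; rewrite ?setI0 ?set0I;
    try by right.
  have [[z [zx zy]]|h] := pselect (dyadic_interval n x `&` dyadic_interval m y !=set0).
    left; exists (maxn n m) => //; exists z => //.
    apply/seteqP; split => w.
      move=> h; split => i im.
        by rewrite h ?zx // leq_max im.
      by rewrite h ?zy // leq_max im orbT.
    move=> [wx wy] i; rewrite leq_max => /orP[] im.
      by rewrite wx // zx.
    by rewrite wy // zy.
  by right; apply/eqP; apply: contra_notT h => /set0P.
- by rewrite bigcup_const //; exists 0%N.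
- move=> _ [[n _ [x _ <-]]|->]; last by rewrite !measure0.
  by rewrite Hmu; exact: (esym (haar_dyadic_interval n x)).
- move=> _; have := Hmu 0%N (fun=> false).
  rewrite [dyadic_interval _ _](_ : _ = setT); last by apply/seteqP; split.
  by move=> /= ->; rewrite ltry.
Qed.

Let preimage_walsh_add a n x :
  walsh_add a @^-1` dyadic_interval n x = dyadic_interval n (walsh_add a x).
Proof.
apply/seteqP; split => y h i ip; first by rewrite /walsh_add -(h i ip) addKb.
by rewrite /walsh_add (h i ip) addKb.
Qed.

Let measurable_walsh_add (a : walsh_group) :
  measurable_fun [set: walsh_group] (walsh_add a).
Proof.
apply: (@measurability _ _ walsh_group walsh_group setT (walsh_add a)
  (\bigcup_n dyadic_intervals n)) => //.
move=> _ [_ [n _ [x _ <-]] <-]; rewrite setTI preimage_walsh_add.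
exact: measurable_dyadic_interval.
Qed.

HB.instance Definition _ a := isMeasurableFun.Build _ _ _ _
  (walsh_add a) (measurable_walsh_add a).

Lemma haar_invariant (a : walsh_group) (A : set walsh_group) :
  measurable A -> haar (walsh_add a @^-1` A) = haar A.
Proof.
apply: (haar_unique (mu := distribution haar (walsh_add a))) => n x.
rewrite /distribution /pushforward /= preimage_walsh_add.
exact: haar_dyadic_interval.
Qed.

End haar_measure.

Section walsh_kaczmarz.
Context {R : realType}.
Implicit Types (x : walsh_group) (f : nat -> walsh_group -> R).

Definition rademacher (k : nat) x : R := (-1) ^+ x k.

Definition binary_digit (n i : nat) : nat := odd (n %/ 2 ^ i)%N.

(* For [n >= 1], [trunc_log 2 n] is the index of the leading binary digit. *)
Definition kaczmarz (n : nat) x : R :=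
  if n is 0 then 1 else
  let m := trunc_log 2 n in
  rademacher m x *
  \prod_(k < m) rademacher (m - 1 - k)%N x ^+ binary_digit n k.

(* Adaptedness is measurability for the sigma-algebra F_n generated by the
   dyadic intervals of rank n; the last clause is E[f_n | F_m] = f_m. *)
Definition dyadic_martingale f : Prop :=
  [/\ forall n, measurable_fun setT
        (f n : g_sigma_algebraType (dyadic_intervals n) -> R),
      forall n, haar.-integrable setT (EFin \o f n)
    & forall m n, (m <= n)%N -> forall A, <<s dyadic_intervals m >> A ->
        \int[haar]_(x in A) f n x = \int[haar]_(x in A) f m x].

Definition martingale_max f x : \bar R :=
  ereal_sup [set `|f n x|%:E | n in [set: nat]].

Definition hardy_norm (p : R) f : \bar R := 'N[haar]_p%:E[martingale_max f].

Definition hardy (p : R) f : Prop :=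
  dyadic_martingale f /\ (hardy_norm p f < +oo)%E.

Definition weak_norm (p : R) (g : walsh_group -> \bar R) : \bar R :=
  (ereal_sup [set (l `^ p)%:E * haar [set x | l%:E < `|g x|]
             | l in [set l : R | (0 < l)%R]] `^ p^-1)%E.

Definition bounded_hardy_weak (p : R)
    (T : (nat -> walsh_group -> R) -> walsh_group -> \bar R) : Prop :=
  exists C : R, forall f, hardy p f ->
    (weak_norm p (T f) <= C%:E * hardy_norm p f)%E.

Definition kaczmarz_coef f (i : nat) : R :=
  limn (fun n => \int[haar]_x (f n x * kaczmarz i x)).

Definition kaczmarz_partial_sum (M : nat) f x : R :=
  \sum_(0 <= i < M) kaczmarz_coef f i * kaczmarz i x.

Definition norlund_weight (q : nat -> R) (n : nat) : R := \sum_(0 <= k < n) q k.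

Definition norlund_mean (q : nat -> R) (n : nat) f x : R :=
  (norlund_weight q n)^-1 *
  \sum_(1 <= k < n.+1) q (n - k)%N * kaczmarz_partial_sum k f x.

Definition norlund_max (q : nat -> R) f x : \bar R :=
  ereal_sup [set `|norlund_mean q n f x|%:E | n in [set n | (1 <= n)%N]].

End walsh_kaczmarz.

(* Main.v *)
(** Part (a).  Write [beta] for [2 ^ alpha], so that [(2 * beta) ^ p = 2] for
    [p = 1 / (1 + alpha)].  Cutting the Nörlund sum at powers of two, reversing
    each block by [D_(2^c - i) = D_(2^c) - w D_i] and summing by parts (for which
    the monotonicity of [q] suffices), one gets [|F_n| <= C V_A] for
    [2^A < n <= 2^(A+1)], with an explicit nonnegative [V_A].  Two properties of
    [V] are enough: [E(V_A | F_M) <= C V_M] for [M <= A], and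
    [E min(1, s V_M) <= C (s / beta^M)^p].  They give
    [E min(1, t^* d) <= C D^p mu(S)] for every [d] bounded by [D], supported by an
    [F_M]-measurable set [S] and orthogonal to [F_M].  A martingale stopped when
    its predictable maximal function crosses the levels [2^k lambda] is a sum of
    such pieces, and the weak type inequality follows because [min(1, .)] is
    subadditive: no interpolation is needed.  The two growth conditions on [q]
    are only used to show that [Q_(2^l) / beta^l] is almost increasing in [l].

    Parts (b) and (c).  For [a_m = D_(2^(m+1)) - D_(2^m)] the mean
    [t_(2^m + 1) a_m] is [q_0 / Q_(2^m + 1)] times a character, so its size is
    [q_0 / Q_(2^m + 1)] everywhere, while [|a_m|_(H_p) = 2^(m (1 - 1/p))].  A
    lacunary sum of multiples of the [a_m] gives a single martingale. *)

Require Import Defs.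
From mathcomp Require Import all_boot all_order all_algebra.
From mathcomp Require Import all_classical all_reals all_analysis.
From mathcomp Require Import measurable_realfun ring lra zify.
Import Order.TTheory GRing.Theory Num.Theory.
Import numFieldNormedType.Exports.
Local Open Scope classical_set_scope.
Local Open Scope ring_scope.

Set Implicit Arguments.
Unset Strict Implicit.
Unset Printing Implicit Defensive.

(** * Averages over finitely many coordinates *)

Section Coordinates.
Implicit Types (x y z : nat -> bool) (n N : nat).

(** At level a the Kaczmarz kernels see a point through its first a coordinates in reverse order, so
    the next level inserts its new coordinate at the front, and estimates on nested cylinders do not
    follow the filtration. Hence the majorants are built by peeling off the first coordinate of the
    reversed point: each obeys a recursion in the single coordinate [x a], and estimates of means
    are inductions on the number of coordinates. That recursion dictates the exponent: to leading
    order a new coordinate doubles the majorant with probability one half and kills it otherwise,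
    while the factor beta^-a shrinks by beta, so a bound by a multiple of (s / beta^a)^p reproduces
    itself when (2 beta)^p = 2. Truncation at 1 serves twice: the indicator of t > 1 is at most
    min(1, t), and min(1, .) can be distributed over the 2^M cells of F_M as well as over the
    stopped pieces. Part (a) is first proved at a finite level N, with finite averages as integrals,
    uniformly in N. *)

Definition setc n (v : bool) x : nat -> bool := fun i => if i == n then v else x i.

Definition addc x y : nat -> bool := fun i => x i (+) y i.

(** Stands for F_N-measurability without any sigma-algebra; [dep_sigma_measurable_fun] makes the
    link. *)
Definition dep {A : Type} N (f : (nat -> bool) -> A) : Prop :=
  forall x y, (forall i, (i < N)%N -> x i = y i) -> f x = f y.

Lemma setcC m n u v x : m != n -> setc m u (setc n v x) = setc n v (setc m u x).
Proof.
move=> mn; apply: funext => i; rewrite /setc.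
by case: (i =P m) => [->|//]; rewrite (negbTE mn).
Qed.

Lemma setcK n u v x : setc n u (setc n v x) = setc n u x.
Proof. by apply: funext => i; rewrite /setc; case: eqP. Qed.

Lemma setc_id n x : setc n (x n) x = x.
Proof. by apply: funext => i; rewrite /setc; case: eqP => [->|]. Qed.

Lemma addc_setc n v x z : addc z (setc n v x) = setc n (z n (+) v) (addc z x).
Proof. by apply: funext => i; rewrite /addc /setc; case: eqP => [->|]. Qed.

Lemma dep_setc {A : Type} n v N (f : (nat -> bool) -> A) x :
  dep N f -> (N <= n)%N -> f (setc n v x) = f x.
Proof.
by move=> df Nn; apply: df => i iN; rewrite /setc ltn_eqF // (leq_trans iN).
Qed.

Lemma depS {A : Type} M N (f : (nat -> bool) -> A) : (M <= N)%N -> dep M f -> dep N f.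
Proof. by move=> MN df x y xy; apply: df => i iM; apply: xy; apply: leq_trans MN. Qed.

Lemma dep_comp {A B : Type} N (g : A -> B) (f : (nat -> bool) -> A) :
  dep N f -> dep N (fun x => g (f x)).
Proof. by move=> df x y /df ->. Qed.

Lemma dep_comp2 {A B C : Type} N (g : A -> B -> C) (f : (nat -> bool) -> A) h :
  dep N f -> dep N h -> dep N (fun x => g (f x) (h x)).
Proof. by move=> df dh x y xy; rewrite (df _ _ xy) (dh _ _ xy). Qed.

Lemma dep_addc {A : Type} N (f : (nat -> bool) -> A) z :
  dep N f -> dep N (fun x => f (addc z x)).
Proof. by move=> df x y xy; apply: df => i iN; rewrite /addc xy. Qed.

End Coordinates.

Section Mean.
Context {R : realType}.
Implicit Types (f g h : (nat -> bool) -> R) (x y z : nat -> bool) (n N : nat).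

(** For [dep n.+1 f] this is the conditional expectation on F_n. Iterating it, [mean N] averages out
    the coordinates below N and reads all others as [false]; for [dep N f] it is the Haar integral,
    by [integral_mean]. *)
Definition avg n f x : R := (f (setc n false x) + f (setc n true x)) / 2.

Fixpoint mean N f : R := if N is N'.+1 then mean N' (avg N' f) else f (fun=> false).

Lemma eq_mean N f g : (forall x, f x = g x) -> mean N f = mean N g.
Proof. by move=> fg; rewrite (funext fg). Qed.

Lemma le_mean N f g : (forall x, f x <= g x) -> mean N f <= mean N g.
Proof.
elim: N f g => [|N IH] f g fg /=; first exact: fg.
by apply: IH => x; rewrite /avg ler_pM2r // lerD.
Qed.

Lemma meanD N f g : mean N (fun x => f x + g x) = mean N f + mean N g.
Proof.
elim: N f g => [//|N IH] f g /=; rewrite -IH; apply: eq_mean => x.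
by rewrite /avg; field.
Qed.

Lemma meanZ N c f : mean N (fun x => c * f x) = c * mean N f.
Proof.
elim: N f => [//|N IH] f /=; rewrite -IH; apply: eq_mean => x.
by rewrite /avg; field.
Qed.

Lemma mean_cst N c : mean N (fun=> c) = c.
Proof. by elim: N => //= N IH; rewrite -[RHS]IH; apply: eq_mean => x; rewrite /avg; field. Qed.

Lemma mean_ge0 N f : (forall x, 0 <= f x) -> 0 <= mean N f.
Proof. by move=> f0; rewrite -(mean_cst N 0); apply: le_mean. Qed.

Lemma mean_sum N (I : Type) (r : seq I) (P : pred I) (F : I -> (nat -> bool) -> R) :
  mean N (fun x => \sum_(i <- r | P i) F i x) = \sum_(i <- r | P i) mean N (F i).
Proof.
elim: r => [|i r IH].
  by rewrite big_nil -[RHS](mean_cst N); apply: eq_mean => x; rewrite big_nil.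
rewrite big_cons -IH; case: ifP => Pi; rewrite -?meanD; apply: eq_mean => x;
  by rewrite big_cons Pi.
Qed.

Lemma norm_mean N f : `|mean N f| <= mean N (fun x => `|f x|).
Proof.
elim: N f => [//|N IH] f /=; apply: le_trans (IH _) _; apply: le_mean => x.
rewrite /avg normrM [`|2^-1|]ger0_norm ?invr_ge0 //.
by rewrite ler_pM2r // ler_normD.
Qed.

Lemma dep_avg n f : dep n.+1 f -> dep n (avg n f).
Proof.
move=> df x y xy; rewrite /avg; congr ((_ + _) / 2); apply: df => i;
  by rewrite ltnS leq_eqVlt /setc; case: eqP => //= _ /xy.
Qed.

Lemma avg_dep n N f : (N <= n)%N -> dep N f -> avg n f = f.
Proof.
by move=> Nn df; apply: funext => x; rewrite /avg !(dep_setc _ _ df Nn); field.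
Qed.

Lemma mean_dep M N f : (M <= N)%N -> dep M f -> mean N f = mean M f.
Proof.
move=> /subnK <- df; elim: (N - M)%N => [//|k IH].
by rewrite addSn /= (@avg_dep _ M) // leq_addl.
Qed.

Lemma mean_avg N n f : (n < N)%N -> mean N (avg n f) = mean N f.
Proof.
elim: N f => [//|N IH] f; rewrite ltnS leq_eqVlt => /predU1P[->|nN] /=.
  by apply: eq_mean => x; rewrite /avg !setcK; field.
rewrite -[RHS]IH //; apply: eq_mean => x; rewrite /avg.
by rewrite !(setcC _ _ _ (negbT (ltn_eqF nN))); field.
Qed.

Lemma mean_addc N f z : dep N f -> mean N (fun x => f (addc z x)) = mean N f.
Proof.
elim: N f => [|N IH] f df /=; first exact: df.
rewrite -(IH _ (dep_avg df)); apply: eq_mean => x; rewrite /avg !addc_setc.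
by case: (z N) => //=; rewrite addrC.
Qed.

Lemma exchange_mean M N (f : (nat -> bool) -> (nat -> bool) -> R) :
  mean M (fun x => mean N (f x)) = mean N (fun y => mean M (f ^~ y)).
Proof.
elim: M f => [//|M IH] f /=; rewrite -IH; apply: eq_mean => x.
rewrite /avg -meanD mulrC -meanZ; apply: eq_mean => y; by rewrite mulrC.
Qed.

(** Such a function takes 2^N values of equal weight, and each is at most their sum. *)
Lemma le_mean_dep N f x : (forall y, 0 <= f y) -> dep N f -> f x <= 2 ^+ N * mean N f.
Proof.
elim: N f x => [|N IH] f x f0 df /=; first by rewrite mul1r (df x (fun=> false)).
have g0 y : 0 <= avg N f y by rewrite divr_ge0 // addr_ge0.
rewrite exprSr -mulrA mulrCA; apply: le_trans (_ : 2 * avg N f x <= _).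
  rewrite /avg mulrC divfK // -{1}(setc_id N x).
  by case: (x N); rewrite ?lerDl ?lerDr.
by rewrite ler_pM2l //; apply: IH => //; exact: dep_avg.
Qed.

Lemma min1D (a b : R) : 0 <= a -> 0 <= b ->
  Num.min 1 (a + b) <= Num.min 1 a + Num.min 1 b.
Proof. by case: (leP 1 a); case: (leP 1 b); case: (leP 1 (a + b)); lra. Qed.

(** [mean M] averages over 2^M points; as truncation is subadditive, it may be applied to the share
    [2 ^- M * f x] of each point before summing. This is how a truncated integral over a set is
    distributed over its cells. *)
Lemma min1_mean M f : (forall x, 0 <= f x) ->
  Num.min 1 (mean M f) <= 2 ^+ M * mean M (fun x => Num.min 1 (2 ^- M * f x)).
Proof.
elim: M f => [|M IH] f f0 /=; first by rewrite expr0 invr1 !mul1r.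
apply: le_trans (IH _ _) _; first by move=> x; rewrite divr_ge0 // addr_ge0.
rewrite exprSr -mulrA ler_pM2l ?exprn_gt0 // -meanZ; apply: le_mean => x.
rewrite /avg.
have -> : 2 ^- M * ((f (setc M false x) + f (setc M true x)) / 2) =
    2 ^- M.+1 * f (setc M false x) + 2 ^- M.+1 * f (setc M true x).
  by rewrite exprS invfM; field.
rewrite [leRHS]mulrC divfK //.
by rewrite -!exprSr; apply: min1D; rewrite mulr_ge0 // invr_ge0 exprn_ge0.
Qed.

End Mean.

(** * Walsh-Paley kernels *)

Section WalshDirichlet.
Context {R : realType}.
Implicit Types (s x y : nat -> bool) (i j k l m n a c : nat).

(** The range [k < n] covers all binary digits because n < 2^n; [walshE] allows any other sufficient
    cutoff. *)
Definition walsh n s : R := \prod_(k < n) @rademacher R k s ^+ binary_digit n k.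

Definition dirichlet n s : R := \sum_(i < n) walsh i s.

Definition cyl n s : R := \prod_(i < n) (~~ s i)%:R.

(* The first [a] coordinates in reverse order: the Kaczmarz functions of index
   in [2^a, 2^(a+1)[ are the Paley functions evaluated at such points. *)
Definition revc a x : nat -> bool := fun i => x (a - 1 - i)%N.

Lemma binary_digit_small n k : (n < 2 ^ k)%N -> binary_digit n k = 0%N.
Proof. by move=> h; rewrite /binary_digit divn_small. Qed.

Lemma binary_digit_lo c i k : (k < c)%N -> binary_digit (2 ^ c + i) k = binary_digit i k.
Proof.
move=> kc; rewrite /binary_digit -{1}(subnK (ltnW kc)) expnD divnMDl ?expn_gt0 //.
by rewrite oddD oddX /= subn_eq0 leqNgt kc.
Qed.

Lemma binary_digit_top c i : (i < 2 ^ c)%N -> binary_digit (2 ^ c + i) c = 1%N.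
Proof.
by move=> h; rewrite /binary_digit divnDl ?dvdnn // divnn expn_gt0 /= divn_small.
Qed.

Lemma walshE N n s : (n < 2 ^ N)%N ->
  walsh n s = \prod_(k < N) @rademacher R k s ^+ binary_digit n k.
Proof.
have ext (M d : nat) : (n < 2 ^ M)%N ->
    \prod_(k < M) @rademacher R k s ^+ binary_digit n k =
    \prod_(k < M + d) @rademacher R k s ^+ binary_digit n k.
  move=> nM; elim: d => [|d IH]; first by rewrite addn0.
  rewrite addnS big_ord_recr /= -IH binary_digit_small ?expr0 ?mulr1 //.
  by rewrite (leq_trans nM) // leq_exp2l // leq_addr.
move=> nN; have nn : (n < 2 ^ n)%N by apply: ltn_expl.
by rewrite (ext N n nN) addnC -(ext n N nn).
Qed.

Lemma walsh_top c i s : (i < 2 ^ c)%N ->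
  walsh (2 ^ c + i) s = @rademacher R c s * walsh i s.
Proof.
move=> ic; have lt : (2 ^ c + i < 2 ^ c.+1)%N by rewrite expnS mul2n -addnn ltn_add2l.
rewrite (walshE s lt) big_ord_recr /= binary_digit_top // expr1 mulrC (walshE s ic).
by congr (_ * _); apply: eq_bigr => k _; rewrite binary_digit_lo.
Qed.

Lemma rademacher_flip k s : @rademacher R k s = (~~ s k)%:R - (s k)%:R.
Proof. by rewrite /rademacher; case: (s k); rewrite ?expr1 ?expr0 /=; ring. Qed.

Lemma norm_rademacher k s : `|@rademacher R k s| = 1.
Proof. by rewrite /rademacher normrX normrN1 expr1n. Qed.

Lemma cylS n s : cyl n.+1 s = cyl n s * (~~ s n)%:R.
Proof. by rewrite /cyl big_ord_recr. Qed.

Lemma cyl_bool n s : cyl n s = 1 \/ cyl n s = 0.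
Proof.
elim: n => [|n [] IH]; first by left; rewrite /cyl big_ord0.
  by rewrite cylS IH mul1r; case: (s n); [right|left].
by right; rewrite cylS IH mul0r.
Qed.

Lemma cyl_ge0 n s : 0 <= cyl n s.
Proof. by case: (cyl_bool n s) => ->. Qed.

Lemma dirichlet_add c j s : (j <= 2 ^ c)%N ->
  dirichlet (2 ^ c + j) s = dirichlet (2 ^ c) s + @rademacher R c s * dirichlet j s.
Proof.
move=> jc; rewrite /dirichlet big_split_ord /=; congr (_ + _).
rewrite mulr_sumr; apply: eq_bigr => i _; apply: walsh_top.
exact: leq_trans (ltn_ord i) jc.
Qed.

Lemma dirichlet0 s : dirichlet 0 s = 0.
Proof. by rewrite /dirichlet big_ord0. Qed.

Lemma dirichlet_pow c s : dirichlet (2 ^ c) s = 2 ^+ c * cyl c s.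
Proof.
elim: c => [|c IH].
  by rewrite /dirichlet /cyl expn0 big_ord1 big_ord0 /walsh big_ord0 mulr1.
rewrite expnS mul2n -addnn dirichlet_add // IH cylS exprS rademacher_flip.
by case: (s c) => /=; ring.
Qed.

Definition walsh_full c s : R := \prod_(k < c) @rademacher R k s.

Lemma norm_walsh_full c s : `|walsh_full c s| = 1.
Proof. by rewrite /walsh_full normr_prod big1 // => k _; rewrite norm_rademacher. Qed.

Lemma walsh_full_cyl c s : walsh_full c s * cyl c s = cyl c s.
Proof.
elim: c => [|c IH]; first by rewrite /walsh_full big_ord0 mul1r.
rewrite /walsh_full big_ord_recr /= -/(walsh_full c s) cylS rademacher_flip.
rewrite mulrACA IH; case: (s c) => /=; ring.
Qed.

(** Complementing binary digits gives w_(2^c-1-j) = w_(2^c-1) w_j, where [walsh_full c] is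
    w_(2^c-1): the last i terms of D_(2^c) are the first i multiplied by it. The induction on c
    obtains this digit by digit. *)
Lemma dirichlet_sub c i s : (i <= 2 ^ c)%N ->
  dirichlet (2 ^ c - i) s = dirichlet (2 ^ c) s - walsh_full c s * dirichlet i s.
Proof.
elim: c i => [|c IH] i.
  rewrite expn0 /walsh_full big_ord0 mul1r; case: i => [|[|//]] _.
    by rewrite dirichlet0 subr0.
  by rewrite subrr subnn dirichlet0.
have ->: walsh_full c.+1 s = walsh_full c s * @rademacher R c s.
  by rewrite /walsh_full big_ord_recr.
have e1 := walsh_full_cyl c s.
have rr : @rademacher R c s * @rademacher R c s = 1.
  by rewrite rademacher_flip; case: (s c) => /=; ring.
rewrite expnS mul2n -addnn (dirichlet_add _ (leqnn _)); case: (leqP i (2 ^ c)) => h hi.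
  rewrite -addnBA // dirichlet_add ?leq_subr // IH //.
  ring.
have [k [-> kc]] : exists k, i = (2 ^ c + k)%N /\ (k <= 2 ^ c)%N.
  by exists (i - 2 ^ c)%N; split; [rewrite subnKC // ltnW | rewrite leq_subLR].
rewrite subnDl IH // dirichlet_add // !dirichlet_pow.
have aux (u v w z : R) : u * v * (2 ^+ c * w + v * z) =
    v * 2 ^+ c * (u * w) + v * v * (u * z) by ring.
by rewrite aux e1 rr; ring.
Qed.

Lemma sum_dirichlet_add c j s : (j <= 2 ^ c)%N ->
  \sum_(i < 2 ^ c + j) dirichlet i s =
  \sum_(i < 2 ^ c) dirichlet i s + j%:R * dirichlet (2 ^ c) s +
  @rademacher R c s * \sum_(i < j) dirichlet i s.
Proof.
move=> jc; rewrite big_split_ord /= -addrA; congr (_ + _).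
rewrite (eq_bigr (fun i : 'I_j => dirichlet (2 ^ c) s + @rademacher R c s * dirichlet i s)).
  by rewrite big_split /= sumr_const card_ord -mulr_sumr mulr_natl.
by move=> i _; rewrite dirichlet_add // (leq_trans (ltnW (ltn_ord i))).
Qed.

End WalshDirichlet.

(** * Majorants of Walsh-Paley kernels and summation by parts *)

Section PaleyMajorant.
Context {R : realType}.
Implicit Types (s x y : nat -> bool) (i j k l m n a c : nat).

Definition shiftc s : nat -> bool := fun i => s i.+1.

(* [Lam l] dominates [D_(2^l)] and the Fejér kernel [K_(2^l)]. *)
Fixpoint Lam l s : R :=
  if l is l'.+1 then 2 * (~~ s 0%N)%:R * Lam l' (shiftc s) + cyl l' (shiftc s)
  else 1.

Lemma cyl_shift l s : cyl l.+1 s = (~~ s 0%N)%:R * cyl l (shiftc s) :> R.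
Proof. by rewrite /cyl big_ord_recl. Qed.

Lemma Lam_ge0 l s : 0 <= Lam l s.
Proof.
by elim: l s => [|l IH] s //=; rewrite addr_ge0 ?cyl_ge0 // !mulr_ge0.
Qed.

(** [Lam] peels off coordinate 0, as reversed points require, whereas Dirichlet sums grow at the top
    coordinate. This is the recursion seen from the other end, up to a nonnegative remainder. *)
Lemma LamS l s : (~~ s l)%:R * Lam l s + 2 ^+ l * cyl l s <= Lam l.+1 s.
Proof.
elim: l s => [|l IH] s.
  by rewrite /= /cyl !big_ord0; case: (s 0%N) => /=; lra.
have -> : Lam l.+2 s = 2 * (~~ s 0%N)%:R * Lam l.+1 (shiftc s) + cyl l.+1 (shiftc s) by [].
have -> : Lam l.+1 s = 2 * (~~ s 0%N)%:R * Lam l (shiftc s) + cyl l (shiftc s) by [].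
rewrite (cyl_shift l s) exprS cylS -[shiftc s l]/(s l.+1).
have := IH (shiftc s); rewrite -[shiftc s l]/(s l.+1).
have := cyl_ge0 l (shiftc s) (R := R).
move: (Lam l.+1 _) (Lam l _) (cyl l _) => u v w.
case: (s 0%N) => /=; case: (s l.+1) => /=; lra.
Qed.

Lemma pow_cyl_le_Lam l s : 2 ^+ l * cyl l s <= Lam l s.
Proof.
elim: l => [|l IH]; first by rewrite /cyl big_ord0 mulr1.
apply: le_trans (LamS l s); rewrite cylS exprS; have := cyl_ge0 l s (R := R); move: IH.
have : 0 <= 2 ^+ l :> R by rewrite exprn_ge0.
case: (s l) => /=; nra.
Qed.

Lemma dirichlet_pow_le l s : dirichlet (2 ^ l) s <= Lam l s.
Proof. by rewrite dirichlet_pow pow_cyl_le_Lam. Qed.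

Lemma dirichlet_pow_ge0 l s : 0 <= dirichlet (2 ^ l) s :> R.
Proof. by rewrite dirichlet_pow mulr_ge0 ?cyl_ge0 // exprn_ge0. Qed.

Lemma sum_dirichlet_pow c s :
  `|\sum_(i < 2 ^ c) dirichlet i s| <= 2 ^+ c * Lam c s.
Proof.
elim: c => [|c IH].
  by rewrite expn0 big_ord1 dirichlet0 normr0 mul1r.
rewrite expnS mul2n -addnn sum_dirichlet_add //.
set X := \sum_(i < _) _ in IH *.
have -> : X + (2 ^ c)%:R * dirichlet (2 ^ c) s + rademacher c s * X =
   2 * (~~ s c)%:R * X + 2 ^+ c * (2 ^+ c * cyl c s).
  by rewrite natrX dirichlet_pow rademacher_flip; case: (s c) => /=; ring.
apply: le_trans (ler_normD _ _) _.
rewrite !normrM !normrX !normr_nat (ger0_norm (cyl_ge0 _ _)).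
have p0 : 0 <= 2 ^+ c :> R by rewrite exprn_ge0.
have h1 := ler_wpM2l (mulr_ge0 (ler0n R 2) p0) (LamS c s).
have h2 : 0 <= 2 ^+ c * (2 ^+ c * cyl c s) :> R by rewrite !mulr_ge0 ?cyl_ge0.
rewrite exprS; move: h1 h2 IH (Lam_ge0 c s).
case: (s c) => /=; lra.
Qed.

(** The restriction [2 ^ l < k] makes the bound, as k varies, the partial sums of one fixed sequence
    supported at the powers of two: the form that [abel_le] requires. *)
Lemma sum_dirichlet_le c k s : (k <= 2 ^ c)%N ->
  `|\sum_(i < k) dirichlet i s| <=
  2 * \sum_(l < c | (2 ^ l < k)%N) 2 ^+ l * Lam l s.
Proof.
have pos (P : pred nat) (d : nat) : 0 <= \sum_(l < d | P l) 2 ^+ l * Lam l s.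
  by apply: sumr_ge0 => l _; rewrite mulr_ge0 ?exprn_ge0 ?Lam_ge0.
elim: c k => [|c IH] k.
  rewrite expn0 big_ord0 mulr0; case: k => [|[|//]] _; first by rewrite big_ord0 normr0.
  by rewrite big_ord1 dirichlet0 normr0.
case: (leqP k (2 ^ c)) => h hk.
  by rewrite [X in _ <= 2 * X]big_mkcond [X in _ <= 2 * X]big_ord_recr /= ltnNge h /= addr0 -big_mkcond; exact: IH.
have [j ek] : exists j, k = (2 ^ c + j)%N.
  by exists (k - 2 ^ c)%N; rewrite subnKC // ltnW.
have jc : (j <= 2 ^ c)%N by move: hk; rewrite ek expnS mul2n -addnn leq_add2l.
have -> : \sum_(l < c.+1 | (2 ^ l < k)%N) 2 ^+ l * Lam l s =
    \sum_(l < c) 2 ^+ l * Lam l s + 2 ^+ c * Lam c s.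
  rewrite big_mkcond big_ord_recr /= h; congr (_ + _); apply: eq_bigr => l _.
  by rewrite (leq_trans _ h) // ltnS leq_exp2l // ltnW.
rewrite ek sum_dirichlet_add //.
have h1 := sum_dirichlet_pow c s.
have h2 : `|j%:R * dirichlet (2 ^ c) s| <= 2 ^+ c * Lam c s.
  rewrite normrM normr_nat (ger0_norm (dirichlet_pow_ge0 _ _)).
  apply: ler_pM => //; [exact: dirichlet_pow_ge0| |exact: dirichlet_pow_le].
  by rewrite -natrX ler_nat.
have h3 : `|rademacher c s * \sum_(i < j) dirichlet i s| <=
    2 * \sum_(l < c) 2 ^+ l * Lam l s.
  rewrite normrM norm_rademacher mul1r; apply: le_trans (IH _ jc) _.
  rewrite ler_pM2l // [leLHS]big_mkcond; apply: ler_sum => l _.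
  by case: ifP => // _; rewrite mulr_ge0 ?exprn_ge0 ?Lam_ge0.
apply: le_trans (ler_normD _ _) _; apply: le_trans (lerD (ler_normD _ _) (lexx _)) _.
lra.
Qed.

Lemma abel_ge0 (v u : nat -> R) n :
  (forall i, 0 <= v i) -> nonincreasing_seq v ->
  (forall k, (k <= n)%N -> 0 <= \sum_(i < k) u i) -> 0 <= \sum_(i < n) v i * u i.
Proof.
move=> v0 vi up; case: n up => [|n] up; first by rewrite big_ord0.
suff : v n * \sum_(i < n.+1) u i <= \sum_(i < n.+1) v i * u i.
  by apply: le_trans; rewrite mulr_ge0 ?up.
elim: n up => [|n IH] up; first by rewrite !big_ord1.
rewrite [leRHS]big_ord_recr /= big_ord_recr /= mulrDr lerD2r.
apply: le_trans (IH _); last by move=> k kn; apply: up; rewrite ltnW.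
by rewrite ler_wpM2r ?up // vi.
Qed.

(** Domination of partial sums says that e + d and e - d have nonnegative partial sums, and
    [abel_ge0] shows that nonincreasing weights preserve this. *)
Lemma abel_le (v d e : nat -> R) n :
  (forall i, 0 <= v i) -> nonincreasing_seq v ->
  (forall k, (k <= n)%N -> `|\sum_(i < k) d i| <= \sum_(i < k) e i) ->
  `|\sum_(i < n) v i * d i| <= \sum_(i < n) v i * e i.
Proof.
move=> v0 vi de; rewrite ler_norml lerNl -subr_ge0 -[X in _ && X]subr_ge0.
rewrite -!sumrN -!big_split /=; apply/andP; split.
  under eq_bigr do rewrite opprK -mulrDr.
  apply: (abel_ge0 (u := fun i => e i + d i)) => // k /de.
  by rewrite big_split /= ler_norml lerNl -subr_ge0 opprK => /andP[].
under eq_bigr do rewrite -mulrN -mulrDr.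
apply: (abel_ge0 (u := fun i => e i - d i)) => // k /de.
by rewrite sumrB ler_norml subr_ge0 => /andP[].
Qed.

Section Norlund.
Variables (q : nat -> R).
Hypothesis q_ge0 : forall k, 0 <= q k.
Hypothesis q_noninc : nonincreasing_seq q.

Lemma sum_q_dirichlet_le c j s :
  `|\sum_(i < 2 ^ c) q (j + i)%N * dirichlet i s| <=
  2 * \sum_(l < c) 2 ^+ l * q (j + 2 ^ l)%N * Lam l s.
Proof.
(* A spike at each power of two, with partial sums equal to the bound of [sum_dirichlet_le]; thus q
   is sampled only at the points j + 2^l. *)
pose e i := \sum_(l < c) (i == 2 ^ l)%N%:R * (2 * (2 ^+ l * Lam l s)).
have se k : \sum_(i < k) e i = 2 * \sum_(l < c | (2 ^ l < k)%N) 2 ^+ l * Lam l s.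
  rewrite exchange_big /= mulr_sumr [RHS]big_mkcond; apply: eq_bigr => l _.
  rewrite -mulr_suml; case: ifP => h.
    rewrite (bigD1 (Ordinal h)) //= eqxx big1 ?addr0 ?mul1r // => i.
    by rewrite -val_eqE /= => /negbTE ->.
  rewrite big1 ?mul0r // => i _; case: eqP => // ei.
  by rewrite -ei ltn_ord in h.
have -> : 2 * \sum_(l < c) 2 ^+ l * q (j + 2 ^ l)%N * Lam l s =
    \sum_(i < 2 ^ c) q (j + i)%N * e i.
  under [RHS]eq_bigr do rewrite mulr_sumr.
  rewrite exchange_big /= mulr_sumr; apply: eq_bigr => l _.
  have h : (2 ^ l < 2 ^ c)%N by rewrite ltn_exp2l.
  rewrite (bigD1 (Ordinal h)) //= eqxx big1 ?addr0 ?mul1r; first by ring.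
  by move=> i; rewrite -val_eqE /= => /negbTE ->; rewrite mul0r mulr0.
apply: (abel_le (v := fun i => q (j + i)%N) (d := dirichlet ^~ s)) => //.
- by move=> a b ab; apply: q_noninc; rewrite leq_add2l.
- by move=> k kc; rewrite se; exact: sum_dirichlet_le.
Qed.

Definition paley_sum m s := \sum_(i < m) q i * dirichlet (m - i) s.

Lemma norlund_weightE n : norlund_weight q n = \sum_(i < n) q i.
Proof. by rewrite /norlund_weight big_mkord. Qed.

Lemma sum_q_dirichlet_sub c j s :
  \sum_(i < 2 ^ c) q (j + i)%N * dirichlet (2 ^ c - i) s =
  (\sum_(i < 2 ^ c) q (j + i)%N) * dirichlet (2 ^ c) s -
  walsh_full c s * \sum_(i < 2 ^ c) q (j + i)%N * dirichlet i s.
Proof.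
rewrite mulr_suml mulr_sumr -sumrB; apply: eq_bigr => i _.
by rewrite dirichlet_sub ?(ltnW (ltn_ord i)) //; ring.
Qed.

(** For i < j the degree is 2^c + (j - i) and [dirichlet_add] applies; the 2^c remaining terms have
    degrees at most 2^c and are reversed by [dirichlet_sub]. Both parts contribute to the
    coefficient of D_(2^c), which adds up to the full weight. *)
Lemma paley_sum_add c j s : (j <= 2 ^ c)%N ->
  paley_sum (2 ^ c + j) s = norlund_weight q (2 ^ c + j) * dirichlet (2 ^ c) s +
    rademacher c s * paley_sum j s -
    walsh_full c s * \sum_(i < 2 ^ c) q (j + i)%N * dirichlet i s.
Proof.
move=> jc; rewrite norlund_weightE /paley_sum addnC !big_split_ord /=.
have -> : \sum_(i < j) q i * dirichlet (j + 2 ^ c - i) s =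
    (\sum_(i < j) q i) * dirichlet (2 ^ c) s +
    rademacher c s * \sum_(i < j) q i * dirichlet (j - i) s.
  rewrite mulr_suml mulr_sumr -big_split; apply: eq_bigr => i _ /=.
  rewrite addnC -addnBA ?(ltnW (ltn_ord i)) //.
  by rewrite dirichlet_add ?(leq_trans (leq_subr _ _)) //; ring.
under [X in _ + X = _]eq_bigr do rewrite subnDl.
by rewrite sum_q_dirichlet_sub; ring.
Qed.

End Norlund.
End PaleyMajorant.

Arguments Lam {R} l s : simpl never.
#[global] Hint Extern 0 (is_true (0 <= Lam _ _)) => apply: Lam_ge0 : core.

Section NorlundWeight.
Context {R : realType}.
Variables (q : nat -> R).
Hypothesis q_ge0 : forall k, 0 <= q k.
Hypothesis q_noninc : nonincreasing_seq q.

Lemma norlund_weightD m k :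
  norlund_weight q (m + k) = norlund_weight q m + \sum_(i < k) q (m + i)%N.
Proof. by rewrite !norlund_weightE big_split_ord. Qed.

Lemma norlund_weight_le m n : (m <= n)%N -> norlund_weight q m <= norlund_weight q n.
Proof.
move=> /subnKC <-; rewrite norlund_weightD lerDl; exact: sumr_ge0.
Qed.

Lemma norlund_weight_ge0 n : 0 <= norlund_weight q n.
Proof. by rewrite norlund_weightE sumr_ge0. Qed.

Lemma sum_q_le m k : \sum_(i < k) q (m + i)%N <= norlund_weight q k.
Proof.
rewrite norlund_weightE; apply: ler_sum => i _; apply: q_noninc; exact: leq_addl.
Qed.

Lemma norlund_weightD_le m k :
  norlund_weight q (m + k) <= norlund_weight q m + norlund_weight q k.
Proof. by rewrite norlund_weightD lerD2l sum_q_le. Qed.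

Lemma q_le_weight n : n%:R * q n <= norlund_weight q n.
Proof.
rewrite norlund_weightE -[X in X%:R * _]card_ord mulr_natl -sumr_const.
by apply: ler_sum => i _; apply: q_noninc; exact: ltnW.
Qed.

End NorlundWeight.

(** * Nörlund sums of Walsh-Paley Dirichlet kernels *)

Section PaleyNorlundBound.
Context {R : realType}.
Variables (q : nat -> R) (beta B : R) (A : nat).
Hypothesis q_ge0 : forall k, 0 <= q k.
Hypothesis q_noninc : nonincreasing_seq q.
Hypothesis beta_gt1 : 1 < beta.
Hypothesis beta_lt2 : beta < 2.
Hypothesis weightB : forall l, (l <= A)%N -> norlund_weight q (2 ^ l) <= B * beta ^+ l.

Let rho : R := beta / 2.
Let C2 : R := 8 / (2 - beta).

Let B_ge0 : 0 <= B.
Proof.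
by have := weightB (leq0n A); rewrite expr0 mulr1; apply: le_trans;
  exact: norlund_weight_ge0.
Qed.

Let b_gt0 : 0 < beta. Proof. exact: lt_trans beta_gt1. Qed.
Let rho_ge0 : 0 <= rho. Proof. by rewrite divr_ge0 // ltW. Qed.
Let rho_le1 : rho <= 1. Proof. by rewrite ler_pdivrMr // mul1r ltW. Qed.
Let C2_ge0 : 0 <= C2. Proof. by rewrite divr_ge0 // subr_ge0 ltW. Qed.
Let C2E : C2 * (1 - rho) = 4.
Proof. by rewrite /C2 /rho; field; rewrite subr_eq0 gt_eqF. Qed.

(** Each step of the induction on c leaves errors of relative size at most 4 rho^(c - l) at level l.
    These coefficients start at 1 and grow by exactly that amount, and [C2], defined by C2 (1 - rho)
    = 4, keeps them below C2 + 1 for all c. *)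
Let coef c l : R := C2 + 1 - C2 * rho ^+ (c - l).

Let coef_ge1 c l : 1 <= coef c l.
Proof.
rewrite /coef addrAC -{1}[1]add0r lerD2r subr_ge0 -[leRHS]mulr1.
by rewrite ler_wpM2l // exprn_ile1.
Qed.

Let coefS c l : (l <= c)%N -> coef c.+1 l = coef c l + 4 * rho ^+ (c - l).
Proof. by move=> lc; rewrite /coef subSn // exprS -C2E; ring. Qed.

Let sum_coefS c s :
  B * \sum_(l < c.+1) coef c l * beta ^+ l * Lam l s +
  4 * B * (rho ^+ c * \sum_(l < c) 2 ^+ l * Lam l s + beta ^+ c * Lam c s) <=
  B * \sum_(l < c.+2) coef c.+1 l * beta ^+ l * Lam l s.
Proof.
rewrite [in leRHS]big_ord_recr /= [leRHS]mulrDr.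
apply: ler_wpDr.
  rewrite !mulr_ge0 ?Lam_ge0 ?exprn_ge0 // ?(ltW b_gt0) //.
  exact: le_trans (coef_ge1 _ _).
have -> : \sum_(l < c.+1) coef c.+1 l * beta ^+ l * Lam l s =
    \sum_(l < c.+1) coef c l * beta ^+ l * Lam l s +
    4 * (rho ^+ c * \sum_(l < c.+1) 2 ^+ l * Lam l s).
  rewrite !mulr_sumr -big_split; apply: eq_bigr => l _ /=.
  rewrite coefS -1?ltnS //.
  have e : rho ^+ c * 2 ^+ l = rho ^+ (c - l) * beta ^+ l.
    rewrite -{1}(@subnK l c) -1?ltnS // exprD -mulrA -exprMn /rho divfK //.
  have -> : 4 * (rho ^+ c * (2 ^+ l * Lam l s)) = 4 * (rho ^+ c * 2 ^+ l) * Lam l s.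
    by ring.
  by rewrite e; ring.
have e2 : rho ^+ c * (2 ^+ c * Lam c s) = beta ^+ c * Lam c s.
  by rewrite mulrA -exprMn /rho divfK.
have -> : \sum_(l < c.+1) 2 ^+ l * Lam l s =
    \sum_(l < c) 2 ^+ l * Lam l s + 2 ^+ c * Lam c s :> R.
  by rewrite big_ord_recr.
rewrite (mulrDr (rho ^+ c)) e2 le_eqVlt; apply/orP; left; apply/eqP.
by ring.
Qed.

(* The induction on [c] only closes thanks to the second summand: the Abel
   remainders of the successive binary digits of [m] telescope. *)
Let paley_sum_bound c m s : (c <= A)%N -> (m <= 2 ^ c)%N ->
  `|paley_sum q m s| + 2 * \sum_(l < c) 2 ^+ l * q (maxn m (2 ^ l)) * Lam l s <=
  B * \sum_(l < c.+1) coef c l * beta ^+ l * Lam l s.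
Proof.
elim: c m => [|c IH] m cA mc.
  rewrite big_ord0 mulr0 addr0 big_ord1 expr0 mulr1 mulr1.
  have -> : coef 0 0 = 1 by rewrite /coef expr0; ring.
  rewrite mulr1; have := weightB (leq0n A); rewrite expr0 mulr1; apply: le_trans.
  case: m mc => [|[|//]] _; rewrite /paley_sum.
    by rewrite big_ord0 normr0 norlund_weight_ge0.
  rewrite big_ord1 expn0 subn0 norlund_weightE big_ord1.
  rewrite -[X in dirichlet X](expn0 2) dirichlet_pow /cyl big_ord0 !mulr1.
  by rewrite ger0_norm.
have cA' := ltnW cA.
apply: le_trans (sum_coefS c s).
have L0 l : 0 <= Lam l s by exact: Lam_ge0.
set X := \sum_(l < c) 2 ^+ l * Lam l s.
have hq : q (2 ^ c)%N * 2 ^+ c <= B * beta ^+ c.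
  by apply: le_trans (weightB cA'); rewrite mulrC -natrX; exact: q_le_weight.
have hqr : q (2 ^ c)%N <= B * rho ^+ c.
  by rewrite /rho expr_div_n mulrA ler_pdivlMr ?exprn_gt0.
have X0 : 0 <= X by apply: sumr_ge0 => l _; rewrite mulr_ge0 ?exprn_ge0 ?Lam_ge0.
have pc : 0 <= 2 ^+ c :> R by rewrite exprn_ge0.
have bc : 0 <= beta ^+ c by rewrite exprn_ge0 // ltW.
have rc : 0 <= rho ^+ c by rewrite exprn_ge0.
have h1 : 2 * (2 ^+ c * q (maxn m (2 ^ c)) * Lam c s) <= 2 * B * (beta ^+ c * Lam c s).
  rewrite -!mulrA ler_pM2l // !mulrA ler_wpM2r //; apply: le_trans hq.
  by rewrite mulrC ler_wpM2r // q_noninc // leq_maxr.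
rewrite big_ord_recr /= mulrDr addrA.
have Y0 : 0 <= B * (beta ^+ c * Lam c s) by rewrite !mulr_ge0.
have Z0 : 0 <= B * (rho ^+ c * X) by rewrite !mulr_ge0.
case: (boolP (m <= 2 ^ c)%N) => [h|]; last (rewrite -ltnNge => h).
  by have := IH m cA' h; lra.
have [j em] : exists j, m = (2 ^ c + j)%N.
  by exists (m - 2 ^ c)%N; rewrite subnKC // ltnW.
have jc : (j <= 2 ^ c)%N by move: mc; rewrite em expnS mul2n -addnn leq_add2l.
have h2 : 2 * \sum_(l < c) 2 ^+ l * q (maxn m (2 ^ l)) * Lam l s <=
    2 * B * (rho ^+ c * X).
  rewrite -!mulrA ler_pM2l // /X !mulr_sumr; apply: ler_sum => l _.
  have -> : B * (rho ^+ c * (2 ^+ l * Lam l s)) = 2 ^+ l * (B * rho ^+ c) * Lam l s.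
    by ring.
  rewrite ler_wpM2r // ler_wpM2l ?exprn_ge0 //; apply: le_trans hqr.
  by apply: q_noninc; rewrite leq_max (ltnW h).
have h3 : `|norlund_weight q m * dirichlet (2 ^ c) s| <= 2 * B * (beta ^+ c * Lam c s).
  rewrite ger0_norm; last first.
    by rewrite mulr_ge0 ?norlund_weight_ge0 ?dirichlet_pow_ge0.
  rewrite mulrA; apply: ler_pM;
    rewrite ?norlund_weight_ge0 ?dirichlet_pow_ge0 ?dirichlet_pow_le //.
  apply: (le_trans (norlund_weight_le q_ge0 mc)).
  rewrite expnS mul2n -addnn; apply: le_trans (norlund_weightD_le q_noninc _ _) _.
  by have := weightB cA'; lra.
(* Since max(j, 2^l) <= j + 2^l, this Abel remainder is at most the second summand of the induction
   hypothesis for j, which therefore pays for it. *)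
have h4 : `|walsh_full c s * \sum_(i < 2 ^ c) q (j + i)%N * dirichlet i s| <=
    2 * \sum_(l < c) 2 ^+ l * q (maxn j (2 ^ l)) * Lam l s.
  rewrite normrM norm_walsh_full mul1r.
  apply: le_trans (sum_q_dirichlet_le q_ge0 q_noninc c j s) _.
  rewrite ler_pM2l //; apply: ler_sum => l _; rewrite ler_wpM2r //.
  rewrite ler_wpM2l ?exprn_ge0 //; apply: q_noninc.
  by rewrite geq_max leq_addr leq_addl.
have h5 : `|rademacher c s * paley_sum q j s| = `|paley_sum q j s|.
  by rewrite normrM norm_rademacher mul1r.
have h6 : `|paley_sum q m s| <= `|norlund_weight q m * dirichlet (2 ^ c) s| +
   `|paley_sum q j s| + `|walsh_full c s * \sum_(i < 2 ^ c) q (j + i)%N * dirichlet i s|.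
  rewrite -h5 [in paley_sum q m s]em (paley_sum_add q s jc) -em.
  by apply: le_trans (ler_normB _ _) _; rewrite lerD2r; exact: ler_normD.
by have := IH j cA' jc; lra.
Qed.

Lemma paley_sum_le m s : (m <= 2 ^ A)%N ->
  `|paley_sum q m s| <=
  (8 / (2 - beta) + 1) * B * \sum_(l < A.+1) beta ^+ l * Lam l s.
Proof.
move=> mA; have := paley_sum_bound s (leqnn A) mA.
set S1 := \sum_(l < A) _; set S2 := \sum_(l < A.+1) _ => h.
have S10 : 0 <= S1.
  by apply: sumr_ge0 => l _; rewrite !mulr_ge0 ?exprn_ge0 ?Lam_ge0.
have h1 : `|paley_sum q m s| <= B * S2 by lra.
apply: le_trans h1 _; rewrite [(_ + 1) * B]mulrC -mulrA ler_wpM2l // mulr_sumr.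
apply: ler_sum => l _; rewrite -mulrA ler_wpM2r //.
  by rewrite mulr_ge0 ?exprn_ge0 ?Lam_ge0 // ltW.
by rewrite /coef gerBl mulr_ge0 // exprn_ge0.
Qed.

End PaleyNorlundBound.

(** * Walsh-Kaczmarz kernels *)

Section Majorants.
Context {R : realType}.
Variable beta : R.

(* By [majGE], [majG a] is [beta ^- a] times the sum of [beta ^ l * Lam l] over
   [l <= a], taken at the reversed point; the recursion adds one coordinate. *)
Fixpoint majH a (x : nat -> bool) : R :=
  if a is a'.+1 then (~~ x a')%:R * majH a' x + beta ^- a else 1.

Fixpoint majG a (x : nat -> bool) : R :=
  if a is a'.+1 then 2 * (~~ x a')%:R * majG a' x + majH a' x + beta ^- a else 1.

(** A kernel of order between 2^A and 2^(A+1) contains blocks of every level a <= A; in [rest_le]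
    block a carries a factor 2^a, against a weight of order Q / 2^A, whence the geometric averaging
    of the [majG a]. *)
Definition majV A (x : nat -> bool) : R := 2 ^- A * \sum_(a < A.+1) 2 ^+ a * majG a x.

Lemma majVS A x : majV A.+1 x = majV A x / 2 + majG A.+1 x.
Proof.
rewrite /majV big_ord_recr mulrDr mulrA mulVf ?expf_neq0 // mul1r exprS invfM.
by congr (_ + _); ring.
Qed.

Lemma majV0 x : majV 0 x = 1.
Proof. by rewrite /majV big_ord1 !expr0 invr1 !mulr1. Qed.

Hypothesis beta_gt1 : 1 < beta.
Hypothesis beta_lt2 : beta < 2.

Let b_gt0 : 0 < beta. Proof. exact: lt_trans beta_gt1. Qed.

Let beV_ge0 a : 0 <= beta ^- a. Proof. by rewrite invr_ge0 exprn_ge0 // ltW. Qed.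

Lemma majH_ge a x : beta ^- a <= majH a x.
Proof.
elim: a => [|a IH]; first by rewrite expr0 invr1.
by rewrite lerDr mulr_ge0 //; exact: le_trans IH.
Qed.

Lemma majH_ge0 a x : 0 <= majH a x.
Proof. exact: le_trans (beV_ge0 a) (majH_ge _ _). Qed.

Lemma majH_le_majG a x : majH a x <= majG a x.
Proof.
elim: a => [//|a IH] /=; rewrite lerD2r; have := majH_ge0 a x; move: IH.
by case: (x a) => /=; lra.
Qed.

Lemma majG_ge0 a x : 0 <= majG a x.
Proof. exact: le_trans (majH_ge0 _ _) (majH_le_majG _ _). Qed.

Lemma majG_le_majV a x : majG a x <= majV a x.
Proof.
case: a => [|a]; first by rewrite majV0.
rewrite majVS lerDr divr_ge0 // mulr_ge0 ?invr_ge0 ?exprn_ge0 // sumr_ge0 // => i _.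
by rewrite mulr_ge0 ?exprn_ge0 ?majG_ge0.
Qed.

Lemma majV_ge0 a x : 0 <= majV a x.
Proof. exact: le_trans (majG_ge0 _ _) (majG_le_majV _ _). Qed.

Lemma dep_majH a : dep a (majH a).
Proof.
elim: a => [//|a IH] x y xy /=; rewrite (xy a) // (IH x y) // => i ia.
by apply: xy; rewrite ltnW.
Qed.

Lemma dep_majG a : dep a (majG a).
Proof.
elim: a => [//|a IH] x y xy /=.
have xy' i : (i < a)%N -> x i = y i by move=> ia; apply: xy; rewrite ltnW.
by rewrite (xy a) // (IH x y) // (dep_majH xy').
Qed.

Lemma dep_majV a : dep a (majV a).
Proof.
move=> x y xy; rewrite /majV; congr (_ * _); apply: eq_bigr => i _.
congr (_ * _); apply: dep_majG => j ji; apply: xy.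
by rewrite (leq_trans ji) // -ltnS.
Qed.

Lemma shiftc_revc a x : shiftc (revc a.+1 x) = revc a x.
Proof.
by apply: funext => i; rewrite /shiftc /revc subn1 /= -subnDA add1n.
Qed.

Lemma revc0 a x : revc a.+1 x 0%N = x a.
Proof. by rewrite /revc subn1 subn0. Qed.

Lemma majHE a x : majH a x = beta ^- a * \sum_(l < a.+1) beta ^+ l * cyl l (revc a x).
Proof.
have bn0 : beta != 0 by rewrite gt_eqF.
elim: a => [|a IH] /=; first by rewrite big_ord1 /cyl big_ord0 !expr0 invr1 !mulr1.
have cyl0 s : cyl 0 s = 1 :> R by rewrite /cyl big_ord0.
rewrite IH [in RHS]big_ord_recl /= cyl0 expr0 mulr1 mulrDr mulr1 addrC.
congr (_ + _).
rewrite !mulr_sumr; apply: eq_bigr => l _.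
rewrite cyl_shift shiftc_revc revc0 /bump /= add1n !exprS invfM.
by field; rewrite bn0 expf_neq0.
Qed.

Lemma majGE a x : majG a x = beta ^- a * \sum_(l < a.+1) beta ^+ l * Lam l (revc a x).
Proof.
have bn0 : beta != 0 by rewrite gt_eqF.
elim: a => [|a IH] /=; first by rewrite big_ord1 /Lam !expr0 invr1 !mulr1.
rewrite IH majHE [in RHS]big_ord_recl /= expr0 mul1r mulrDr [Lam 0 _]/(1) mulr1 addrC.
congr (_ + _).
rewrite !mulr_sumr -big_split; apply: eq_bigr => l _ /=.
rewrite /bump /= add1n.
have -> : Lam l.+1 (revc a.+1 x) =
  2 * (~~ x a)%:R * Lam l (revc a x) + cyl l (revc a x) :> R.
  by rewrite -(shiftc_revc a x) -{1}(revc0 a x).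
by rewrite !exprS invfM; field; rewrite bn0 expf_neq0.
Qed.

End Majorants.

(** * Pointwise bound for the Walsh-Kaczmarz-Nörlund kernels *)

Section KaczmarzKernel.
Context {R : realType}.
Implicit Types (x : nat -> bool) (a i j k l m n : nat).

Definition kdirichlet n x : R := \sum_(i < n) kaczmarz i x.

Lemma kaczmarz_top a i x : (i < 2 ^ a)%N ->
  kaczmarz (2 ^ a + i) x = @rademacher R a x * walsh i (revc a x).
Proof.
move=> ia; have h : (2 ^ a <= 2 ^ a + i < 2 ^ a.+1)%N.
  by rewrite leq_addr expnS mul2n -addnn ltn_add2l.
have ta : trunc_log 2 (2 ^ a + i) = a by apply: trunc_log_eq.
have : (0 < 2 ^ a + i)%N by rewrite addn_gt0 expn_gt0.
move en : (2 ^ a + i)%N => [//|n] _.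
rewrite /kaczmarz -en ta; congr (_ * _).
rewrite (walshE _ ia); apply: eq_bigr => k _.
by rewrite binary_digit_lo // /rademacher /revc subnAC.
Qed.

Lemma norm_kaczmarz n x : `|kaczmarz n x| = 1 :> R.
Proof.
case: n => [|n]; first by rewrite normr1.
rewrite /kaczmarz normrM norm_rademacher mul1r normr_prod big1 // => k _.
by rewrite normrX norm_rademacher expr1n.
Qed.

Lemma cyl_revc a x : cyl a (revc a x) = cyl a x :> R.
Proof.
rewrite /cyl (reindex_inj rev_ord_inj) /=; apply: eq_bigr => i _.
rewrite /revc; congr (~~ x _)%:R; have := ltn_ord i; lia.
Qed.

Lemma kdirichlet_pow_add a j x :
  (j <= 2 ^ a)%N ->
  kdirichlet (2 ^ a + j) x = kdirichlet (2 ^ a) x + rademacher a x * dirichlet j (revc a x).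
Proof.
move=> ja; rewrite /kdirichlet big_split_ord /=; congr (_ + _).
rewrite /dirichlet mulr_sumr; apply: eq_bigr => i _; apply: kaczmarz_top.
exact: leq_trans (ltn_ord i) ja.
Qed.

Lemma kdirichlet_pow a x : kdirichlet (2 ^ a) x = dirichlet (2 ^ a) (revc a x).
Proof.
rewrite dirichlet_pow cyl_revc; elim: a => [|a IH].
  by rewrite /kdirichlet expn0 big_ord1 /cyl big_ord0 mulr1.
rewrite expnS mul2n -addnn kdirichlet_pow_add // IH dirichlet_pow cyl_revc cylS.
by rewrite exprS rademacher_flip; case: (x a) => /=; ring.
Qed.

Lemma kdirichlet_add a j x : (j <= 2 ^ a)%N ->
  kdirichlet (2 ^ a + j) x =
  dirichlet (2 ^ a) (revc a x) + rademacher a x * dirichlet j (revc a x).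
Proof. by move=> ja; rewrite kdirichlet_pow_add // kdirichlet_pow. Qed.

Variables (q : nat -> R) (beta K : R).
Hypothesis q_ge0 : forall k, 0 <= q k.
Hypothesis q_noninc : nonincreasing_seq q.
Hypothesis beta_gt1 : 1 < beta.
Hypothesis beta_lt2 : beta < 2.
Hypothesis K_ge0 : 0 <= K.
Hypothesis weightK : forall l A, (l <= A)%N ->
  norlund_weight q (2 ^ l) <= K * norlund_weight q (2 ^ A) / beta ^+ A * beta ^+ l.

Let b_gt0 : 0 < beta. Proof. exact: lt_trans beta_gt1. Qed.

Definition norlund_kernel_sum n x : R := \sum_(i < n) q i * kdirichlet (n - i) x.

(** The degrees run from 2^a + 1 to 2^(a+1), the range on which a single reversal of a coordinates
    describes the kernels. *)
Let block a m x : R := \sum_(i < 2 ^ a) q (m + i)%N * kdirichlet (2 ^ a + (2 ^ a - i)) x.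

Let block_le a m x : `|block a m x| <=
  2 * (\sum_(i < 2 ^ a) q (m + i)%N) * Lam a (revc a x) +
  2 * \sum_(l < a) 2 ^+ l * q (m + 2 ^ l)%N * Lam l (revc a x).
Proof.
have -> : block a m x = (\sum_(i < 2 ^ a) q (m + i)%N) * dirichlet (2 ^ a) (revc a x) +
  rademacher a x *
    \sum_(i < 2 ^ a) q (m + i)%N * dirichlet (2 ^ a - i) (revc a x).
  rewrite mulr_suml mulr_sumr -big_split; apply: eq_bigr => i _ /=.
  by rewrite kdirichlet_add ?leq_subr //; ring.
rewrite sum_q_dirichlet_sub.
set W := \sum_(i < _) q _; set s := revc a x; set S := \sum_(i < _) q _ * _.
have W0 : 0 <= W by exact: sumr_ge0.
have hS : `|S| <= 2 * \sum_(l < a) 2 ^+ l * q (m + 2 ^ l)%N * Lam l s.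
  exact: sum_q_dirichlet_le.
have hD : `|W * dirichlet (2 ^ a) s| <= W * Lam a s.
  rewrite ger0_norm ?ler_wpM2l ?dirichlet_pow_le // mulr_ge0 ?dirichlet_pow_ge0 //.
apply: le_trans (ler_normD _ _) _.
rewrite [`|rademacher a x * _|]normrM norm_rademacher mul1r.
apply: le_trans (lerD (lexx _) (ler_normB _ _)) _.
by rewrite [`|walsh_full a s * _|]normrM norm_walsh_full; lra.
Qed.

Let rest a m x : R := \sum_(i < 2 ^ a) q (m + i)%N * kdirichlet (2 ^ a - i) x.

Let restS a m x : rest a.+1 m x = block a m x + rest a (m + 2 ^ a) x.
Proof.
rewrite /rest expnS mul2n -addnn big_split_ord /=; congr (_ + _).
  by apply: eq_bigr => i _; rewrite addnBA // ltnW.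
by apply: eq_bigr => i _; rewrite subnDl addnA.
Qed.

Let pow_le_beta l a : (l <= a)%N -> 2 ^+ l <= 2 ^+ a * beta ^- a * beta ^+ l.
Proof.
move=> la; rewrite -(subnK la) !exprD invfM.
have bl : beta ^+ l != 0 by rewrite expf_neq0 // gt_eqF.
have -> : 2 ^+ (a - l) * 2 ^+ l * (beta ^- (a - l) / beta ^+ l) * beta ^+ l =
  2 ^+ l * (2 / beta) ^+ (a - l) by rewrite expr_div_n; field; rewrite bl expf_neq0 // gt_eqF.
rewrite ler_peMr ?exprn_ge0 // exprn_ege1 // ler_pdivlMr // mul1r ltW //.
Qed.

Let sum_Lam_le a x :
  \sum_(l < a.+1) 2 ^+ l * Lam l (revc a x) <= 2 ^+ a * majG beta a x.
Proof.
rewrite majGE // mulrA mulr_sumr; apply: ler_sum => l _.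
by rewrite mulrA ler_wpM2r // pow_le_beta // -ltnS.
Qed.

(** Every weight is replaced by the largest one, [q m]. The result is sharp enough once m is
    comparable with 2^a, because then 2^a q_m is controlled by the total weight. *)
Let rest_le a m x :
  `|rest a m x| <= q m * (1 + 2 * \sum_(b < a) 2 ^+ b * majG beta b x).
Proof.
elim: a m => [|a IH] m.
  rewrite /rest expn0 big_ord1 big_ord0 mulr0 addr0 mulr1 addn0.
  by rewrite /kdirichlet subn0 big_ord1 mulr1 ger0_norm.
rewrite restS big_ord_recr /=; apply: le_trans (ler_normD _ _) _.
have h1 : `|rest a (m + 2 ^ a) x| <= q m * (1 + 2 * \sum_(b < a) 2 ^+ b * majG beta b x).
  apply: le_trans (IH _) _; rewrite ler_wpM2r //; last exact/q_noninc/leq_addr.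
  rewrite addr_ge0 // mulr_ge0 // sumr_ge0 // => b _.
  by rewrite mulr_ge0 ?exprn_ge0 ?majG_ge0.
suff h2 : `|block a m x| <= 2 * q m * (2 ^+ a * majG beta a x) by lra.
apply: le_trans (block_le _ _ _) _.
apply: le_trans (_ : 2 * q m * \sum_(l < a.+1) 2 ^+ l * Lam l (revc a x) <= _); last first.
  by rewrite ler_wpM2l ?sum_Lam_le // mulr_ge0.
rewrite big_ord_recr /= mulrDr addrC -!mulrA; apply: lerD.
  rewrite ler_pM2l // mulr_sumr; apply: ler_sum => l _.
  rewrite [2 ^+ l * q _]mulrC -mulrA ler_wpM2r //.
    by rewrite mulr_ge0 ?exprn_ge0.
  by apply: q_noninc; exact: leq_addr.
rewrite ler_pM2l // mulrA ler_wpM2r // -natrX mulr_natr.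
rewrite -[X in _ *+ X]card_ord -sumr_const; apply: ler_sum => i _.
by apply: q_noninc; exact: leq_addr.
Qed.

Lemma norlund_kernel_sum_le A n x : (2 ^ A < n <= 2 ^ A.+1)%N ->
  `|norlund_kernel_sum n x| <=
  ((8 / (2 - beta) + 1) * K + 4 * K + 11) * norlund_weight q n * majV beta A x.
Proof.
move=> /andP[An nA].
have [m en] : exists m, n = (2 ^ A + m)%N.
  by exists (n - 2 ^ A)%N; rewrite subnKC // ltnW.
have mA : (m <= 2 ^ A)%N by move: nA; rewrite en expnS mul2n -addnn leq_add2l.
have m0 : (0 < m)%N by move: An; rewrite en -{1}[(2 ^ A)%N]addn0 ltn_add2l.
have Q0 k : 0 <= norlund_weight q k by exact: norlund_weight_ge0.
have QA : norlund_weight q (2 ^ A) <= norlund_weight q n.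
  by apply: norlund_weight_le => //; exact: ltnW.
set Q := norlund_weight q n in QA *.
have hQ0 : 0 <= Q by exact: Q0.
have V0 a : 0 <= majV beta a x by exact: majV_ge0.
have GV : majG beta A x <= majV beta A x by exact: majG_le_majV.
have bA : beta ^+ A != 0 by rewrite expf_neq0 // gt_eqF.
have weightQ l : (l <= A)%N -> norlund_weight q (2 ^ l) <= K * Q / beta ^+ A * beta ^+ l.
  move=> lA; apply: le_trans (weightK lA) _.
  rewrite ler_wpM2r ?exprn_ge0 ?(ltW b_gt0) // ler_wpM2r ?invr_ge0 ?exprn_ge0 ?(ltW b_gt0) //.
  by rewrite ler_wpM2l.
(* The terms i < m have degree 2^A + (m - i), so [kdirichlet_add] turns them into a multiple of
   D_(2^A) and a Paley sum at the reversed point; the terms i >= m have degree at most 2^A and form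
   [rest A m]. *)
have -> : norlund_kernel_sum n x =
    norlund_weight q m * dirichlet (2 ^ A) (revc A x) +
    rademacher A x * paley_sum q m (revc A x) + rest A m x.
  rewrite /norlund_kernel_sum en addnC big_split_ord /=; congr (_ + _).
    rewrite norlund_weightE /paley_sum mulr_suml mulr_sumr -big_split.
    apply: eq_bigr => i _ /=.
    rewrite addnC -addnBA ?(ltnW (ltn_ord i)) // kdirichlet_add; first by ring.
    by rewrite (leq_trans (leq_subr _ _)).
  by apply: eq_bigr => i _; rewrite subnDl.
have h1 : `|norlund_weight q m * dirichlet (2 ^ A) (revc A x)| <= Q * majV beta A x.
  rewrite ger0_norm ?mulr_ge0 ?dirichlet_pow_ge0 //.
  apply: ler_pM; rewrite ?dirichlet_pow_ge0 //.
    by apply: norlund_weight_le => //; rewrite en leq_addl.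
  apply: le_trans (dirichlet_pow_le _ _) _; apply: le_trans GV.
  rewrite majGE // big_ord_recr /= mulrDr.
  rewrite mulrA mulVf // mul1r lerDr mulr_ge0 ?invr_ge0 ?exprn_ge0 ?(ltW b_gt0) //.
  by rewrite sumr_ge0 // => l _; rewrite mulr_ge0 ?exprn_ge0 ?(ltW b_gt0).
have h2 : `|rademacher A x * paley_sum q m (revc A x)| <=
    (8 / (2 - beta) + 1) * K * Q * majV beta A x.
  rewrite normrM norm_rademacher mul1r.
  apply: le_trans (paley_sum_le q_ge0 q_noninc beta_gt1 beta_lt2 weightQ _ mA) _.
  have -> : (8 / (2 - beta) + 1) * (K * Q / beta ^+ A) *
      \sum_(l < A.+1) beta ^+ l * Lam l (revc A x) =
      (8 / (2 - beta) + 1) * K * Q * majG beta A x.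
    by rewrite majGE //; ring.
  rewrite ler_wpM2l //; apply: mulr_ge0 => //; apply: mulr_ge0 => //.
  by rewrite addr_ge0 // divr_ge0 // subr_ge0 ltW.
have h3 : `|rest A m x| <= (4 * K + 10) * Q * majV beta A x.
  (* One block is split off before [rest_le] is applied. The index m may be as small as 1, and then
     q_m 2^A need not be controlled by Q; after the first block the weights start at m + 2^A, where
     2^A q <= Q. The split block is estimated by [block_le], which keeps the weights. *)
  case: A => [|A] in GV bA mA QA weightQ An nA en h1 h2 *.
    have := rest_le 0 m x; rewrite big_ord0 mulr0 addr0 mulr1 => h.
    rewrite majV0 mulr1; apply: (le_trans h).
    have : q m <= Q.
      apply: le_trans QA; rewrite expn0 norlund_weightE big_ord1; exact: q_noninc.
    by have : 0 <= K * Q by [rewrite mulr_ge0]; have : 0 <= Q by []; lra.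
  have L0 l : 0 <= Lam l (revc A x) :> R by [].
  have KQ0 : 0 <= K * Q by rewrite mulr_ge0.
  have QA' : norlund_weight q (2 ^ A) <= Q.
    by apply: le_trans QA; apply: norlund_weight_le => //; rewrite leq_exp2l.
  have VV : majV beta A x <= 2 * majV beta A.+1 x.
    by have := majVS beta A x; have := majG_ge0 beta_gt1 A.+1 x; lra.
  have GA : majG beta A x <= 2 * majV beta A.+1 x by apply: le_trans VV; exact: majG_le_majV.
  have LG : Lam A (revc A x) <= majG beta A x.
    rewrite majGE // big_ord_recr /= mulrDr mulrA mulVf ?expf_neq0 ?gt_eqF // mul1r.
    rewrite lerDr mulr_ge0 ?invr_ge0 ?exprn_ge0 ?(ltW b_gt0) //.
    by rewrite sumr_ge0 // => l _; rewrite mulr_ge0 ?exprn_ge0 ?(ltW b_gt0).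
  have b1 : 2 * (\sum_(i < 2 ^ A) q (m + i)%N) * Lam A (revc A x) <= 2 * Q * majG beta A x.
    rewrite -!mulrA ler_pM2l //; apply: ler_pM => //; first exact: sumr_ge0.
    by apply: le_trans QA'; exact: sum_q_le.
  have b2 : \sum_(l < A) 2 ^+ l * q (m + 2 ^ l)%N * Lam l (revc A x) <= K * Q * majG beta A x.
    rewrite majGE // mulrA mulr_sumr big_ord_recr /=; apply: ler_wpDr.
      by rewrite !mulr_ge0 ?invr_ge0 ?exprn_ge0 ?(ltW b_gt0).
    apply: ler_sum => l _; rewrite mulrA ler_wpM2r //.
    apply: le_trans (_ : 2 ^+ l * q (2 ^ l)%N <= _).
      by rewrite ler_wpM2l ?exprn_ge0 //; apply: q_noninc; exact: leq_addl.
    apply: le_trans (_ : norlund_weight q (2 ^ l) <= _).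
      by rewrite -natrX; exact: q_le_weight.
    apply: le_trans (weightQ l _) _; first by rewrite ltnW // ltnS ltnW.
    rewrite ler_wpM2r ?exprn_ge0 ?(ltW b_gt0) // ler_wpM2l //.
    by rewrite lef_pV2 ?posrE ?exprn_gt0 // exprS ler_peMl ?exprn_ge0 ?ltW.
  have S1 : 1 <= 2 ^+ A * majV beta A x.
    rewrite /majV mulrA mulfV ?expf_neq0 // mul1r big_ord_recl expr0 mul1r lerDl.
    by apply: sumr_ge0 => i _; rewrite mulr_ge0 ?exprn_ge0 ?majG_ge0.
  have S2 : \sum_(b < A) 2 ^+ b * majG beta b x <= 2 ^+ A * majV beta A x.
    rewrite /majV mulrA mulfV ?expf_neq0 // mul1r big_ord_recr /= lerDl.
    by rewrite mulr_ge0 ?exprn_ge0 ?majG_ge0.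
  have b3 : `|rest A (m + 2 ^ A) x| <= 6 * Q * majV beta A.+1 x.
    apply: le_trans (rest_le _ _ _) _.
    apply: le_trans (_ : q (m + 2 ^ A)%N * (3 * (2 ^+ A * majV beta A x)) <= _).
      by rewrite ler_wpM2l //; lra.
    have qQ : 2 ^+ A * q (m + 2 ^ A)%N <= Q.
      apply: le_trans QA'; apply: le_trans (q_le_weight q_noninc _).
      by rewrite natrX ler_wpM2l ?exprn_ge0 //; apply: q_noninc; exact: leq_addl.
    have := ler_pM (mulr_ge0 (exprn_ge0 A (ler0n R 2)) (q_ge0 (m + 2 ^ A)%N)) (V0 A) qQ VV.
    by lra.
  rewrite restS; apply: le_trans (ler_normD _ _) _.
  have := block_le A m x.
  have : Q * majG beta A x <= Q * (2 * majV beta A.+1 x) by rewrite ler_wpM2l.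
  have : K * Q * majG beta A x <= K * Q * (2 * majV beta A.+1 x) by rewrite ler_wpM2l.
  by lra.
apply: le_trans (ler_normD _ _) _; apply: le_trans (lerD (ler_normD _ _) (lexx _)) _.
by lra.
Qed.

End KaczmarzKernel.

(** * Means of the majorants *)

Section MajorantMeans.
Context {R : realType}.
Implicit Types (x y z : nat -> bool) (a M N : nat) (s : R).
Variable beta : R.
Hypothesis beta_gt1 : 1 < beta.
Hypothesis beta_lt2 : beta < 2.

Let b_gt0 : 0 < beta. Proof. exact: lt_trans beta_gt1. Qed.
Let beV_ge0 a : 0 <= beta ^- a. Proof. by rewrite invr_ge0 exprn_ge0 // ltW. Qed.
Let beVS a : beta ^- a = beta * beta ^- a.+1.
Proof. by rewrite exprS invfM mulVKf // gt_eqF. Qed.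

Let G := @majG R beta.
Let H := @majH R beta.
Let V := @majV R beta.

Let H_setc a v x : H a.+1 (setc a v x) = (~~ v)%:R * H a x + beta ^- a.+1.
Proof. by rewrite /H /= (dep_setc v x (@dep_majH R beta a) (leqnn a)) /setc eqxx. Qed.

Let G_setc a v x : G a.+1 (setc a v x) = 2 * (~~ v)%:R * G a x + H a x + beta ^- a.+1.
Proof.
rewrite /G /H /= (dep_setc v x (@dep_majH R beta a) (leqnn a)).
by rewrite (dep_setc v x (@dep_majG R beta a) (leqnn a)) /setc eqxx.
Qed.

Let G_ge0 a x : 0 <= G a x. Proof. exact: majG_ge0. Qed.
Let H_ge0 a x : 0 <= H a x. Proof. exact: majH_ge0. Qed.

Let psi a x : R := G a x + 2 * H a x + 3 / (beta - 1) * beta ^- a.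

(* The three terms are chosen so that [psi] is a martingale, which makes
   [majG] comparable to its conditional expectations. *)
Let avg_psi a x : avg a (psi a.+1) x = psi a x.
Proof.
rewrite /avg /psi !G_setc !H_setc /= (beVS a); move: (beta ^- a.+1) => e.
by field; rewrite subr_eq0 gt_eqF.
Qed.

Lemma mean_dep_avg N a (h f : (nat -> bool) -> R) : (a < N)%N -> dep a h ->
  mean N (fun y => h y * f y) = mean N (fun y => h y * avg a f y).
Proof.
move=> aN dh; rewrite -(mean_avg _ aN); apply: eq_mean => y.
by rewrite /avg !(dep_setc _ _ dh (leqnn a)); ring.
Qed.

Lemma avg_addc a z (f : (nat -> bool) -> R) y :
  avg a (fun y => f (addc z y)) y = avg a f (addc z y).
Proof. by rewrite /avg !addc_setc; case: (z a) => //=; rewrite addrC. Qed.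

Let CG : R := 3 + 3 / (beta - 1).

Let CG_ge1 : 1 <= CG.
Proof.
have : 0 <= 3 / (beta - 1) by rewrite divr_ge0 // subr_ge0 ltW.
by rewrite /CG; lra.
Qed.

Let psi_le a x : psi a x <= CG * G a x.
Proof.
have h1 := majH_le_majG beta_gt1 a x; have h2 := majH_ge beta_gt1 a x.
have h3 : 0 <= 3 / (beta - 1) by rewrite divr_ge0 // subr_ge0 ltW.
have := ler_wpM2l h3 (le_trans h2 h1); rewrite /psi /CG -/(G a x) -/(H a x) in h1 *.
by lra.
Qed.

Let le_psi a x : G a x <= psi a x.
Proof.
rewrite /psi -addrA lerDl addr_ge0 // mulr_ge0 ?(majH_ge0 beta_gt1) //.
by rewrite divr_ge0 // subr_ge0 ltW.
Qed.

Lemma mean_majG_le N M a (h : (nat -> bool) -> R) z :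
  (M <= a <= N)%N -> dep M h -> (forall y, 0 <= h y) ->
  mean N (fun y => h y * majG beta a (addc z y)) <=
  CG * mean N (fun y => h y * majG beta M (addc z y)).
Proof.
move=> /andP[Ma aN] dh h0.
have e : mean N (fun y => h y * psi a (addc z y)) =
         mean N (fun y => h y * psi M (addc z y)).
  elim: a Ma aN => [|a IH]; first by rewrite leqn0 => /eqP ->.
  rewrite leq_eqVlt ltnS => /predU1P[->//|Ma aN].
  rewrite -IH ?(ltnW aN) // (@mean_dep_avg N a) //; last exact: depS dh.
  by apply: eq_mean => y; rewrite avg_addc avg_psi.
rewrite -meanZ; apply: le_trans (_ : mean N (fun y => h y * psi a (addc z y)) <= _).
  by apply: le_mean => y; rewrite ler_wpM2l.
by rewrite e; apply: le_mean => y; rewrite mulrCA ler_wpM2l.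
Qed.

(** Testing against nonnegative F_M-measurable [h] expresses a bound on the conditional expectation
    given F_M. By [majVS] a step halves the previous bound and adds [CG] times the mean at level M,
    so the constant 2 CG is stable. *)
Lemma mean_majV_le N M A (h : (nat -> bool) -> R) z :
  (M <= A <= N)%N -> dep M h -> (forall y, 0 <= h y) ->
  mean N (fun y => h y * majV beta A (addc z y)) <=
  2 * CG * mean N (fun y => h y * majV beta M (addc z y)).
Proof.
move=> /andP[MA AN] dh h0; set m := mean N (fun y => h y * majV beta M _).
have m0 : 0 <= m by apply: mean_ge0 => y; rewrite mulr_ge0 ?majV_ge0.
have Gm : mean N (fun y => h y * majG beta M (addc z y)) <= m.
  by apply: le_mean => y; rewrite ler_wpM2l // majG_le_majV.
have Cm : CG * mean N (fun y => h y * majG beta M (addc z y)) <= CG * m.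
  by rewrite ler_wpM2l // (le_trans _ CG_ge1).
have Cm1 : m <= CG * m by rewrite ler_peMl.
elim: A MA AN => [|A IH].
  by rewrite leqn0 => /eqP M0 _; move: Cm1 m0; rewrite /m M0; lra.
rewrite leq_eqVlt ltnS => /predU1P[<- _|MA AN]; first by rewrite -/m; lra.
have -> : mean N (fun y => h y * majV beta A.+1 (addc z y)) =
   2^-1 * mean N (fun y => h y * majV beta A (addc z y)) +
   mean N (fun y => h y * majG beta A.+1 (addc z y)).
  by rewrite -meanZ -meanD; apply: eq_mean => y; rewrite majVS; ring.
have := IH MA (ltnW AN).
have : mean N (fun y => h y * majG beta A.+1 (addc z y)) <=
  CG * mean N (fun y => h y * majG beta M (addc z y)).
  by apply: mean_majG_le; rewrite // AN ltnW.
by move: Cm; lra.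
Qed.

Notation min1 := (Num.min 1).

Let min1_ge0 (t : R) : 0 <= t -> 0 <= min1 t.
Proof. by move=> t0; rewrite le_min ler01. Qed.

Let min1_le1 (t : R) : min1 t <= 1. Proof. by rewrite ge_min lexx. Qed.
Let min1_le (t : R) : min1 t <= t. Proof. by rewrite ge_min lexx orbT. Qed.

(** The solution of C = C beta / 2 + 1: a new coordinate halves the previous mean, whose bound is at
    most beta times larger, and adds one truncated term. *)
Let CH : R := 2 / (2 - beta).

Let CH_ge1 : 1 <= CH.
Proof. by rewrite /CH ler_pdivlMr ?subr_gt0 // mul1r; have := b_gt0; lra. Qed.

Let mean_min1_H a s : 0 <= s -> mean a (fun x => min1 (s * H a x)) <= CH * min1 (s * beta ^- a).
Proof.
move=> s0; elim: a => [|a IH].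
  by rewrite /H /= expr0 invr1 mulr1 ler_peMl // min1_ge0.
set e := s * beta ^- a.+1.
have e0 : 0 <= e by rewrite mulr_ge0.
apply: le_trans (_ : 2^-1 * mean a (fun x => min1 (s * H a x)) + min1 e <= _).
  rewrite -meanZ -[X in _ + X](mean_cst a) -meanD; apply: (@le_mean _ a (avg a _)) => x.
  rewrite /avg !H_setc /= mul1r mul0r add0r mulrDr -/e.
  have : min1 (s * H a x + e) <= min1 (s * H a x) + min1 e.
    by apply: min1D => //; rewrite mulr_ge0 // (majH_ge0 beta_gt1).
  by lra.
have h : min1 (s * beta ^- a) <= beta * min1 e.
  have -> : s * beta ^- a = beta * e by rewrite beVS /e; ring.
  by case: (leP 1 e) => h; rewrite ?mulr1 ?min1_le // (le_trans (min1_le1 _)) // ltW.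
have h2 : CH * min1 (s * beta ^- a) <= CH * (beta * min1 e).
  by rewrite ler_wpM2l // (le_trans _ CH_ge1).
have : CH = CH * beta / 2 + 1.
  by rewrite /CH; field; rewrite subr_eq0 gt_eqF.
by move=> eC; rewrite [in leRHS]eC; lra.
Qed.

Variable p : R.
Hypothesis p_gt0 : 0 < p.
Hypothesis p_le1 : p <= 1.
Hypothesis powp : (2 * beta) `^ p = 2.

Let theta : R := 2 * beta.

Let theta_gt0 : 0 < theta. Proof. by rewrite mulr_gt0. Qed.

Let powRge1 (t : R) : 1 <= t -> 1 <= t `^ p.
Proof. by move=> t1; rewrite -(powRr0 t) ler_powR // ltW. Qed.

Let powRle (t : R) : 0 <= t -> t <= 1 -> t <= t `^ p.
Proof.
move=> t0 t1; have [->|tn0] := eqVneq t 0; first exact: powR_ge0.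
by apply: ger1_powR => //; rewrite lt_def tn0 t0 t1.
Qed.

(** [cg] solves cg beta = cg + CH beta + 1, so that the linear correction absorbs the lower-order
    terms of one recursion step and reproduces itself. [CGp] is large enough for the trivial bound 1
    to suffice when 1 <= y <= theta. *)
Let cg : R := (CH * beta + 1) / (beta - 1).
Let CGp : R := 1 + cg + cg * theta.

Let cg_ge0 : 0 <= cg.
Proof.
rewrite divr_ge0 ?subr_ge0 ?(ltW beta_gt1) // addr_ge0 // mulr_ge0 ?(ltW b_gt0) //.
exact: le_trans CH_ge1.
Qed.

Let CGp_ge1 : 1 <= CGp.
Proof.
by rewrite /CGp -addrA lerDl addr_ge0 // mulr_ge0 // ltW.
Qed.

Let mean_min1_G_le1 a s : mean a (fun x => min1 (s * G a x)) <= 1.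
Proof. by rewrite -[leRHS](mean_cst a); apply: le_mean. Qed.

(* The linear correction [- cg * y] makes the recursion in [a] stable. *)
Let mean_min1_G_aux a s : 0 <= s -> s * beta ^- a <= theta ->
  mean a (fun x => min1 (s * G a x)) <=
  CGp * (s * beta ^- a) `^ p - cg * (s * beta ^- a).
Proof.
elim: a s => [|a IH] s s0 ys; set y := s * _ in ys *.
all: have y0 : 0 <= y by rewrite mulr_ge0.
all: have [y1|y1] := leP 1 y; first by
  (apply: (le_trans (mean_min1_G_le1 _ _)); have := powRge1 y1;
   have := ler_wpM2l cg_ge0 ys; move=> h1 h2;
   have := ler_wpM2l (le_trans ler01 CGp_ge1) h2; rewrite /CGp; have := cg_ge0; lra).
  have yp := powRle y0 (ltW y1).
  have e : s = y by rewrite /y expr0 invr1 mulr1.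
  rewrite /G /= mulr1 e; apply: (le_trans (min1_le _)).
  have := ler_wpM2l cg_ge0 yp.
  have : 0 <= cg * theta * y `^ p by exact: mulr_ge0 (mulr_ge0 cg_ge0 (ltW theta_gt0)) (powR_ge0 _ _).
  by rewrite /CGp; lra.
have ey : s * beta ^- a = beta * y by rewrite beVS /y; ring.
apply: le_trans (_ : 2^-1 * mean a (fun x => min1 (2 * s * G a x)) +
    mean a (fun x => min1 (s * H a x)) + min1 y <= _).
  rewrite -meanZ -meanD -[X in _ + X](mean_cst a) -meanD; apply: (@le_mean _ a (avg a _)) => x.
  rewrite /avg !G_setc /= mulr1 mulr0 mul0r add0r !mulrDr -/y.
  have g0 : 0 <= 2 * s * G a x by rewrite !mulr_ge0.
  have h0 : 0 <= s * H a x by rewrite !mulr_ge0.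
  have := min1D h0 y0; have := min1D (addr_ge0 g0 h0) y0; have := min1D g0 h0.
  have -> : s * (2 * G a x) = 2 * s * G a x by ring.
  by lra.
have h1 : mean a (fun x => min1 (s * H a x)) <= CH * beta * y.
  apply: le_trans (mean_min1_H a s0) _; rewrite -mulrA -ey ler_wpM2l ?min1_le //.
  exact: le_trans CH_ge1.
have e2 : 2 * s * beta ^- a = theta * y by rewrite -mulrA ey /theta; ring.
have h2 := IH (2 * s); rewrite e2 in h2.
have {}h2 : mean a (fun x => min1 (2 * s * G a x)) <=
    CGp * (2 * y `^ p) - cg * (theta * y).
  (* The exponent is tuned for this identity: the factor 2 it produces cancels the probability 1/2
     of the branch on which the majorant doubles. *)
  have -> : 2 * y `^ p = (theta * y) `^ p by rewrite powRM ?(ltW theta_gt0) // /theta powp.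
  by apply: h2; [rewrite mulr_ge0 | rewrite ler_piMr ?(ltW theta_gt0) // ltW].
have h3 := min1_le y.
have ec : cg * beta = cg + CH * beta + 1.
  by rewrite /cg; field; rewrite subr_eq0 gt_eqF.
have ec2 : cg * (theta * y) = 2 * (cg + CH * beta + 1) * y.
  by rewrite -ec /theta; ring.
by rewrite ec2 in h2; lra.
Qed.

Let mean_min1_G a s : 0 <= s ->
  mean a (fun x => min1 (s * G a x)) <= CGp * (s * beta ^- a) `^ p.
Proof.
move=> s0; have y0 : 0 <= s * beta ^- a by rewrite mulr_ge0.
have [h|h] := leP (s * beta ^- a) theta.
  apply: le_trans (mean_min1_G_aux s0 h) _.
  by rewrite gerBl mulr_ge0.
apply: (le_trans (mean_min1_G_le1 _ _)); rewrite -[leLHS]mulr1.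
apply: ler_pM => //; apply: powRge1; apply: le_trans (ltW h).
by rewrite /theta; move: beta_gt1; lra.
Qed.

(** In [majVS] the factor 1/2 replaces s by s / 2, while beta^-M is beta times beta^-(M+1). The p-th
    power thus contracts by (beta / 2)^p < 1, and the constant is the sum of the resulting geometric
    series. *)
Lemma mean_min1_majV M s : 0 <= s ->
  mean M (fun x => min1 (s * majV beta M x)) <=
  CGp / (1 - (beta / 2) `^ p) * (s * beta ^- M) `^ p.
Proof.
set r := (beta / 2) `^ p.
have r0 : 0 <= r by exact: powR_ge0.
have r1 : r < 1.
  have e1 : 1 `^ p = 1 :> R by rewrite powR1.
  rewrite /r -[ltRHS]e1 gt0_ltr_powR ?nnegrE ?divr_ge0 ?(ltW b_gt0) //.
  by rewrite ltr_pdivrMr // mul1r.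
set C := CGp / (1 - r).
have eC : C = C * r + CGp by rewrite /C; field; rewrite subr_eq0 gt_eqF.
have C0 : 0 <= C.
  by rewrite divr_ge0 ?subr_ge0 ?(ltW r1) // (le_trans ler01 CGp_ge1).
have CC : CGp <= C by rewrite [leRHS]eC lerDr mulr_ge0.
elim: M s => [|M IH] s s0.
  apply: le_trans (_ : mean 0 (fun x => min1 (s * G 0 x)) <= _).
    by apply: le_mean => x; rewrite majV0.
  by apply: le_trans (mean_min1_G 0 s0) _; rewrite ler_wpM2r ?powR_ge0.
set y := s * beta ^- M.+1.
have y0 : 0 <= y by rewrite mulr_ge0.
apply: le_trans (_ : mean M.+1 (fun x => min1 (s / 2 * V M x)) +
    mean M.+1 (fun x => min1 (s * G M.+1 x)) <= _).
  rewrite -meanD; apply: le_mean => x; rewrite majVS mulrDr.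
  have -> : s * (majV beta M x / 2) = s / 2 * V M x by rewrite /V; ring.
  by apply: min1D; rewrite mulr_ge0 ?divr_ge0 ?majV_ge0 ?majG_ge0.
rewrite [in leRHS]eC mulrDl; apply: lerD; last exact: mean_min1_G.
rewrite (@mean_dep _ M); [|exact: leqnSn|]; last first.
  by apply: (dep_comp (fun t => min1 (s / 2 * t))); exact: dep_majV.
apply: le_trans (IH _ _) _; first by rewrite divr_ge0.
have -> : s / 2 * beta ^- M = beta / 2 * y by rewrite beVS /y; ring.
by rewrite (powRM _ (divr_ge0 (ltW b_gt0) (ler0n R 2)) y0) mulrA.
Qed.

End MajorantMeans.

(** * Nörlund means as convolutions, and their action on pieces with cancellation *)

Section NorlundOperator.
Context {R : realType}.
Implicit Types (x y z : nat -> bool) (n m i j M N A : nat).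

Lemma rademacher_addc k x y :
  @rademacher R k (addc x y) = rademacher k x * rademacher k y.
Proof. by rewrite /rademacher /addc signr_addb. Qed.

Lemma kaczmarz_addc i x y : kaczmarz i (addc x y) = kaczmarz i x * kaczmarz i y :> R.
Proof.
case: i => [|i]; first by rewrite /= mulr1.
rewrite /kaczmarz rademacher_addc mulrACA -big_split; congr (_ * _).
by apply: eq_bigr => k _; rewrite rademacher_addc exprMn.
Qed.

Lemma dep_kaczmarz i M : (i < 2 ^ M)%N -> dep M (@kaczmarz R i).
Proof.
case: i => [//|i] iM x y xy.
have hm : (trunc_log 2 i.+1 < M)%N.
  by rewrite -(ltn_exp2l _ _ (ltnSn 1)); apply: leq_ltn_trans iM; exact: trunc_logP.
rewrite /kaczmarz /rademacher xy //; congr (_ * _); apply: eq_bigr => k _.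
rewrite xy //; apply: leq_ltn_trans hm; apply: leq_trans (leq_subr _ _) _; exact: leq_subr.
Qed.

Lemma dep_kdirichlet n M : (n <= 2 ^ M)%N -> dep M (@kdirichlet R n).
Proof.
move=> nM x y xy; apply: eq_bigr => i _; apply: dep_kaczmarz xy.
exact: leq_trans nM.
Qed.

Lemma addcC x y : addc x y = addc y x.
Proof. by apply: funext => i; rewrite /addc addbC. Qed.

Variables (q : nat -> R).

Definition norlund_kernel n x : R := (norlund_weight q n)^-1 * norlund_kernel_sum q n x.

Definition norlund_op N n (f : (nat -> bool) -> R) x : R :=
  mean N (fun y => f y * norlund_kernel n (addc x y)).

(** The shift [n.+1] gives the orders 1 to 2^N, for which the kernel depends on N coordinates
    only. *)
Definition norlund_opmax N (f : (nat -> bool) -> R) x : R :=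
  \big[Num.max/0]_(n < 2 ^ N) `|norlund_op N n.+1 f x|.

Lemma dep_norlund_kernel n M : (n <= 2 ^ M)%N -> dep M (norlund_kernel n).
Proof.
move=> nM x y xy; rewrite /norlund_kernel /norlund_kernel_sum; congr (_ * _).
apply: eq_bigr => i _; congr (_ * _); apply: dep_kdirichlet xy.
by apply: leq_trans nM; exact: leq_subr.
Qed.

Lemma norlund_opmax_ge0 N f x : 0 <= norlund_opmax N f x.
Proof. exact: bigmax_ge_id. Qed.

Lemma norlund_opmax_le N f x (c : R) : 0 <= c ->
  (forall n, (0 < n <= 2 ^ N)%N -> `|norlund_op N n f x| <= c) ->
  norlund_opmax N f x <= c.
Proof.
by move=> c0 h; apply: bigmax_le => // i _; apply: h; exact: ltn_ord.
Qed.

Lemma le_norlund_opmax N f x n : (0 < n <= 2 ^ N)%N ->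
  `|norlund_op N n f x| <= norlund_opmax N f x.
Proof.
case: n => [//|n] /= nN.
exact: (le_bigmax 0 (fun n : 'I_(2 ^ N) => `|norlund_op N n.+1 f x|) (Ordinal nN)).
Qed.

Lemma norlund_opD N n f g x :
  norlund_op N n (fun y => f y + g y) x = norlund_op N n f x + norlund_op N n g x.
Proof. by rewrite /norlund_op -meanD; apply: eq_mean => y; rewrite mulrDl. Qed.

Lemma norlund_opmaxD N f g x :
  norlund_opmax N (fun y => f y + g y) x <= norlund_opmax N f x + norlund_opmax N g x.
Proof.
apply: norlund_opmax_le; first by rewrite addr_ge0 ?norlund_opmax_ge0.
move=> n nN; rewrite norlund_opD; apply: le_trans (ler_normD _ _) _.
by apply: lerD; exact: le_norlund_opmax.
Qed.

Lemma norlund_opmax0 N x : norlund_opmax N (fun=> 0) x = 0.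
Proof.
apply/eqP; rewrite eq_le norlund_opmax_ge0 andbT; apply: norlund_opmax_le => // n _.
rewrite /norlund_op (eq_mean _ (g := fun=> 0)) ?mean_cst ?normr0 // => y.
by rewrite mul0r.
Qed.

Lemma norlund_opmax_sum N (I : Type) (r : seq I) (F : I -> (nat -> bool) -> R) x :
  norlund_opmax N (fun y => \sum_(i <- r) F i y) x <=
  \sum_(i <- r) norlund_opmax N (F i) x.
Proof.
elim: r => [|i r IH].
  rewrite big_nil (_ : (fun y => _) = fun=> 0) ?norlund_opmax0 //.
  by apply: funext => y; rewrite big_nil.
rewrite big_cons (_ : (fun y => _) = fun y => F i y + \sum_(i <- r) F i y).
  by apply: le_trans (norlund_opmaxD _ _ _ _) _; rewrite lerD2l.
by apply: funext => y; rewrite big_cons.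
Qed.

Variables (beta K p : R).
Hypothesis q_ge0 : forall k, 0 <= q k.
Hypothesis q_noninc : nonincreasing_seq q.
Hypothesis q0_gt0 : 0 < q 0%N.
Hypothesis beta_gt1 : 1 < beta.
Hypothesis beta_lt2 : beta < 2.
Hypothesis K_ge0 : 0 <= K.
Hypothesis weightK : forall l A, (l <= A)%N ->
  norlund_weight q (2 ^ l) <= K * norlund_weight q (2 ^ A) / beta ^+ A * beta ^+ l.
Hypothesis p_gt0 : 0 < p.
Hypothesis p_le1 : p <= 1.
Hypothesis powp : (2 * beta) `^ p = 2.

Let b_gt0 : 0 < beta. Proof. exact: lt_trans beta_gt1. Qed.

Lemma norlund_weight_gt0 n : (0 < n)%N -> 0 < norlund_weight q n.
Proof.
move=> n0; apply: lt_le_trans q0_gt0 _.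
apply: le_trans (norlund_weight_le q_ge0 n0).
by rewrite norlund_weightE big_ord1.
Qed.

Let CK : R := (8 / (2 - beta) + 1) * K + 4 * K + 11.

Let CK_ge1 : 1 <= CK.
Proof.
have h : 0 <= 8 / (2 - beta) by rewrite divr_ge0 // subr_ge0 ltW.
by have := mulr_ge0 h K_ge0; have := K_ge0; rewrite /CK; lra.
Qed.

Lemma norlund_kernel_le A n x : (2 ^ A < n <= 2 ^ A.+1)%N ->
  `|norlund_kernel n x| <= CK * majV beta A x.
Proof.
move=> nA; have n0 : (0 < n)%N by case/andP: nA => h _; exact: leq_ltn_trans h.
have Q0 := norlund_weight_gt0 n0.
rewrite normrM ger0_norm ?invr_ge0 ?(ltW Q0) // ler_pdivrMl //.
by rewrite mulrA [_ * CK]mulrC; exact: norlund_kernel_sum_le.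
Qed.

Lemma norlund_kernel1 x : norlund_kernel 1 x = 1.
Proof.
rewrite /norlund_kernel /norlund_kernel_sum norlund_weightE !big_ord1.
by rewrite /kdirichlet big_ord1 mulr1 mulVf // gt_eqF.
Qed.

Let C1 : R := CK * (2 * (3 + 3 / (beta - 1))).

Let C3_ge1 : 1 <= 2 * (3 + 3 / (beta - 1)).
Proof.
have : 0 <= 3 / (beta - 1) by rewrite divr_ge0 // subr_ge0 ltW.
by lra.
Qed.

Let C1_ge1 : 1 <= C1.
Proof. by rewrite /C1 -[leLHS]mulr1 ler_pM. Qed.

Let C1_ge0 : 0 <= C1. Proof. exact: le_trans C1_ge1. Qed.

(** If n <= 2^M the kernel is F_M-measurable and orthogonality gives 0; otherwise its level A is at
    least M and [mean_majV_le] replaces V_A by V_M. The alternative M = 0 admits pieces without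
    cancellation, and V_0 = 1. *)
Lemma norlund_op_atom N M n (D : R) (S : (nat -> bool) -> bool) d x :
  0 <= D -> (M <= N)%N -> (0 < n <= 2 ^ N)%N -> dep M S ->
  (forall y, `|d y| <= D * (S y)%:R) ->
  M = 0%N \/ (forall e, dep M e -> mean N (fun y => d y * e y) = 0) ->
  `|norlund_op N n d x| <= D * (C1 * mean M (fun y => (S y)%:R * majV beta M (addc x y))).
Proof.
move=> D0 MN /andP[n0 nN] dS dD canc.
set m := mean M _.
have m0 : 0 <= m by apply: mean_ge0 => y; rewrite mulr_ge0 // majV_ge0.
have mN : mean N (fun y => (S y)%:R * majV beta M (addc x y)) = m.
  apply: mean_dep => //; apply: dep_comp2; last exact/dep_addc/dep_majV.
  exact: (dep_comp (fun b : bool => b%:R)).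
have main A : (M <= A <= N)%N ->
    (forall y, `|norlund_kernel n y| <= CK * majV beta A y) ->
    `|norlund_op N n d x| <= D * (C1 * m).
  move=> MA hk; apply: (le_trans (norm_mean _ _)).
  apply: le_trans (_ : D * CK * mean N (fun y => (S y)%:R * majV beta A (addc x y)) <= _).
    rewrite -meanZ; apply: le_mean => y; rewrite normrM.
    have -> : D * CK * ((S y)%:R * majV beta A (addc x y)) =
      D * (S y)%:R * (CK * majV beta A (addc x y)) by ring.
    by apply: ler_pM.
  have hS : dep M (fun y => (S y)%:R : R) by exact: (dep_comp (fun b : bool => b%:R)).
  have := mean_majV_le beta_gt1 x MA hS (fun y => ler0n R (S y)).
  rewrite mN => h; rewrite /C1 -!mulrA ler_wpM2l // ler_wpM2l ?(le_trans _ CK_ge1) //.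
  by rewrite mulrA.
case: (ltnP 1 n) => n1; last first.
  have {n1} n1 : n = 1%N by apply/eqP; rewrite eqn_leq n1.
  case: M => [|M] in MN dS m m0 mN canc main *.
    apply: (main 0%N) => // y; rewrite n1 norlund_kernel1 normr1 majV0 mulr1 //.
  case: canc => // canc; rewrite /norlund_op canc ?normr0.
    exact: mulr_ge0 D0 (mulr_ge0 C1_ge0 m0).
  by apply: dep_addc; apply: dep_norlund_kernel; rewrite n1 expn_gt0.
(* The kernel bound requires 2^A < n <= 2^(A+1), strict on the left, so A is read off from n - 1; n
   = 1 has been treated separately. *)
have n1' : (0 < n.-1)%N by rewrite -ltnS prednK.
have /andP[hA1 hA2] := trunc_log_bounds (ltnSn 1) n1'.
set A := trunc_log 2 n.-1 in hA1 hA2.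
have nA : (2 ^ A < n <= 2 ^ A.+1)%N by rewrite -(prednK n0) !ltnS hA1.
have AN : (A < N)%N.
  by rewrite -(ltn_exp2l _ _ (ltnSn 1)); case/andP: nA => h _; exact: leq_trans h nN.
case: (leqP M A) => MA.
  by apply: (main A); [rewrite MA ltnW | move=> y; exact: norlund_kernel_le].
case: canc => [M0|canc]; first by rewrite M0 in MA.
rewrite /norlund_op canc ?normr0.
  exact: mulr_ge0 D0 (mulr_ge0 C1_ge0 m0).
apply: dep_addc; apply: dep_norlund_kernel; case/andP: nA => _ h.
by apply: leq_trans h _; rewrite leq_exp2l.
Qed.

Lemma norlund_opmax_bounded : exists2 C : R, 1 <= C & forall N (D : R) d x,
  0 <= D -> (forall y, `|d y| <= D) -> norlund_opmax N d x <= C * D.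
Proof.
exists C1 => // N D d x D0 dD; apply: norlund_opmax_le.
  by rewrite mulr_ge0 // (le_trans _ C1_ge1).
move=> n nN; have := @norlund_op_atom N 0 n D (fun=> true) d x D0 (leq0n N) nN.
rewrite /= majV0 !mulr1 mulrC; apply => //.
by left.
Qed.

(** The bound of [norlund_op_atom] is independent of n, hence holds for the maximum. It is an
    average over cells y of S; [min1_mean] truncates each cell separately, exchanging the means
    fixes y, and translation by y leaves a truncated mean of V_M. *)
Lemma mean_norlund_opmax_atom : exists2 C : R, 0 <= C &
  forall N M (D : R) (S : (nat -> bool) -> bool) d,
  0 <= D -> (M <= N)%N -> dep M S -> (forall y, `|d y| <= D * (S y)%:R) ->
  M = 0%N \/ (forall e, dep M e -> mean N (fun y => d y * e y) = 0) ->
  mean N (fun x => Num.min 1 (norlund_opmax N d x)) <=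
  C * D `^ p * mean N (fun x => (S x)%:R).
Proof.
set CV := (1 + ((2 / (2 - beta)) * beta + 1) / (beta - 1) +
  ((2 / (2 - beta)) * beta + 1) / (beta - 1) * (2 * beta)) / (1 - (beta / 2) `^ p).
have hV M s : 0 <= s ->
    mean M (fun x => Num.min 1 (s * majV beta M x)) <= CV * (s * beta ^- M) `^ p.
  exact: mean_min1_majV.
have CV0 : 0 <= CV.
  have := hV 0%N 1 ler01; rewrite expr0 invr1 mulr1 powR1 mulr1; apply: le_trans.
  by apply: mean_ge0 => x; rewrite le_min ler01 mul1r majV_ge0.
exists (CV * C1 `^ p); first by rewrite mulr_ge0 ?powR_ge0.
move=> N M D S d D0 MN dS dD canc.
have C10 : 0 <= C1 by exact: le_trans C1_ge1.
pose u x y := D * C1 * ((S y)%:R * majV beta M (addc x y)).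
have u0 x y : 0 <= u x y.
  exact: mulr_ge0 (mulr_ge0 D0 C10) (mulr_ge0 (ler0n _ _) (majV_ge0 beta_gt1 _ _)).
apply: le_trans (_ : mean N (fun x => 2 ^+ M * mean M (fun y => Num.min 1 (2 ^- M * u x y))) <= _).
  apply: le_mean => x; apply: le_trans (min1_mean M (u0 x)).
  rewrite le_min ge_min lexx /= ge_min; apply/orP; right.
  apply: norlund_opmax_le; first exact: mean_ge0.
  move=> n nN; apply: le_trans (norlund_op_atom x D0 MN nN dS dD canc) _.
  by rewrite meanZ mulrA.
rewrite meanZ exchange_mean.
pose s := 2 ^- M * (D * C1).
have s0 : 0 <= s by rewrite mulr_ge0 ?invr_ge0 ?exprn_ge0 // mulr_ge0.
apply: le_trans (_ : 2 ^+ M * mean M (fun y => CV * (s * beta ^- M) `^ p * (S y)%:R) <= _).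
  rewrite ler_pM2l ?exprn_gt0 //; apply: le_mean => y; rewrite /u.
  case: (S y); rewrite ?mulr0 ?mulr1 /=; last first.
    rewrite -(mean_cst N 0); apply: le_mean => x.
    by rewrite mul0r !mulr0 ge_min lexx orbT.
  rewrite (eq_mean _ (g := fun x => Num.min 1 (s * majV beta M (addc y x)))); last first.
    by move=> x; rewrite mul1r (addcC x y) /s !mulrA.
  rewrite (mean_addc (f := fun x => Num.min 1 (s * majV beta M x))); last first.
    apply: (depS MN); apply: (dep_comp (fun t => Num.min 1 (s * t))); exact: dep_majV.
  rewrite (@mean_dep _ M) //; first exact: hV.
  by apply: (dep_comp (fun t => Num.min 1 (s * t))); exact: dep_majV.
rewrite meanZ.
have -> : mean N (fun x => (S x)%:R) = mean M (fun x => (S x)%:R) :> R.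
  by apply: mean_dep => //; exact: (dep_comp (fun b : bool => b%:R)).
have -> : s * beta ^- M = D * C1 * (2 * beta) ^- M.
  by rewrite /s exprMn invfM; ring.
have i0 : 0 <= (2 * beta) ^- M by rewrite invr_ge0 exprn_ge0 // mulr_ge0 // ltW.
(* Each cell contributes a factor 2^-M, which cancels the number 2^M of cells: the estimate does not
   depend on M. *)
have hp : ((2 * beta) ^- M) `^ p = 2 ^- M.
  have b20 : 0 <= 2 * beta by rewrite mulr_ge0 // ltW.
  rewrite -powR_invn // -powRrM [- M%:R * p]mulrC powRrM powp powR_invn //.
rewrite (powRM _ (mulr_ge0 D0 C10) i0) hp (powRM _ D0 C10) le_eqVlt; apply/orP; left; apply/eqP.
by field; rewrite expf_neq0.
Qed.

End NorlundOperator.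

(** * The weak type inequality at a finite level *)

Section DyadicStopping.
Context {R : realType}.
Implicit Types (x y : nat -> bool) (n m N : nat) (s : R).

Definition tree_martingale (f : nat -> (nat -> bool) -> R) : Prop :=
  (forall n, dep n (f n)) /\ (forall n x, avg n (f n.+1) x = f n x).

Variable f : nat -> (nat -> bool) -> R.
Hypothesis mf : tree_martingale f.

(* The predictable maximal function: [predmax n] only depends on the first
   [n - 1] coordinates. *)
Fixpoint predmax n x : R :=
  if n is m.+1 then
    Num.max (predmax m x)
      (Num.max `|f m.+1 (setc m false x)| `|f m.+1 (setc m true x)|)
  else 0.

Definition fmax N x : R := \big[Num.max/0]_(n < N.+1) `|f n x|.

(** The event that the predictable stopping time at level s equals n. It belongs to F_n because
    [predmax n.+1] looks at n coordinates only. *)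
Definition stopped s n x : bool := (predmax n x <= s) && (s < predmax n.+1 x).

(** The stopped martingale minus f_0. The increment that could lead above s is left out, which keeps
    the sum bounded by 2 s. *)
Definition trunc_sum s N x : R := \sum_(m < N | predmax m.+1 x <= s) (f m.+1 x - f m x).

Lemma predmaxS n x : predmax n x <= predmax n.+1 x.
Proof. by rewrite /= le_max lexx. Qed.

Lemma predmax_homo m n x : (m <= n)%N -> predmax m x <= predmax n x.
Proof.
move=> /subnKC <-; elim: (n - m)%N => [|k IH]; first by rewrite addn0.
by rewrite addnS; exact: le_trans IH (predmaxS _ _).
Qed.

Lemma predmax_ge0 n x : 0 <= predmax n x.
Proof. exact: (@predmax_homo 0). Qed.

Lemma dep_predmax n : dep n (predmax n.+1).
Proof.
have dm m v : dep m (fun x => `|f m.+1 (setc m v x)|).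
  move=> x y xy; congr (`|_|); apply: (mf.1 m.+1) => i.
  by rewrite ltnS leq_eqVlt /setc; case: eqP => //= _ /xy.
elim: n => [|n IH] x y xy; rewrite /= -/(predmax _ _).
  by congr (Num.max _ (Num.max _ _)); apply: (dm 0%N).
congr (Num.max _ (Num.max _ _)); [|exact: (dm n.+1)..].
by apply: IH => i ni; apply: xy; rewrite ltnW.
Qed.

Lemma le_predmax n x : `|f n.+1 x| <= predmax n.+1 x.
Proof.
rewrite -{1}(setc_id n x) /= le_max; case: (x n); rewrite ?(le_max, lexx, orbT) //.
Qed.

Lemma le_predmax_prev n x : `|f n x| <= predmax n.+1 x.
Proof.
rewrite -(mf.2 n x) /avg normrM [`|2^-1|]ger0_norm ?invr_ge0 //.
have h v : `|f n.+1 (setc n v x)| <= predmax n.+1 x.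
  by rewrite /= !le_max; case: v; rewrite lexx ?orbT.
have := ler_normD (f n.+1 (setc n false x)) (f n.+1 (setc n true x)).
by have := h false; have := h true; lra.
Qed.

Arguments predmax n x : simpl never.

Lemma le_fmax N n x : (n <= N)%N -> `|f n x| <= fmax N x.
Proof.
move=> nN; rewrite /fmax.
by have := le_bigmax 0 (fun n : 'I_N.+1 => `|f n x|) (Ordinal (nN : (n < N.+1)%N)).
Qed.

Lemma trunc_sum_full s N x : predmax N x <= s -> trunc_sum s N x = f N x - f 0%N x.
Proof.
move=> h; rewrite /trunc_sum -(telescope_sumr (fun m => f m x) (leq0n N)) big_mkord.
apply: eq_bigl => m; apply/idP; apply: le_trans h; exact: predmax_homo.
Qed.

Lemma trunc_sum_le s N x : 0 <= s -> `|trunc_sum s N x| <= 2 * s.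
Proof.
move=> s0; elim: N => [|N IH]; first by rewrite /trunc_sum big_ord0 normr0 mulr_ge0.
have [h|h] := leP (predmax N.+1 x) s; last first.
  have hF : (predmax N.+1 x <= s) = false by rewrite leNgt h.
  by rewrite /trunc_sum big_mkcond big_ord_recr /= hF addr0 -big_mkcond.
rewrite trunc_sum_full //; apply: le_trans (ler_normB _ _) _.
have h1 := le_trans (le_predmax N x) h.
have h2 := le_trans (le_trans (le_predmax_prev 0 x) (@predmax_homo 1 N.+1 x isT)) h.
by lra.
Qed.

Lemma sum_stopped s N x : 0 <= s ->
  \sum_(n < N) (stopped s n x)%:R = (s < predmax N x)%R%:R :> R.
Proof.
move=> s0; elim: N => [|N IH]; first by rewrite big_ord0 ltNge s0.
rewrite big_ord_recr /= IH /stopped; have := predmaxS N x.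
case: (leP (predmax N x) s) => h1 h2 /=; first by rewrite add0r.
by rewrite (lt_le_trans h1 h2) addr0.
Qed.

Lemma dep_stopped s n : dep n (stopped s n).
Proof.
move=> x y xy; rewrite /stopped (dep_predmax xy); congr ((_ <= _) && _).
case: n xy => [//|n] xy; apply: dep_predmax => i ni; apply: xy; exact: ltnW.
Qed.

(** On the event that stopping occurs at n, increments before n belong to both truncations and
    cancel; the later ones are martingale differences multiplied by F_m-measurable factors. *)
Lemma stopped_atom s s' N n e : s <= s' -> dep n e ->
  mean N (fun x => (stopped s n x)%:R * (trunc_sum s' N x - trunc_sum s N x) * e x) = 0.
Proof.
move=> ss' de.
pose h m x : R := (stopped s n x)%:R *
  ((predmax m.+1 x <= s')%R%:R - (predmax m.+1 x <= s)%R%:R) * e x.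
have -> : (fun x => (stopped s n x)%:R * (trunc_sum s' N x - trunc_sum s N x) * e x) =
  fun x => \sum_(m < N) h m x * (f m.+1 x - f m x).
  apply: funext => x; rewrite /trunc_sum big_mkcond [X in _ - X]big_mkcond -sumrB.
  rewrite mulr_sumr mulr_suml; apply: eq_bigr => m _; rewrite /h.
  by case: (_ <= s'); case: (_ <= s) => /=; ring.
rewrite mean_sum big1 // => m _; have [mn|nm] := ltnP m n.
  rewrite -[RHS](mean_cst N); apply: eq_mean => x; rewrite /h.
  case E : (stopped s n x); last by rewrite !mul0r.
  have h1 : predmax m.+1 x <= s.
    by case/andP: E => h1 _; apply: le_trans h1; exact: predmax_homo.
  by rewrite h1 (le_trans h1 ss') subrr mulr0 !mul0r.
have dh : dep m (h m).
  move=> x y xy; have xy' i : (i < n)%N -> x i = y i.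
    by move=> im; apply: xy; apply: leq_trans nm.
  by rewrite /h (dep_stopped s xy') (dep_predmax xy) (de _ _ xy').
rewrite (mean_dep_avg (fun x => f m.+1 x - f m x) (ltn_ord m) dh).
rewrite -[RHS](mean_cst N); apply: eq_mean => x.
have -> : avg m (fun x => f m.+1 x - f m x) x = avg m (f m.+1) x - avg m (f m) x.
  by rewrite /avg; ring.
by rewrite mf.2 (avg_dep (leqnn m) (mf.1 m)) subrr mulr0.
Qed.

(** When the process stops at n, at least one of the two values of f_(n+1) exceeds s in modulus. So
    f_(n+1) is large on at least half of the stopping event, and the factor 2 is the price of
    predictability. *)
Lemma mean_stopped_le s N : 0 <= s ->
  \sum_(n < N) mean N (fun x => (stopped s n x)%:R : R) <=
  2 * mean N (fun x => (s < fmax N x)%R%:R).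
Proof.
move=> s0; pose g n x : R := (stopped s n x)%:R * (s < `|f n.+1 x|)%R%:R.
apply: le_trans (_ : \sum_(n < N) 2 * mean N (g n) <= _).
  apply: ler_sum => n _; rewrite -(mean_avg (g n) (ltn_ord n)) -meanZ.
  apply: le_mean => x; rewrite /avg /g.
  rewrite !(dep_setc _ _ (@dep_stopped s n) (leqnn n)).
  case E : (stopped s n x); last by rewrite !mul0r addr0 !(mulr0, mul0r).
  case/andP: E => h1 /=; rewrite lt_max ltNge h1 /= lt_max.
  by case: (s < _); case: (s < _) => //= _; lra.
rewrite -mulr_sumr ler_pM2l // -mean_sum; apply: le_mean => x.
have [h|h] := ltP s (fmax N x).
  apply: le_trans (_ : \sum_(n < N) (stopped s n x)%:R <= _).
    by apply: ler_sum => n _; rewrite /g; case: (stopped _ _ _); case: (s < _) => /=; lra.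
  by rewrite sum_stopped //; case: (s < _).
rewrite big1 // => n _; rewrite /g [s < `|_|]ltNge.
by rewrite (le_trans _ h) ?mulr0 // le_fmax.
Qed.

End DyadicStopping.

(** * The weak type inequality with threshold 1 *)

Section FiniteWeakType.
Context {R : realType}.
Variables (q : nat -> R) (beta K p : R).
Hypothesis q_ge0 : forall k, 0 <= q k.
Hypothesis q_noninc : nonincreasing_seq q.
Hypothesis q0_gt0 : 0 < q 0%N.
Hypothesis beta_gt1 : 1 < beta.
Hypothesis beta_lt2 : beta < 2.
Hypothesis K_ge0 : 0 <= K.
Hypothesis weightK : forall l A, (l <= A)%N ->
  norlund_weight q (2 ^ l) <= K * norlund_weight q (2 ^ A) / beta ^+ A * beta ^+ l.
Hypothesis p_gt0 : 0 < p.
Hypothesis p_le1 : p <= 1.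
Hypothesis powp : (2 * beta) `^ p = 2.

Lemma min1_sum (I : Type) (r : seq I) (F : I -> R) : (forall i, 0 <= F i) ->
  Num.min 1 (\sum_(i <- r) F i) <= \sum_(i <- r) Num.min 1 (F i).
Proof.
move=> F0; elim: r => [|i r IH]; first by rewrite !big_nil ge_min lexx orbT.
rewrite !big_cons; apply: le_trans (min1D _ _) _ => //; first exact: sumr_ge0.
by rewrite lerD2l.
Qed.

Lemma sum_geometric_pow_le (L y : R) n : 0 < L -> 0 <= y ->
  \sum_(k < n) (L * 2 ^+ k) `^ p * (L * 2 ^+ k < y)%R%:R <=
  2 `^ p / (2 `^ p - 1) * y `^ p.
Proof.
move=> L0 y0.
have c1 : 1 < 2 `^ p :> R.
  have e1 : 1 `^ p = 1 :> R by rewrite powR1.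
  by rewrite -[ltLHS]e1 gt0_ltr_powR ?nnegrE // ltr1n.
set c := 2 `^ p in c1 *.
have C0 : 0 <= c / (c - 1) by rewrite divr_ge0 ?subr_ge0 ?ltW // (lt_trans ltr01).
pose s k : R := L * 2 ^+ k.
have s0 k : 0 <= s k by rewrite mulr_ge0 ?exprn_ge0 // ltW.
have sS k : (s k.+1) `^ p = c * (s k) `^ p.
  by rewrite /s exprS mulrCA (powRM _ (ler0n R 2) (s0 k)).
have full m : \sum_(k < m) (s k) `^ p <= (s m) `^ p / (c - 1).
  elim: m => [|m IH]; first by rewrite big_ord0 divr_ge0 ?powR_ge0 // subr_ge0 ltW.
  rewrite big_ord_recr /= sS; apply: le_trans (lerD IH (lexx _)) _.
  rewrite le_eqVlt; apply/orP; left; apply/eqP; field.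
  by rewrite subr_eq0 gt_eqF.
elim: n => [|n IH]; first by rewrite big_ord0 mulr_ge0 ?powR_ge0.
rewrite big_ord_recr /= -/(s n); have [h|h] := ltP (s n) y; last by rewrite mulr0 addr0.
rewrite mulr1; apply: le_trans (_ : \sum_(k < n.+1) (s k) `^ p <= _).
  rewrite big_ord_recr /= lerD2r; apply: ler_sum => k _; rewrite -/(s k).
  by case: (_ < _); rewrite ?mulr1 ?mulr0 ?powR_ge0.
apply: (le_trans (full _)); rewrite sS mulrAC ler_wpM2l //.
by rewrite ge0_ler_powR ?nnegrE ?(ltW p_gt0) ?(ltW h).
Qed.

Theorem mean_norlund_opmax_weak : exists2 C : R, 0 <= C &
  forall N (f : nat -> (nat -> bool) -> R), tree_martingale f ->
  mean N (fun x => (1 < norlund_opmax q N (f N) x)%R%:R) <=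
  C * mean N (fun x => fmax f N x `^ p).
Proof.
have [Cb Cb1 hb] := norlund_opmax_bounded q_ge0 q_noninc q0_gt0 beta_gt1 beta_lt2 K_ge0 weightK.
have [Ca Ca0 ha] := mean_norlund_opmax_atom q_ge0 q_noninc q0_gt0 beta_gt1 beta_lt2 K_ge0
  weightK p_gt0 p_le1 powp.
pose C0 : R := 2 `^ p / (2 `^ p - 1).
have c1 : 1 < 2 `^ p :> R.
  have e1 : 1 `^ p = 1 :> R by rewrite powR1.
  by rewrite -[ltLHS]e1 gt0_ltr_powR ?nnegrE // ltr1n.
have C00 : 0 <= C0 by rewrite divr_ge0 ?powR_ge0 // subr_ge0 ltW.
exists (Ca * (2 `^ p + 16 `^ p * 2 * C0)).
  exact: mulr_ge0 Ca0 (addr_ge0 (powR_ge0 _ _)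
    (mulr_ge0 (mulr_ge0 (powR_ge0 _ _) (ler0n R 2)) C00)).
move=> N f mf.
(* The part truncated at L is at most 2 L in modulus, so its image is at most 2 Cb L = 1/2: half of
   the threshold 1. *)
pose L : R := (4 * Cb)^-1.
have Cb0 : 0 < Cb by exact: lt_le_trans Cb1.
have L0 : 0 < L by rewrite invr_gt0 mulr_gt0.
pose s k : R := L * 2 ^+ k.
have s0 k : 0 <= s k by rewrite mulr_ge0 ?exprn_ge0 // ltW.
have sS k : s k.+1 = 2 * s k by rewrite /s exprS mulrCA.
have s_le k : s k <= s k.+1 by rewrite sS; have := s0 k; lra.
(* [predmax f N] depends on finitely many coordinates, hence is bounded, and finitely many levels
   decompose f_N exactly. *)
have [n hn] : exists n, forall x, predmax f N x <= s n.
  pose B := 2 ^+ N * mean N (predmax f N).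
  have B0 : 0 <= B.
    by rewrite mulr_ge0 ?exprn_ge0 // mean_ge0 // => x; exact: predmax_ge0.
  exists (Num.bound (B / L)) => x.
  apply: le_trans (_ : B <= _).
    apply: le_mean_dep; first by move=> y; exact: predmax_ge0.
    by case: N {B B0} => [//|N]; apply: (depS (leqnSn N)); exact: dep_predmax.
  have := archi_boundP (divr_ge0 B0 (ltW L0)).
  set k := Num.bound _ => hk.
  rewrite /s mulrC -ler_pdivrMr //; apply: le_trans (ltW hk) _.
  by rewrite -natrX ler_nat ltnW // ltn_expl.
pose T g x := norlund_opmax q N g x.
pose d k (j : nat) x : R :=
  (stopped f (s k) j x)%:R * (trunc_sum f (s k.+1) N x - trunc_sum f (s k) N x).
have deco x : f N x =
    f 0%N x + trunc_sum f (s 0%N) N x + \sum_(k < n) \sum_(j < N) d k j x.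
  (* Where level s_k is never exceeded, both truncations equal f_N - f_0 and their difference
     vanishes; elsewhere exactly one stopping event occurs. *)
  have -> : \sum_(k < n) \sum_(j < N) d k j x =
    \sum_(k < n) (trunc_sum f (s k.+1) N x - trunc_sum f (s k) N x).
    apply: eq_bigr => k _; rewrite /d -mulr_suml sum_stopped //.
    case: ltP => h; rewrite ?mul1r // mul0r.
    by rewrite !trunc_sum_full ?subrr // (le_trans h).
  rewrite -(big_mkord xpredT (fun k => trunc_sum f (s k.+1) N x - trunc_sum f (s k) N x)).
  rewrite telescope_sumr // (trunc_sum_full (hn x)); ring.
(* The pieces other than the bounded part must exceed the remaining 1/2; doubling them restores the
   threshold 1. *)
have T2 g x : T g x <= 2^-1 * T (fun y => 2 * g y) x.
  apply: norlund_opmax_le; first by rewrite mulr_ge0 // norlund_opmax_ge0.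
  move=> m mN; have -> : norlund_op q N m g x = 2^-1 * norlund_op q N m (fun y => 2 * g y) x.
    by rewrite /norlund_op -meanZ; apply: eq_mean => y; field.
  rewrite normrM ger0_norm // ler_pM2l ?invr_gt0 //; exact: le_norlund_opmax.
have T_ge0 g x : 0 <= T g x by exact: norlund_opmax_ge0.
pose Tmin g x := Num.min 1 (T (fun y => 2 * g y) x).
have Tmin_ge0 g x : 0 <= Tmin g x by rewrite le_min ler01 T_ge0.
have pointwise x : (1 < T (f N) x)%R%:R <=
    Tmin (f 0%N) x + \sum_(k < n) \sum_(j < N) Tmin (d k j) x.
  case: (ltP 1 (T (f N) x)) => h; last first.
    by rewrite addr_ge0 // sumr_ge0 // => k _; apply: sumr_ge0.
  pose W := T (fun y => 2 * f 0%N y) x + \sum_(k < n) \sum_(j < N) T (fun y => 2 * d k j y) x.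
  have W0 : 1 <= W.
    have h1 : T (f N) x <= T (f 0%N) x + T (trunc_sum f (s 0%N) N) x +
        \sum_(k < n) \sum_(j < N) T (d k j) x.
      rewrite (funext deco); apply: le_trans (norlund_opmaxD _ _ _ _ _) _.
      apply: lerD; first exact: norlund_opmaxD.
      apply: le_trans (norlund_opmax_sum _ _ _ _ _) _; apply: ler_sum => k _.
      exact: norlund_opmax_sum.
    have h2 : T (trunc_sum f (s 0%N) N) x <= 2^-1.
      apply: le_trans (hb N (2 * s 0%N) _ x _ _) _; first by rewrite mulr_ge0.
        by move=> y; exact: trunc_sum_le.
      by rewrite /s expr0 mulr1 /L le_eqVlt; apply/orP; left; apply/eqP; field; rewrite gt_eqF.
    have h3 : \sum_(k < n) \sum_(j < N) T (d k j) x <=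
        2^-1 * \sum_(k < n) \sum_(j < N) T (fun y => 2 * d k j y) x.
      rewrite mulr_sumr; apply: ler_sum => k _; rewrite mulr_sumr; apply: ler_sum => j _.
      exact: T2.
    by have := T2 (f 0%N) x; rewrite /W; lra.
  have -> : true%:R = Num.min 1 W :> R by rewrite min_l.
  rewrite /W; apply: le_trans (min1D _ _) _ => //.
    by rewrite sumr_ge0 // => k _; apply: sumr_ge0.
  rewrite lerD2l; apply: le_trans (min1_sum _ _) _.
    by move=> k; apply: sumr_ge0.
  by apply: ler_sum => k _; apply: min1_sum.
apply: le_trans (le_mean N pointwise) _.
rewrite meanD mean_sum mulrDr mulrDl; apply: lerD.
  pose c := `|f 0%N (fun=> false)|.
  have fc x : `|f 0%N x| = c by rewrite /c (mf.1 0%N x (fun=> false)).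
  apply: le_trans (ha N 0%N (2 * c) (fun=> true) _ _ (leq0n N) _ _ _) _ => //.
  - by rewrite mulr_ge0 // /c normr_ge0.
  - by move=> y; rewrite mulr1 normrM fc ger0_norm.
  - by left.
  rewrite mean_cst mulr1 powRM ?normr_ge0 // mulrA ler_wpM2l ?mulr_ge0 ?powR_ge0 //.
  rewrite -(mean_cst N (c `^ p)); apply: le_mean => x.
  by rewrite -(fc x) ge0_ler_powR ?nnegrE ?(ltW p_gt0) ?le_fmax // (le_trans (normr_ge0 _) (le_fmax f x (leq0n N))).
apply: le_trans (_ : \sum_(k < n) Ca * 16 `^ p * 2 *
    mean N (fun x => (s k) `^ p * (s k < fmax f N x)%R%:R) <= _).
  apply: ler_sum => k _; rewrite mean_sum.
  (* A piece is at most 2 s_(k+1) + 2 s_k = 6 s_k in modulus, and 12 s_k after doubling; 16 leaves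
     room. *)
  apply: le_trans (_ : \sum_(j < N) Ca * (16 * s k) `^ p *
      mean N (fun x => (stopped f (s k) j x)%:R) <= _).
    apply: ler_sum => j _; apply: (ha N j (16 * s k) (stopped f (s k) j)).
    - by rewrite mulr_ge0.
    - exact: ltnW.
    - exact: dep_stopped.
    - move=> y; rewrite /d !normrM !normr_nat mulrCA [leRHS]mulrC ler_wpM2l //.
      have := trunc_sum_le mf N y (s0 k); have := trunc_sum_le mf N y (s0 k.+1).
      have := ler_normB (trunc_sum f (s k.+1) N y) (trunc_sum f (s k) N y).
      by rewrite sS; have := s0 k; lra.
    - right=> e de.
      have := stopped_atom mf N (s_le k) de => h.
      rewrite (eq_mean _ (g := fun x => 2 * ((stopped f (s k) j x)%:R *
        (trunc_sum f (s k.+1) N x - trunc_sum f (s k) N x) * e x))).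
        by rewrite meanZ h mulr0.
      by move=> x; rewrite /d; ring.
  rewrite -mulr_sumr meanZ (powRM _ (ler0n R 16) (s0 k)).
  have h := mean_stopped_le mf N (s0 k).
  have h2 : 0 <= Ca * (16 `^ p * s k `^ p) by rewrite !mulr_ge0 ?powR_ge0.
  apply: le_trans (ler_wpM2l h2 h) _.
  by rewrite le_eqVlt; apply/orP; left; apply/eqP; ring.
rewrite -mulr_sumr -mean_sum.
have -> : Ca * (16 `^ p * 2 * C0) * mean N (fun x => fmax f N x `^ p) =
   Ca * 16 `^ p * 2 * mean N (fun x => C0 * fmax f N x `^ p).
  by rewrite meanZ; ring.
rewrite ler_wpM2l ?mulr_ge0 ?powR_ge0 //; apply: le_mean => x.
by apply: sum_geometric_pow_le => //; exact: bigmax_ge_id.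
Qed.

End FiniteWeakType.

(** * Growth of the weights under the two conditions of part (a) *)

Section WeightGrowth.
Context {R : realType}.
Variables (q : nat -> R) (alpha : R).
Hypothesis q_ge0 : forall k, 0 <= q k.
Hypothesis q_noninc : nonincreasing_seq q.
Hypothesis q0_gt0 : 0 < q 0%N.
Hypothesis alpha_gt0 : 0 < alpha.
Hypothesis alpha_lt1 : alpha < 1.

Let beta : R := 2 `^ alpha.

Lemma powR_pow2 (a : R) n : (2 ^+ n) `^ a = (2 `^ a) ^+ n.
Proof.
elim: n => [|n IH]; first by rewrite !expr0 powR1.
by rewrite !exprS powRM ?exprn_ge0 // IH.
Qed.

Lemma powR2_gt1 (a : R) : 0 < a -> 1 < 2 `^ a.
Proof.
move=> a0; have e1 : 1 `^ a = 1 :> R by rewrite powR1.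
by rewrite -[ltLHS]e1 gt0_ltr_powR ?nnegrE // ltr1n.
Qed.

Lemma powR2_lt2 (a : R) : a < 1 -> 2 `^ a < 2.
Proof.
move=> a1; have h : 2 `^ a * 2 `^ (1 - a) = 2 :> R.
  have e : a + (1 - a) = 1 by ring.
  by rewrite -powRD e ?oner_eq0 // powRr1.
rewrite -[ltRHS]h ltr_pMr ?powR_gt0 // powR2_gt1 // subr_gt0 //.
Qed.

(** As Q(2^(l+1)) - Q(2^l) <= 2^l q(2^l), it suffices to bound 2^l q(2^l) by a multiple of beta^l
    Q(2^A) / beta^A. The second condition bounds q(2^l) - q(2^A) by a multiple of (beta / 2)^l,
    which 2^l turns into beta^l; the first bounds Q(2^A) / beta^A from below and absorbs this error;
    q(2^A) is at most 2^-A Q(2^A). *)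
Lemma weight_growth :
  (fun n : nat => q 0%N * n%:R `^ alpha / norlund_weight q n) =O_\oo (fun _ : nat => 1 : R) ->
  (fun n : nat => (q n - q n.+1) / n%:R `^ (alpha - 2)) =O_\oo (fun _ : nat => 1 : R) ->
  exists2 K : R, 0 <= K & forall l A, (l <= A)%N ->
    norlund_weight q (2 ^ l) <= K * norlund_weight q (2 ^ A) / beta ^+ A * beta ^+ l.
Proof.
have b1 := powR2_gt1 alpha_gt0; have b2 := powR2_lt2 alpha_lt1; rewrite -/beta in b1 b2 *; have b0 : 0 < beta by exact: lt_trans b1.
move=> /eqO_exP [k k0 [n0 _ hk]] /eqO_exP [k' k'0 [n1 _ hk']].
have Q0 n := norlund_weight_gt0 q_ge0 q0_gt0 (n := n).
pose Q A := norlund_weight q (2 ^ A).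
have QA0 A : 0 < Q A by apply: Q0; rewrite expn_gt0.
have bA0 A : 0 < beta ^+ A by rewrite exprn_gt0.
pose rho := beta / 2.
have rho0 : 0 < rho by rewrite divr_gt0.
have rho1 : rho < 1 by rewrite ltr_pdivrMr // mul1r.
have rhoA0 A : 0 < rho ^+ A by rewrite exprn_gt0.
(* The summand beta^n0 covers the exponents A < n0 not reached by the asymptotic hypothesis, since
   Q(2^A) >= q_0. *)
pose c1 := (k + beta ^+ n0) / q 0%N.
have c10 : 0 <= c1 by rewrite divr_ge0 // addr_ge0 // ltW.
have hc1 A : beta ^+ A <= c1 * Q A.
  rewrite /c1 mulrAC ler_pdivlMr // mulrDl.
  have [h|h] := leqP n0 A.
    apply: ler_wpDr; first by rewrite mulr_ge0 // ltW.
    have := hk (2 ^ A)%N (leq_trans h (ltnW (ltn_expl A (ltnSn 1)))).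
    rewrite /= normr1 mulr1 natrX powR_pow2 ger0_norm; last first.
      by rewrite divr_ge0 ?mulr_ge0 ?(ltW (QA0 A)) // ltW.
    by rewrite (ler_pdivrMr _ _ (QA0 A)) [q 0%N * _]mulrC.
  apply: ler_wpDl; first by rewrite mulr_ge0 // ltW.
  apply: ler_pM => //; first exact: ltW.
    by rewrite ler_eXn2l // ltnW.
  have := q_le_weight q_noninc 1; have := norlund_weight_le q_ge0 (expn_gt0 2 A : (1 <= 2 ^ A)%N).
  rewrite -/(Q A) !norlund_weightE big_ord1; lra.
(* The second summand covers the exponents i < n1, where the difference is at most q_0. *)
pose c2 := k' + q 0%N / rho ^+ n1.
have c20 : 0 <= c2 by rewrite addr_ge0 ?divr_ge0 // ltW.
have hc2 i : q (2 ^ i)%N - q (2 ^ i.+1)%N <= c2 * rho ^+ i.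
  rewrite /c2 mulrDl; have [h|h] := leqP n1 i; last first.
    apply: ler_wpDl; first by rewrite mulr_ge0 // ltW.
    apply: le_trans (_ : q 0%N <= _).
      by have := q_noninc (leq0n (2 ^ i)); have := q_ge0 (2 ^ i.+1)%N; lra.
    rewrite mulrAC ler_pdivlMr // ler_wpM2l //.
    by rewrite -(subnK (ltnW h)) exprD ler_piMl ?exprn_ile1 // ltW.
  apply: ler_wpDr; first by rewrite mulr_ge0 ?divr_ge0 // ltW.
  have -> : q (2 ^ i)%N - q (2 ^ i.+1)%N = \sum_(j < 2 ^ i) (q (2 ^ i + j)%N - q (2 ^ i + j).+1).
    rewrite -opprB -(telescope_sumr q) ?leq_exp2l // -sumrN.
    rewrite -{1}[(2 ^ i)%N]add0n big_addn expnS mul2n -addnn addnK big_mkord.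
    by apply: eq_bigr => j _; rewrite opprB addnC.
  have -> : k' * rho ^+ i = \sum_(j < 2 ^ i) (k' * (2 ^+ i) `^ (alpha - 2)).
    have e : (2 ^+ i) `^ (alpha - 2) * 2 ^+ i = rho ^+ i :> R.
      rewrite powR_pow2 powRB; last by rewrite pnatr_eq0 implybT.
      rewrite powR_mulrn //.
      rewrite -exprMn /rho; congr (_ ^+ _); by rewrite -/beta; field.
    by rewrite big_const_ord iter_addr addr0 -e mulrA -natrX mulr_natr.
  apply: ler_sum => j _; set m := (2 ^ i + j)%N.
  have m0 : 0 < m%:R :> R by rewrite ltr0n addn_gt0 expn_gt0.
  have p0 : 0 < m%:R `^ (alpha - 2) :> R by rewrite powR_gt0.
  have nm : (n1 <= m)%N.
    by apply: leq_trans (leq_addr _ _); apply: leq_trans h (ltnW (ltn_expl i (ltnSn 1))).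
  have := hk' m nm; rewrite /= normr1 mulr1 ger0_norm; last first.
    by rewrite divr_ge0 ?(ltW p0) // subr_ge0 q_noninc.
  rewrite ler_pdivrMr // => hm; apply: le_trans hm _; rewrite ler_wpM2l ?(ltW k'0) //.
  have -> : alpha - 2 = - (2 - alpha) by ring.
  rewrite !powRN lef_pV2 ?posrE ?powR_gt0 ?exprn_gt0 //.
  rewrite ge0_ler_powR ?nnegrE ?exprn_ge0 ?(ltW m0) //; first by move: alpha_lt1; lra.
  by rewrite -natrX ler_nat leq_addr.
pose c3 := c2 / (1 - rho).
have c30 : 0 <= c3 by rewrite divr_ge0 // subr_ge0 ltW.
have ec3 : c3 * (1 - rho) = c2 by rewrite /c3 divfK // subr_eq0 gt_eqF.
have hc3 l j : q (2 ^ l)%N <= q (2 ^ (l + j))%N + c3 * (rho ^+ l - rho ^+ (l + j)).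
  elim: j => [|j IH]; first by rewrite addn0 subrr mulr0 addr0.
  have := hc2 (l + j)%N; rewrite addnS exprS -ec3; move: IH; lra.
pose E A := Q A / beta ^+ A.
have E0 A : 0 <= E A by rewrite divr_ge0 // ltW.
have c1E A : 1 <= c1 * E A by rewrite /E mulrA ler_pdivlMr // mul1r.
pose c4 := 1 + c3 * c1.
have c40 : 0 <= c4 by rewrite addr_ge0 // mulr_ge0.
have hc4 l A : (l <= A)%N -> 2 ^+ l * q (2 ^ l)%N <= c4 * E A * beta ^+ l.
  move=> lA; have h1 := hc3 l (A - l)%N; rewrite subnKC // in h1.
  have h2 : 2 ^+ l * q (2 ^ A)%N <= E A * beta ^+ l.
    have hA := q_le_weight q_noninc (2 ^ A); rewrite natrX -/(Q A) in hA.
    rewrite /E mulrAC ler_pdivlMr //.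
    have -> : 2 ^+ l * q (2 ^ A)%N * beta ^+ A =
        beta ^+ l * (2 ^+ l * beta ^+ (A - l) * q (2 ^ A)%N).
      by rewrite -{2}(subnKC lA) exprD; ring.
    rewrite [leRHS]mulrC ler_wpM2l ?(ltW (bA0 l)) //; apply: le_trans hA.
    rewrite ler_wpM2r // -[in leRHS](subnKC lA) [leRHS]exprD ler_wpM2l ?exprn_ge0 //.
    by rewrite lerXn2r ?nnegrE // ltW.
  have h3 : 2 ^+ l * (c3 * (rho ^+ l - rho ^+ A)) <= c3 * c1 * E A * beta ^+ l.
    apply: le_trans (_ : c3 * beta ^+ l <= _).
      rewrite mulrCA ler_wpM2l // mulrBr -exprMn /rho [2 * _]mulrC divfK //.
      by rewrite gerBl mulr_ge0 ?exprn_ge0 // ltW.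
    rewrite ler_wpM2r ?(ltW (bA0 l)) // -mulrA; exact: ler_peMr.
  have := ler_wpM2l (exprn_ge0 l (ler0n R 2)) h1; rewrite /c4; lra.
have bm1 : 0 <= beta - 1 by rewrite subr_ge0 ltW.
(* The first term absorbs the increments c4 beta^l, whose sum is geometric with ratio beta; the
   second gives the case l = 0, where Q(1) = q_0. *)
exists (c4 / (beta - 1) + q 0%N * c1).
  by apply: addr_ge0; [exact: divr_ge0 | exact: mulr_ge0 (ltW q0_gt0) c10].
move=> l A lA; rewrite -[X in X * beta ^+ l]mulrA -/(E A).
elim: l lA => [|l IH] lA.
  rewrite expr0 mulr1 expn0 norlund_weightE big_ord1 mulrDl.
  apply: ler_wpDl; first exact: mulr_ge0 (divr_ge0 c40 bm1) (E0 A).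
  by rewrite -mulrA ler_peMr.
have hQ : Q l.+1 <= Q l + 2 ^+ l * q (2 ^ l)%N.
  rewrite /Q expnS mul2n -addnn norlund_weightD lerD2l -natrX.
  rewrite -[X in X%:R * _]card_ord mulr_natl -sumr_const; apply: ler_sum => i _.
  by apply: q_noninc; exact: leq_addr.
apply: le_trans hQ _; apply: le_trans (lerD (IH (ltnW lA)) (hc4 _ _ (ltnW lA))) _.
have -> : c4 * E A * beta ^+ l = c4 / (beta - 1) * (beta - 1) * E A * beta ^+ l.
  by rewrite divfK // subr_eq0 gt_eqF.
rewrite exprS -subr_ge0.
have e a b c d : (a + b) * c * (beta * d) -
  ((a + b) * c * d + a * (beta - 1) * c * d) = b * c * d * (beta - 1) :> R by ring.
rewrite e; exact: mulr_ge0 (mulr_ge0 (mulr_ge0 (mulr_ge0 (ltW q0_gt0) c10) (E0 A)) (ltW (bA0 l))) bm1.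
Qed.

End WeightGrowth.

(** * Haar integrals of functions of finitely many coordinates *)

Section HaarMean.
Context {R : realType}.
Implicit Types (N n : nat) (x y : nat -> bool).

Local Notation haar := (@haar R).

(** A is the union of the cylinders of rank N that it contains; finite words as indices make the
    union countable. *)
Lemma dep_sigma_algebra N (A : set (nat -> bool)) :
  dep N (A : (nat -> bool) -> Prop) -> <<s dyadic_intervals N >> A.
Proof.
move=> dA.
have -> : A = \bigcup_(s : seq bool)
    [set y | A (nth false s) /\ dyadic_interval N (nth false s) y].
  apply/seteqP; split=> [y Ay|y [s _ [As sy]]].
    exists (mkseq y N) => //; split.
      by rewrite -(dA y) // => i iN; rewrite nth_mkseq.
    by move=> i iN; rewrite nth_mkseq.
  by rewrite (dA _ (nth false s)).
apply: (@countable_bigcupT_measurable _ (g_sigma_algebraType (dyadic_intervals N))).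
  exact: countableP.
move=> s; have [As|nAs] := pselect (A (nth false s)).
  rewrite (_ : [set y | _] = dyadic_interval N (nth false s)).
    by apply: sub_sigma_algebra; exists (nth false s).
  by apply/seteqP; split => // y [].
rewrite (_ : [set y | _] = set0); first exact: measurable0.
by apply/seteqP; split => // y [].
Qed.

Lemma sigma_algebra_dep N (A : set (nat -> bool)) :
  <<s dyadic_intervals N >> A -> dep N (A : (nat -> bool) -> Prop).
Proof.
apply: (@smallest_sub _ _ _ [set A | dep N (A : (nat -> bool) -> Prop)]).
  split.
  - by move=> x y _.
  - move=> B dB x y xy; rewrite /setD /mkset; rewrite (dB _ _ xy) //.
  - by move=> F dF x y xy; apply/propext; split=> -[i _ Fi]; exists i => //;
      [rewrite -(dF i _ _ xy)|rewrite (dF i _ _ xy)].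
move=> _ [z _ <-] x y xy; apply/propext.
by split=> h i iN; rewrite -(h i iN) xy.
Qed.

Lemma dep_measurable N (A : set (nat -> bool)) :
  dep N (A : (nat -> bool) -> Prop) -> measurable (A : set walsh_group).
Proof.
move=> /dep_sigma_algebra; apply: smallest_sub; first exact: smallest_sigma_algebra.
by move=> B [x _ <-]; exact: measurable_dyadic_interval.
Qed.

Lemma dep_measurable_fun N d (T : measurableType d) (f : (nat -> bool) -> T) :
  dep N f -> measurable_fun setT (f : walsh_group -> T).
Proof.
move=> df _ B mB; rewrite setTI; apply: (@dep_measurable N).
by move=> x y xy; rewrite /preimage /mkset (df _ _ xy).
Qed.

Lemma dep_sigma_measurable_fun N (f : (nat -> bool) -> R) :
  dep N f <-> measurable_fun setT (f : g_sigma_algebraType (dyadic_intervals N) -> R).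
Proof.
split=> [df _ B mB|mf x y xy].
  rewrite setTI; apply: dep_sigma_algebra.
  by move=> x y xy; rewrite /preimage /mkset (df _ _ xy).
have := mf measurableT [set f x] (measurable_set1 _).
rewrite setTI => /sigma_algebra_dep /(_ x y xy); rewrite /preimage /mkset /= => e.
by apply/esym; rewrite -e.
Qed.

Lemma dep_bounded N (f : (nat -> bool) -> R) : dep N f ->
  forall x, `|f x| <= 2 ^+ N * mean N (fun x => `|f x|).
Proof.
move=> df x; apply: (@le_mean_dep _ N (fun x => `|f x|)); first by move=> y.
exact: (dep_comp Num.norm).
Qed.

Lemma dep_integrable N (f : (nat -> bool) -> R) : dep N f ->
  haar.-integrable setT (EFin \o (f : walsh_group -> R)).
Proof.
move=> df; apply: measurable_bounded_integrable => //.
- by apply: (le_lt_trans (@probability_le1 _ _ _ haar setT measurableT)); rewrite ltry.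
- exact: dep_measurable_fun df.
- exists (2 ^+ N * mean N (fun x => `|f x|)); split; first exact: num_real.
  move=> M hM x _ /=; apply: le_trans (ltW hM); exact: dep_bounded.
Qed.

Definition unitc n : nat -> bool := fun i => i == n.

Lemma integral_flip n N (f : (nat -> bool) -> R) : dep N f ->
  (\int[haar]_x (f (walsh_add (unitc n) x))%:E = \int[haar]_x (f x)%:E)%E.
Proof.
move=> df.
have df' : dep N (fun x => f (walsh_add (unitc n) x)) by exact: dep_addc.
have mw : measurable_fun setT (walsh_add (unitc n)) by exact: measurable_funPT.
rewrite -(@integral_pushforward _ _ _ _ _ (walsh_add (unitc n)) mw haar setT (EFin \o f)) //.
- by apply: eq_measure_integral => A mA _; exact: haar_invariant.
- by apply/measurable_EFinP; exact: (dep_measurable_fun df).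
- exact: (dep_integrable df').
Qed.

Lemma walsh_add_unitc n x : walsh_add (unitc n) x = setc n (~~ x n) x.
Proof.
apply: funext => i; rewrite /walsh_add /setc /unitc.
by case: eqP => [->|]; rewrite ?addTb ?addFb.
Qed.

(** Flipping coordinate N preserves Haar measure, so f and its flip have the same integral, and half
    their sum is [avg N f]. *)
Lemma integral_mean N (f : (nat -> bool) -> R) : dep N f ->
  (\int[haar]_x (f x)%:E = (mean N f)%:E)%E.
Proof.
elim: N f => [|N IH] f df.
  rewrite (eq_integral (cst (f (fun=> false))%:E)); last first.
    by move=> x _; rewrite /= (df x (fun=> false)).
  rewrite integral_cst //; have h1 := @probability_setT _ _ _ haar.
  by rewrite -[RHS]mule1 -h1.
rewrite -[RHS](IH _ (dep_avg df)).
have df' : dep N.+1 (fun x => f (walsh_add (unitc N) x)) by exact: dep_addc.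
rewrite [RHS](eq_integral (fun x : walsh_group => (2^-1)%:E *
    ((f x)%:E + (f (walsh_add (unitc N) x))%:E))%E); last first.
  move=> x _; rewrite walsh_add_unitc -{2}(setc_id N x) -EFinD -EFinM mulrC /avg.
  by case: (x N) => //=; rewrite addrC.
rewrite integralZl //; last first.
  by apply: integrableD => //; [exact: (dep_integrable df)|exact: (dep_integrable df')].
rewrite integralD //; [|exact: (dep_integrable df)|exact: (dep_integrable df')].
rewrite (integral_flip _ df).
have : (\int[haar]_x (f x)%:E)%E \is a fin_num.
  by apply: integrable_fin_num => //; exact: (dep_integrable df).
by case: (\int[haar]_x (f x)%:E)%E => // r _; rewrite -EFinD -EFinM; congr EFin; field.
Qed.

Lemma Rintegral_mean N (f : (nat -> bool) -> R) : dep N f ->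
  \int[haar]_x f x = mean N f.
Proof. by move=> df; rewrite /Rintegral (integral_mean df). Qed.

Lemma haar_mean N (P : pred (nat -> bool)) : dep N P ->
  haar [set x | P x] = (mean N (fun x => (P x)%:R))%:E.
Proof.
move=> dP; rewrite -(@integral_mean N); last by exact: (dep_comp (fun b : bool => b%:R)).
rewrite -[LHS]mul1e -integral_cst; last first.
  by apply: (@dep_measurable N) => x y xy; rewrite /mkset (dP _ _ xy).
rewrite [LHS]integral_mkcond; apply: eq_integral => x _.
by rewrite patchE /=; case: ifPn; rewrite ?inE ?notin_setE /=; case: (P x).
Qed.

Lemma Rintegral_mean_set N (A : set (nat -> bool)) (f : (nat -> bool) -> R) :
  dep N (A : (nat -> bool) -> Prop) -> dep N f ->
  \int[haar]_(x in A) f x = mean N (fun x => \1_A x * f x).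
Proof.
move=> dA df; rewrite -Rintegral_mean.
  rewrite /Rintegral; congr fine; rewrite integral_mkcond; apply: eq_integral => x _.
  by rewrite patchE indicE; case: (x \in A); rewrite ?mul1r ?mul0r.
apply: dep_comp2 => // x y xy; rewrite !indicE.
by have e := dA _ _ xy; congr (nat_of_bool _)%:R; apply/idP/idP; rewrite !inE e.
Qed.

(** The averaging identity at x comes from testing the martingale property on the cylinder of rank n
    around x. The converse follows coordinate by coordinate, because the sets of F_m are not
    affected by the later coordinates. *)
Lemma dyadic_tree_martingale (f : nat -> walsh_group -> R) :
  dyadic_martingale f <-> tree_martingale f.
Proof.
split=> [[mf intf ef]|[df ef]].
  have df n : dep n (f n) by apply/dep_sigma_measurable_fun.
  split=> // n x.
  pose A := dyadic_interval n x.
  have dA : dep n (A : (nat -> bool) -> Prop).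
    by move=> y z yz; apply/propext; split=> h i ni; rewrite -h // yz.
  have := ef n n.+1 (leqnSn n) A (dep_sigma_algebra dA).
  rewrite (Rintegral_mean_set (depS (leqnSn n) dA) (df n.+1)) (Rintegral_mean_set dA (df n)).
  rewrite /= => h.
  have e (g : (nat -> bool) -> R) : dep n g -> mean n (fun y => \1_A y * g y) = g x * 2 ^- n.
    move=> dg; rewrite (eq_mean _ (g := fun y => g x * \1_A y)).
      have d1 : dep n (\1_A : _ -> R).
        by move=> y z yz; rewrite !indicE; congr (nat_of_bool _)%:R;
          apply/idP/idP; rewrite !inE (dA _ _ yz).
      rewrite meanZ; congr (_ * _); have := integral_mean d1.
      rewrite integral_indic ?setIT //; last exact: dep_measurable dA.
      by move=> h2; case: (etrans (esym h2) (@haar_dyadic_interval R n x)).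
    move=> y; rewrite mulrC indicE; case: (boolP (y \in A)); rewrite ?mulr0 //.
    by rewrite inE => Ay; congr (_ * _); apply: dg => i /Ay.
  apply: (@mulIf _ (2 ^- n)); first by rewrite invr_neq0 // expf_neq0.
  rewrite -(e _ (dep_avg (df n.+1))) -(e _ (df n)) -h.
  apply: eq_mean => y; rewrite /avg !indicE.
  have hA v : (setc n v y \in A) = (y \in A).
    by apply/idP/idP; rewrite !inE (dA (setc n v y) y) // => i ni; rewrite /setc ltn_eqF.
  by rewrite !hA; ring.
split.
- by move=> n; apply/dep_sigma_measurable_fun.
- by move=> n; exact: (dep_integrable (df n)).
- move=> m n mn A /sigma_algebra_dep dA.
  rewrite -(subnK mn); elim: (n - m)%N => [//|k IH].
  rewrite -IH addSn.
  have dA' : dep (k + m) (A : (nat -> bool) -> Prop) by exact: depS (leq_addl _ _) dA.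
  rewrite (Rintegral_mean_set (depS (leqnSn _) dA') (df _)) (Rintegral_mean_set dA' (df _)) /=.
  apply: eq_mean => x; rewrite -ef /avg !indicE.
  have hA v : (setc (k + m) v x \in A) = (x \in A).
    by apply/idP/idP; rewrite !inE (dA' (setc (k + m) v x) x) // => i ni; rewrite /setc ltn_eqF.
  by rewrite !hA; ring.
Qed.

End HaarMean.

(** * Nörlund means and maximal functions of a martingale at a finite level *)

Section NorlundMeans.
Context {R : realType}.
Implicit Types (f : nat -> walsh_group -> R) (x : walsh_group) (n m k i N : nat).

Local Notation haar := (@haar R).

Lemma tree_martingale_dep_test f N m (e : (nat -> bool) -> R) :
  tree_martingale f -> dep N e -> (N <= m)%N ->
  mean m (fun x => f m x * e x) = mean N (fun x => f N x * e x).
Proof.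
move=> [df ef] de Nm; rewrite -(subnK Nm); elim: (m - N)%N => [//|k IH].
rewrite -IH addSn /=; apply: eq_mean => x.
rewrite -ef /avg !(dep_setc _ _ de (leq_addl k N)); ring.
Qed.

Lemma kaczmarz_coefE f N i : tree_martingale f -> (i < 2 ^ N)%N ->
  kaczmarz_coef f i = mean N (fun y => f N y * kaczmarz i y).
Proof.
move=> mf iN; have dk := @dep_kaczmarz R i N iN.
rewrite /kaczmarz_coef; apply/cvg_lim => //.
apply: cvg_near_cst; exists N => // m /= Nm.
have dfk : dep m (fun y => f m y * kaczmarz i y).
  by apply: dep_comp2; [exact: mf.1|exact: depS dk].
by rewrite (Rintegral_mean dfk) (tree_martingale_dep_test mf dk Nm).
Qed.

(** The Kaczmarz functions are characters, so partial sums are convolutions with [kdirichlet]; the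
    orders involved are at most 2^N, where f_N already determines the coefficients. *)
Lemma norlund_mean_op (q : nat -> R) f N n x : tree_martingale f -> (n <= 2 ^ N)%N ->
  norlund_mean q n f x = norlund_op q N n (f N) x.
Proof.
move=> mf nN; rewrite /norlund_mean /norlund_op.
transitivity (mean N (fun y => (norlund_weight q n)^-1 *
    (f N y * norlund_kernel_sum q n (addc x y)))); last first.
  by apply: eq_mean => y; rewrite /norlund_kernel; ring.
rewrite meanZ; congr (_ * _).
rewrite big_add1 /= big_mkord /norlund_kernel_sum.
rewrite (eq_mean _ (g := fun y => \sum_(i < n) f N y * (q i * kdirichlet (n - i) (addc x y))));
  last by move=> y; rewrite mulr_sumr.
rewrite mean_sum (reindex_inj rev_ord_inj) /=; apply: eq_bigr => i _.
have e : (n - i.+1).+1 = (n - i)%N by rewrite -subSn.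
rewrite e subKn ?(ltnW (ltn_ord i)) //.
transitivity (mean N (fun y => q i * (f N y * kdirichlet (n - i) (addc x y)))); last first.
  by apply: eq_mean => y; ring.
rewrite meanZ; congr (_ * _); rewrite /kaczmarz_partial_sum big_mkord /kdirichlet.
rewrite (eq_mean _ (g := fun y => \sum_(j < n - i) kaczmarz j x * (f N y * kaczmarz j y)));
  last by move=> y; rewrite mulr_sumr; apply: eq_bigr => j _; rewrite kaczmarz_addc; ring.
rewrite mean_sum; apply: eq_bigr => j _; rewrite meanZ mulrC; congr (_ * _).
apply: kaczmarz_coefE => //; apply: leq_trans (ltn_ord j) _.
exact: leq_trans (leq_subr _ _) nN.
Qed.

Lemma dep_norlund_op q N n (g : (nat -> bool) -> R) : (n <= 2 ^ N)%N ->
  dep N (norlund_op q N n g).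
Proof.
move=> nN x y xy; apply: eq_mean => z; congr (_ * _).
apply: (dep_norlund_kernel q nN) => i iN; by rewrite /addc xy.
Qed.

Lemma dep_norlund_opmax q N (g : (nat -> bool) -> R) : dep N (norlund_opmax q N g).
Proof.
move=> x y xy; apply: eq_bigr => n _; congr (`|_|).
by apply: dep_norlund_op xy; exact: ltn_ord.
Qed.

Lemma dep_fmax f N : tree_martingale f -> dep N (fmax f N).
Proof.
move=> mf x y xy; apply: eq_bigr => n _; congr (`|_|).
by apply: (mf.1 n) => i ni; apply: xy; apply: leq_trans ni _; rewrite -ltnS.
Qed.

Lemma fmax_le_martingale_max f N x : ((fmax f N x)%:E <= martingale_max f x)%E.
Proof.
have h n : (`|f n x|%:E <= martingale_max f x)%E.
  by apply: ereal_sup_ubound; exists n.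
case E : (martingale_max f x) => [r| |]; rewrite ?leey //.
- rewrite lee_fin; apply: bigmax_le => [|n _].
    by have := h 0%N; rewrite E lee_fin; apply: le_trans.
  by have := h n; rewrite E lee_fin.
- by have := h 0%N; rewrite E.
Qed.

Lemma measurable_martingale_max f : tree_martingale f ->
  measurable_fun setT (martingale_max f).
Proof.
move=> mf; have -> : martingale_max f = fun x => esups (fun n => `|f n x|%:E) 0%N.
  apply: funext => x; rewrite /esups /sdrop /martingale_max; congr ereal_sup.
  by apply/seteqP; split=> _ [n _ <-]; exists n.
apply: measurable_fun_esups => n; apply/measurable_EFinP.
apply: measurableT_comp => //; exact: (dep_measurable_fun (mf.1 n)).
Qed.

Definition hardy_integral (p : R) f : \bar R :=
  (\int[haar]_x (`|martingale_max f x| `^ p))%E.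

Lemma mean_fmax_le p f N : 0 < p -> tree_martingale f ->
  ((mean N (fun x => (fmax f N x `^ p)%R))%:E <= hardy_integral p f)%E.
Proof.
move=> p0 mf; rewrite -(@integral_mean R N); last first.
  by apply: (dep_comp (fun t => (t `^ p)%R)); exact: dep_fmax.
have f0 x : 0 <= fmax f N x by exact: bigmax_ge_id.
have m0 x : (0 <= martingale_max f x)%E.
  by apply: le_trans (fmax_le_martingale_max f N x); rewrite lee_fin.
rewrite /hardy_integral; apply: ge0_le_integral => //.
- by move=> x _; rewrite lee_fin powR_ge0.
- apply/measurable_EFinP; apply: (@dep_measurable_fun N).
  by apply: (dep_comp (fun t => (t `^ p)%R)); exact: dep_fmax.
- apply: (measurableT_comp (measurable_poweR _)); apply: measurableT_comp => //.
  exact: measurable_martingale_max.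
- move=> x _; rewrite gee0_abs // -poweR_EFin.
  by apply: gt0_ler_poweR; rewrite ?(ltW p0) ?in_itv /= ?leey ?andbT ?lee_fin //
    fmax_le_martingale_max.
Qed.

End NorlundMeans.

(** * From finite levels to the maximal operator *)

Section PartA.
Context {R : realType}.
Variables (q : nat -> R) (beta K p : R).
Hypothesis q_ge0 : forall k, 0 <= q k.
Hypothesis q_noninc : nonincreasing_seq q.
Hypothesis q0_gt0 : 0 < q 0%N.
Hypothesis beta_gt1 : 1 < beta.
Hypothesis beta_lt2 : beta < 2.
Hypothesis K_ge0 : 0 <= K.
Hypothesis weightK : forall l A, (l <= A)%N ->
  norlund_weight q (2 ^ l) <= K * norlund_weight q (2 ^ A) / beta ^+ A * beta ^+ l.
Hypothesis p_gt0 : 0 < p.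
Hypothesis p_le1 : p <= 1.
Hypothesis powp : (2 * beta) `^ p = 2.

Local Notation haar := (@haar R).

Lemma mean_norlund_opmax_gt : exists2 C : R, 0 <= C &
  forall N (f : nat -> (nat -> bool) -> R) (l : R), 0 < l -> tree_martingale f ->
  l `^ p * mean N (fun x => (l < norlund_opmax q N (f N) x)%R%:R) <=
  C * mean N (fun x => fmax f N x `^ p).
Proof.
have [C C0 hC] := mean_norlund_opmax_weak q_ge0 q_noninc q0_gt0 beta_gt1 beta_lt2 K_ge0
  weightK p_gt0 p_le1 powp.
exists C => // N f l l0 mf.
pose g n x := l^-1 * f n x.
have mg : tree_martingale g.
  split=> [n x y xy|n x]; first by rewrite /g (mf.1 n _ _ xy).
  by rewrite /g -mf.2 /avg; ring.
have fg n x : f n x = l * g n x by rewrite /g mulrA mulfV ?mul1r // gt_eqF.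
have lp0 : 0 < l `^ p by rewrite powR_gt0.
rewrite -ler_pdivlMl //; apply: le_trans (_ : C * mean N (fun x => fmax g N x `^ p) <= _).
  apply: le_trans (hC N g mg); apply: le_mean => x.
  case: (boolP (l < norlund_opmax q N (f N) x)) => h; last by rewrite ler0n.
  suff -> : 1 < norlund_opmax q N (g N) x by [].
  have : norlund_opmax q N (f N) x <= l * norlund_opmax q N (g N) x.
    apply: norlund_opmax_le; first by rewrite mulr_ge0 ?norlund_opmax_ge0 // ltW.
    move=> n nN; have -> : norlund_op q N n (f N) x = l * norlund_op q N n (g N) x.
      by rewrite /norlund_op -meanZ; apply: eq_mean => y; rewrite fg; ring.
    rewrite normrM (gtr0_norm l0) ler_pM2l //; exact: le_norlund_opmax.
  by move/(lt_le_trans h); rewrite -ltr_pdivrMl // mulVf // gt_eqF.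
rewrite mulrCA ler_wpM2l // -meanZ; apply: le_mean => x.
rewrite ler_pdivlMl // -(powRM _ (ltW l0) (bigmax_ge_id _ _ _ _)).
rewrite ge0_ler_powR ?nnegrE ?(ltW p_gt0) //.
- by rewrite mulr_ge0 ?(ltW l0) //; exact: bigmax_ge_id.
- exact: bigmax_ge_id.
- rewrite -ler_pdivlMl //; apply: bigmax_le.
    by rewrite mulr_ge0 ?invr_ge0 ?(ltW l0) //; exact: bigmax_ge_id.
  move=> n _; rewrite /g normrM gtr0_norm ?invr_gt0 // ler_pM2l ?invr_gt0 //.
  by apply: le_fmax; rewrite -ltnS.
Qed.

Theorem norlund_max_bounded : bounded_hardy_weak p (norlund_max q).
Proof.
have [C C0 hC] := mean_norlund_opmax_gt.
exists (C `^ p^-1) => f [/dyadic_tree_martingale mf _].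
rewrite /weak_norm /hardy_norm unlock -/(hardy_integral p f).
have I0 : (0 <= hardy_integral p f)%E by apply: integral_ge0 => x _; exact: poweR_ge0.
rewrite -poweR_EFin -poweRM ?lee_fin //.
pose E (l : R) N : set walsh_group := [set x | l < norlund_opmax q N (f N) x].
have lt_pow n : (n < 2 ^ n)%N by exact: ltn_expl.
(* The full maximal operator is the increasing limit of the maxima over n <= 2^N, so the bound,
   being uniform in N, passes to the limit by continuity from below. *)
have EU l : 0 < l -> [set x | (l%:E < `|norlund_max q f x|)%E] = \bigcup_N E l N.
  move=> l0.
  have m0 x : (0 <= norlund_max q f x)%E.
    apply: (@le_trans _ _ `|norlund_mean q 1 f x|%:E); first by rewrite lee_fin.
    by apply: ereal_sup_ubound; exists 1%N.
  apply/seteqP; split => [x /=|x [N _] /=].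
    rewrite gee0_abs // => /ereal_sup_gt [_ [n n1 <-]]; rewrite lte_fin => ln.
    exists n => //; apply: (lt_le_trans ln).
    rewrite (norlund_mean_op q x mf (ltnW (lt_pow n))).
    by apply: le_norlund_opmax; rewrite n1 ltnW.
  rewrite gee0_abs // /E /= => h.
  case: (pselect (exists2 n, (0 < n <= 2 ^ N)%N & l < `|norlund_op q N n (f N) x|)).
    move=> [n /andP[n0 nN] hn]; apply: (@lt_le_trans _ _ `|norlund_mean q n f x|%:E).
      by rewrite lte_fin (norlund_mean_op q x mf nN).
    by apply: ereal_sup_ubound; exists n.
  move=> hn; exfalso; move: h; apply/negP; rewrite -leNgt; apply: norlund_opmax_le; first exact: ltW.
  by move=> n nN; rewrite leNgt; apply/negP => h; apply: hn; exists n.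
have dE l N : dep N (fun x => l < norlund_opmax q N (f N) x).
  by apply: (dep_comp (fun t => l < t)); exact: dep_norlund_opmax.
have mE l N : measurable (E l N).
  by apply: (@dep_measurable N) => x y xy; rewrite /E /mkset (dE l N _ _ xy).
have ndE l : nondecreasing_seq (E l).
  move=> N M NM; rewrite subsetEset => x; rewrite /E /= => h; apply: (lt_le_trans h).
  apply: norlund_opmax_le; first exact: norlund_opmax_ge0.
  move=> n /andP[n0 nN]; rewrite -(norlund_mean_op q x mf nN).
  have nM : (n <= 2 ^ M)%N by apply: leq_trans nN _; rewrite leq_exp2l.
  by rewrite (norlund_mean_op q x mf nM); apply: le_norlund_opmax; rewrite n0.
have main l : 0 < l ->
    ((l `^ p)%:E * haar [set x | (l%:E < `|norlund_max q f x|)%E] <= C%:E * hardy_integral p f)%E.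
  move=> l0; rewrite (EU l l0).
  have lp0 : 0 < l `^ p by rewrite powR_gt0.
  have cv := @nondecreasing_cvg_mu _ _ _ haar (E l) (mE l) (bigcupT_measurable _ (mE l)) (ndE l).
  have hN N : ((l `^ p)%:E * haar (E l N) <= C%:E * hardy_integral p f)%E.
    rewrite /E (@haar_mean _ N) ?dE // -EFinM.
    apply: (@le_trans _ _ (C * mean N (fun x => (fmax f N x `^ p)))%:E).
      by rewrite lee_fin; exact: hC.
    rewrite EFinM lee_pmul // ?lee_fin // ?mean_fmax_le // mean_ge0 // => x.
    exact: powR_ge0.
  rewrite -lee_pdivlMl // -(cvg_lim _ cv) //; apply: lime_le; first by apply/cvg_ex; eexists; exact: cv.
  by apply: nearW => N; have := hN N; rewrite -lee_pdivlMl.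
apply: gt0_ler_poweR; rewrite ?invr_ge0 ?(ltW p_gt0) ?in_itv /= ?leey ?andbT //.
- apply: (@le_trans _ _ ((1 `^ p)%:E * haar [set x | (1%:E < `|norlund_max q f x|)%E])%E).
    by rewrite mule_ge0 // lee_fin powR_ge0.
  by apply: ereal_sup_ubound; exists 1%R => //=; exact: ltr01.
- by rewrite mule_ge0 // lee_fin.
- by apply: ge_ereal_sup => _ [l l0 <-]; exact: main.
Qed.

End PartA.

(** * Divergence *)

Section Divergence.
Context {R : realType}.
Variable q : nat -> R.
Hypothesis q_ge0 : forall k, 0 <= q k.
Hypothesis q_noninc : nonincreasing_seq q.
Hypothesis q0_gt0 : 0 < q 0%N.

Local Notation haar := (@haar R).

Section LacunarySeries.
Variable c : nat -> R.
Hypothesis c_ge0 : forall m, 0 <= c m.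

(** The m-th summand is c_m (D_(2^(m+1)) - D_(2^m)), since that difference equals 2^m r_m on the
    cylinder of rank m at 0 and vanishes elsewhere. *)
Definition atom_series n (x : walsh_group) : R :=
  \sum_(m < n) c m * 2 ^+ m * rademacher m x * cyl m x.

Lemma dep_cyl n : dep n (@cyl R n).
Proof. by move=> x y xy; apply: eq_bigr => i _; rewrite xy. Qed.

Lemma dep_rademacher n : dep n.+1 (@rademacher R n).
Proof. by move=> x y xy; rewrite /rademacher xy. Qed.

Lemma rademacher_setc n v x : @rademacher R n (setc n v x) = (-1) ^+ v.
Proof. by rewrite /rademacher /setc eqxx. Qed.

Lemma dep_atom_series n : dep n (atom_series n).
Proof.
move=> x y xy; apply: eq_bigr => m _.
have xy' i : (i < m.+1)%N -> x i = y i by move=> im; apply: xy; exact: leq_trans im _.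
by rewrite (dep_rademacher xy') (@dep_cyl m x y) // => i im; apply: xy'; exact: ltnW.
Qed.

Lemma atom_series_tree : tree_martingale atom_series.
Proof.
split; first exact: dep_atom_series.
move=> n x; rewrite /avg /atom_series !big_ord_recr /= -!/(atom_series n _).
rewrite !(dep_setc _ _ (@dep_atom_series n) (leqnn n)) !rademacher_setc.
by rewrite !(dep_setc _ _ (@dep_cyl n) (leqnn n)) expr0 expr1; field.
Qed.

Lemma mean_cyl n : mean n (@cyl R n) = 2 ^- n.
Proof.
elim: n => [|n IH] /=; first by rewrite /cyl big_ord0 expr0 invr1.
rewrite exprS invfM -IH -meanZ; apply: eq_mean => x.
by rewrite /avg !cylS !(dep_setc _ _ (@dep_cyl n) (leqnn n)) /setc eqxx /=; field.
Qed.

Lemma walsh_cyl j n x : (j < 2 ^ n)%N -> walsh j x * cyl n x = cyl n x :> R.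
Proof.
move=> jn; have [e|->] := @cyl_bool R n x; last by rewrite mulr0.
rewrite e mulr1 (walshE x jn) big1 // => i _.
suff : ~~ x i by rewrite /rademacher => /negbTE ->; rewrite expr0 expr1n.
apply/negP => xi; have /eqP := e; rewrite /cyl (bigD1 i) //= xi mul0r eq_sym oner_eq0 //.
Qed.

(** Averaging over coordinate s removes the earlier summands, which meet an isolated r_s, and the
    remaining Walsh factor is 1 on the cylinder where the s-th summand lives. *)
Lemma atom_series_coef s j : (j < 2 ^ s)%N ->
  kaczmarz_coef atom_series (2 ^ s + j) = c s.
Proof.
move=> js; have lt : (2 ^ s + j < 2 ^ s.+1)%N by rewrite expnS mul2n -addnn ltn_add2l.
rewrite (kaczmarz_coefE atom_series_tree lt) /=.
transitivity (mean s (fun x => c s * 2 ^+ s * cyl s x)); last first.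
  by rewrite meanZ mean_cyl mulfK // expf_neq0.
have dw : dep s (fun x => walsh j (revc s x) : R).
  move=> x y xy; rewrite !(walshE _ js); apply: eq_bigr => k _.
  by rewrite /rademacher /revc xy //; have := ltn_ord k; lia.
apply: eq_mean => x; rewrite /avg !kaczmarz_top // !rademacher_setc /atom_series.
rewrite !big_ord_recr /= -!/(atom_series s _) !rademacher_setc.
rewrite !(dep_setc _ _ (@dep_atom_series s) (leqnn s)).
rewrite !(dep_setc _ _ (@dep_cyl s) (leqnn s)) !(dep_setc _ _ dw (leqnn s)).
have := walsh_cyl (revc s x) js; rewrite cyl_revc => h; rewrite -[in RHS]h expr0 expr1.
by field.
Qed.

Lemma atom_series_coef0 : kaczmarz_coef atom_series 0 = 0.
Proof.
by rewrite (@kaczmarz_coefE R _ 0 0 atom_series_tree) //= /atom_series big_ord0 mul0r.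
Qed.

Lemma sum_atom_series_coef M :
  \sum_(i < 2 ^ M) `|kaczmarz_coef atom_series i| = \sum_(m < M) c m * 2 ^+ m.
Proof.
elim: M => [|M IH]; first by rewrite big_ord1 atom_series_coef0 normr0 big_ord0.
rewrite expnS mul2n -addnn big_split_ord /= IH big_ord_recr /=; congr (_ + _).
rewrite (eq_bigr (fun=> c M)); last first.
  by move=> j _; rewrite atom_series_coef // ger0_norm.
by rewrite big_const_ord iter_addr addr0 -natrX mulr_natr.
Qed.

(** The index 2^M occurs only in the last partial sum, which has weight q_0 / Q and contributes a
    function of constant modulus. All the rest is an average of sums over lower blocks, bounded by
    the total mass of their coefficients. *)
Lemma norlund_mean_atom_series M x :
  q 0%N * c M / norlund_weight q (2 ^ M).+1 - \sum_(m < M) c m * 2 ^+ m <=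
  `|norlund_mean q (2 ^ M).+1 atom_series x|.
Proof.
set n := (2 ^ M).+1; set B := \sum_(m < M) _.
have Q0 : 0 < norlund_weight q n by apply: norlund_weight_gt0.
have B0 : 0 <= B by apply: sumr_ge0 => m _; rewrite mulr_ge0 ?exprn_ge0.
have SB k : (k <= 2 ^ M)%N -> `|kaczmarz_partial_sum k atom_series x| <= B.
  move=> kM; rewrite /kaczmarz_partial_sum big_mkord /B -sum_atom_series_coef.
  apply: le_trans (ler_norm_sum _ _ _) _.
  rewrite -[X in _ <= X](big_mkord xpredT (fun i => `|kaczmarz_coef atom_series i|)).
  rewrite -(subnKC kM) (big_cat_nat (n := k)) ?leq_addr //= big_mkord.
  apply: ler_wpDr; first exact: sumr_ge0.
  by apply: ler_sum => i _; rewrite normrM norm_kaczmarz mulr1.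
have Sn : kaczmarz_partial_sum n atom_series x =
    kaczmarz_partial_sum (2 ^ M) atom_series x + c M * kaczmarz (2 ^ M) x.
  rewrite /kaczmarz_partial_sum big_nat_recr //=.
  by have := @atom_series_coef M 0 (expn_gt0 2 M); rewrite addn0 => ->.
rewrite /norlund_mean normrM ger0_norm ?invr_ge0 ?(ltW Q0) //.
rewrite [leRHS]mulrC ler_pdivlMr // mulrBl divfK ?gt_eqF //.
rewrite big_nat_recr //= subnn Sn mulrDr.
set A := \sum_(1 <= _ < _) _.
have hA : `|A + q 0%N * kaczmarz_partial_sum (2 ^ M) atom_series x| <= B * norlund_weight q n.
  apply: le_trans (ler_normD _ _) _.
  rewrite norlund_weightE /n big_ord_recl mulrDr addrC; apply: lerD.
    by rewrite normrM ger0_norm // mulrC ler_wpM2r // SB.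
  rewrite /A big_add1 /= big_mkord; apply: le_trans (ler_norm_sum _ _ _) _.
  rewrite mulr_sumr (reindex_inj rev_ord_inj) /=; apply: ler_sum => i _.
  rewrite normrM ger0_norm // /n mulrC; apply: ler_pM => //.
    by apply: SB; have := ltn_ord i; lia.
  by rewrite le_eqVlt; apply/orP; left; apply/eqP; congr q; have := ltn_ord i; rewrite /bump; lia.
have hK : `|q 0%N * (c M * kaczmarz (2 ^ M) x)| = q 0%N * c M.
  by rewrite !normrM norm_kaczmarz mulr1 !ger0_norm.
rewrite addrA; set X := A + _ in hA *; set Y := q 0%N * _ in hK *.
have := ler_normD (X + Y) (- X); rewrite addrAC subrr add0r normrN hK; lra.
Qed.

End LacunarySeries.
End Divergence.

Lemma half_pow_sub (R : realType) k : 1 - 2 ^- k + 2 ^- k.+1 = 1 - 2 ^- k.+1 :> R.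
Proof.
have -> : 2 ^- k = 2 * 2 ^- k.+1 :> R by rewrite exprS invfM mulVKf.
ring.
Qed.

(** * A single martingale with unbounded means, built hump by hump *)

Section GlidingHump.
Context {R : realType}.
Variables (q : nat -> R) (p : R).
Hypothesis q_ge0 : forall k, 0 <= q k.
Hypothesis q_noninc : nonincreasing_seq q.
Hypothesis q0_gt0 : 0 < q 0%N.
Hypothesis p_gt0 : 0 < p.
Hypothesis p_lt1 : p < 1.

Local Notation haar := (@haar R).

Let rho : R := 2 `^ (p^-1 - 1).
Let v : R := 2 `^ (- p^-1).

Hypothesis unbounded : forall (C : R) m0, exists2 m, (m0 <= m)%N &
  C <= q 0%N * rho ^+ m / norlund_weight q (2 ^ m).+1.

Let rho_gt0 : 0 < rho. Proof. exact: powR_gt0. Qed.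
Let v_gt0 : 0 < v. Proof. exact: powR_gt0. Qed.

(** Normalized so that hump k, wherever it is placed, has p-th power Hardy cost 2^-(k+1); see
    [hump_height_pow]. *)
Definition hump_height k M : R := v ^+ k.+1 * rho ^+ M.

(* [s] records the number of humps placed so far and their total size; a new
   hump is placed as soon as it dominates that size. *)
Definition hump_wins M (s : nat * R) : bool :=
  s.1.+1%:R + s.2 <= q 0%N * hump_height s.1 M / norlund_weight q (2 ^ M).+1.

Fixpoint hump_state M : nat * R :=
  if M is M'.+1 then
    let s := hump_state M' in
    if hump_wins M' s then (s.1.+1, s.2 + hump_height s.1 M' * 2 ^+ M') else s
  else (0%N, 0).

Definition hump_coef M : R :=
  if hump_wins M (hump_state M) then hump_height (hump_state M).1 M else 0.

Lemma hump_height_gt0 k M : 0 < hump_height k M.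
Proof. by rewrite mulr_gt0 // exprn_gt0. Qed.

Lemma hump_coef_ge0 M : 0 <= hump_coef M.
Proof. by rewrite /hump_coef; case: ifP => // _; rewrite ltW // hump_height_gt0. Qed.

Lemma hump_state_sum M : (hump_state M).2 = \sum_(m < M) hump_coef m * 2 ^+ m.
Proof.
elim: M => [|M IH]; first by rewrite big_ord0.
rewrite big_ord_recr /= -IH /hump_coef.
by case: ifP => //= _; rewrite mul0r addr0.
Qed.

(** While no hump is placed the state is frozen, so the size to be beaten is fixed, and [unbounded]
    provides a later position that beats it. *)
Lemma hump_wins_after M0 : exists2 M, hump_state M = hump_state M0 &
  hump_wins M (hump_state M).
Proof.
set s := hump_state M0.
have [m mM0 hm] := unbounded ((s.1.+1%:R + s.2) / v ^+ s.1.+1) M0.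
have win : hump_wins m s.
  have aux (a b c d : R) : a * b / c * d = a * (d * b) / c by ring.
  by move: hm; rewrite ler_pdivrMr ?exprn_gt0 // aux.
have claim d : (exists2 M, hump_state M = s & hump_wins M (hump_state M)) \/
    hump_state (M0 + d)%N = s.
  elim: d => [|d [IH|IH]]; [by right; rewrite addn0|by left|].
  case: (boolP (hump_wins (M0 + d) s)) => h.
    by left; exists (M0 + d)%N; rewrite ?IH.
  by right; rewrite addnS /= IH (negbTE h).
case: (claim (m - M0)%N) => // e; exists m; first by rewrite -e subnKC.
by rewrite -[m](subnKC mM0) e subnKC.
Qed.

Lemma hump_count k : exists2 M, (hump_state M).1 = k & hump_wins M (hump_state M).
Proof.
elim: k => [|k [M Mk hM]].
  by have [M e h] := hump_wins_after 0; exists M => //; rewrite e.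
have [M' e h] := hump_wins_after M.+1.
by exists M' => //; rewrite e /= hM Mk.
Qed.

Lemma powv : v `^ p = 2^-1.
Proof. by rewrite /v -powRrM mulNr mulVf ?gt_eqF // powR_inv1. Qed.

Lemma powrho : (rho * 2) `^ p = 2.
Proof.
have -> : rho * 2 = 2 `^ p^-1.
  have e : p^-1 - 1 + 1 = p^-1 :> R by ring.
  have c : (p^-1 - 1 + 1 == 0) ==> ((2 : R) != 0) by rewrite pnatr_eq0 implybT.
  have := powRD c; rewrite e powRr1 => [h|]; last exact: ler0n.
  exact: esym h.
by rewrite -powRrM mulVf ?gt_eqF // powRr1.
Qed.

Lemma hump_height_pow k M :
  (hump_height k M * 2 ^+ M) `^ p * 2 ^- M = 2 ^- k.+1.
Proof.
have e (t : R) n : 0 <= t -> (t ^+ n) `^ p = (t `^ p) ^+ n.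
  move=> t0; elim: n => [|n IH]; first by rewrite !expr0 powR1.
  by rewrite !exprS powRM ?exprn_ge0 // IH.
have v0 := ltW v_gt0; have r0 : 0 <= rho * 2 by rewrite mulr_ge0 // ltW.
have -> : hump_height k M * 2 ^+ M = v ^+ k.+1 * (rho * 2) ^+ M.
  by rewrite /hump_height -mulrA -exprMn.
rewrite (powRM _ (exprn_ge0 _ v0) (exprn_ge0 _ r0)) (e _ _ v0) (e _ _ r0) powv powrho.
by rewrite mulfK ?expf_neq0 // exprVn.
Qed.

Lemma sum_hump_coef_pow M :
  \sum_(m < M) (hump_coef m * 2 ^+ m) `^ p * 2 ^- m = 1 - 2 ^- (hump_state M).1.
Proof.
elim: M => [|M IH]; first by rewrite big_ord0 expr0 invr1 subrr.
rewrite big_ord_recr /= IH /hump_coef; case: ifP => _.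
  rewrite [X in _ + X = _](hump_height_pow (hump_state M).1 M).
  exact: half_pow_sub.
by rewrite mul0r powR0 ?gt_eqF // mul0r addr0.
Qed.

Let f := atom_series hump_coef.

Let mf : tree_martingale f. Proof. exact: atom_series_tree. Qed.

Lemma powR_sum_le (I : Type) (r : seq I) (F : I -> R) : (forall i, 0 <= F i) ->
  (\sum_(i <- r) F i) `^ p <= \sum_(i <- r) (F i) `^ p.
Proof.
have addp (a b : R) : 0 <= a -> 0 <= b -> (a + b) `^ p <= a `^ p + b `^ p.
  move=> a0 b0; have [->|ab] := eqVneq (a + b) 0.
    by rewrite powR0 ?gt_eqF // addr_ge0 ?powR_ge0.
  have s0 : 0 < a + b by rewrite lt_def ab addr_ge0.
  have h (c : R) : 0 <= c -> c <= a + b -> c / (a + b) * (a + b) `^ p <= c `^ p.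
    move=> c0 cs; rewrite -{2}[c](divfK ab) powRM ?divr_ge0 ?(ltW s0) //.
    rewrite ler_wpM2r ?powR_ge0 //.
    have [->|cn] := eqVneq c 0; first by rewrite mul0r powR_ge0.
    apply: ger1_powR; last exact: ltW.
    by rewrite divr_gt0 ?lt_def ?cn ?c0 ?ab ?(ltW s0) //= ler_pdivrMr // mul1r.
  have h1 := h a a0; have h2 := h b b0.
  have e : (a + b) `^ p = a / (a + b) * (a + b) `^ p + b / (a + b) * (a + b) `^ p.
    by rewrite -!mulrDl mulfV // mul1r.
  by rewrite e; apply: lerD; [apply: h1; rewrite lerDl|apply: h2; rewrite lerDr].
move=> F0; elim: r => [|i r IH]; first by rewrite !big_nil powR0 ?gt_eqF.
rewrite !big_cons; apply: le_trans (addp _ _ _ _) _ => //; first exact: sumr_ge0.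
by rewrite lerD2l.
Qed.

Lemma norm_atom_series_pow n x :
  `|f n x| `^ p <= \sum_(m < n) (hump_coef m * 2 ^+ m) `^ p * cyl m x.
Proof.
apply: le_trans (_ : (\sum_(m < n) hump_coef m * 2 ^+ m * cyl m x) `^ p <= _).
  have h m : 0 <= hump_coef m * 2 ^+ m * cyl m x.
    by rewrite !mulr_ge0 ?hump_coef_ge0 ?exprn_ge0 ?cyl_ge0.
  rewrite ge0_ler_powR ?nnegrE ?(ltW p_gt0) ?normr_ge0 ?sumr_ge0 //.
  apply: le_trans (ler_norm_sum _ _ _) _; apply: ler_sum => m _.
  rewrite !normrM norm_rademacher mulr1 !ger0_norm ?hump_coef_ge0 ?exprn_ge0 ?cyl_ge0 //.
apply: le_trans (powR_sum_le _ _) _.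
  by move=> m; rewrite !mulr_ge0 ?hump_coef_ge0 ?exprn_ge0 ?cyl_ge0.
apply: ler_sum => m _; case: (@cyl_bool R m x) => ->; rewrite ?mulr1 ?mulr0 //.
by rewrite powR0 ?gt_eqF.
Qed.

(** For p < 1 the power of a sum is at most the sum of the powers, which bounds every |f_n|^p by one
    series independent of n. Integrating it termwise gives the costs of the humps, at most 1 in
    total. *)
Lemma hump_hardy_integral_le1 : (hardy_integral p f <= 1)%E.
Proof.
pose g m (x : walsh_group) : \bar R := ((hump_coef m * 2 ^+ m) `^ p * cyl m x)%:E.
have g0 m x : (0 <= g m x)%E by rewrite lee_fin mulr_ge0 ?powR_ge0 ?cyl_ge0.
have dg m : dep m (fun x => (hump_coef m * 2 ^+ m) `^ p * cyl m x).
  by apply: (dep_comp (fun t => _ * t)); exact: dep_cyl.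
have mg m : measurable_fun setT (g m).
  by apply/measurable_EFinP; exact: (dep_measurable_fun (dg m)).
have S0 x : (0 <= \sum_(m <oo) g m x)%E by apply: nneseries_ge0.
apply: (@le_trans _ _ (\int[haar]_x (\sum_(m <oo) g m x))%E).
  apply: ge0_le_integral => //.
  - by move=> x _; exact: poweR_ge0.
  - apply: (measurableT_comp (measurable_poweR _)); apply: measurableT_comp => //.
    exact: measurable_martingale_max.
  - exact: ge0_emeasurable_sum.
  - move=> x _.
    have m0 : (0 <= martingale_max f x)%E.
      by apply: le_trans (fmax_le_martingale_max f 0 x); rewrite lee_fin; exact: bigmax_ge_id.
    rewrite gee0_abs //.
    have -> : (\sum_(m <oo) g m x = ((\sum_(m <oo) g m x) `^ p^-1) `^ p)%E.
      by rewrite -poweRrM mulVf ?gt_eqF // poweRe1.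
    apply: gt0_ler_poweR; rewrite ?(ltW p_gt0) ?in_itv /= ?leey ?andbT ?poweR_ge0 //.
    apply: ge_ereal_sup => _ [n _ <-].
    have -> : (`|f n x|%:E = ((`|f n x| `^ p)%:E `^ p^-1))%E.
      by rewrite poweR_EFin -powRrM mulfV ?gt_eqF // powRr1.
    apply: gt0_ler_poweR; rewrite ?invr_ge0 ?(ltW p_gt0) ?in_itv /= ?leey ?andbT ?lee_fin ?powR_ge0 //.
    apply: le_trans (nneseries_lim_ge n _); last by move=> *; exact: g0.
    by rewrite big_mkord sumEFin lee_fin; exact: norm_atom_series_pow.
rewrite integral_nneseries //.
apply: lime_le; first by apply: is_cvg_nneseries => *; exact: integral_ge0.
apply: nearW => M; rewrite big_mkord.
rewrite (eq_bigr (fun m : 'I_M => ((hump_coef m * 2 ^+ m) `^ p * 2 ^- m)%:E)); last first.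
  by move=> m _; rewrite (integral_mean (dg m)) meanZ mean_cyl.
by rewrite sumEFin sum_hump_coef_pow lee_fin gerBl invr_ge0 exprn_ge0.
Qed.

Lemma hump_hardy_integral_gt0 : (0 < hardy_integral p f)%E.
Proof.
have [M _ hM] := hump_count 0.
apply: lt_le_trans (mean_fmax_le M.+1 p_gt0 mf); rewrite lte_fin.
(* At the zero point all summands are nonnegative, so the first hump cannot be cancelled. *)
pose z : nat -> bool := fun=> false.
have cz m : cyl m z = 1 :> R by rewrite /cyl big1.
have fz : 0 < f M.+1 z.
  have rz m : rademacher m z = 1 :> R by rewrite /rademacher expr0.
  have -> : f M.+1 z = atom_series hump_coef M z + hump_coef M * 2 ^+ M * rademacher M z * cyl M z.
    by rewrite {1}/f {1}/atom_series big_ord_recr.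
  rewrite cz rz !mulr1; apply: ltr_wpDl.
    apply: sumr_ge0 => m _; rewrite cz rz !mulr1 mulr_ge0 ?exprn_ge0 //.
    exact: hump_coef_ge0.
  by rewrite mulr_gt0 ?exprn_gt0 // /hump_coef hM hump_height_gt0.
have h := @le_mean_dep R M.+1 (fun x => fmax f M.+1 x `^ p) z.
rewrite -(@pmulr_rgt0 _ (2 ^+ M.+1)) ?exprn_gt0 //; apply: lt_le_trans (h _ _).
- rewrite powR_gt0 //; apply: lt_le_trans (le_fmax f z (leqnn M.+1)).
  by rewrite normr_gt0 gt_eqF.
- by move=> y; exact: powR_ge0.
- by apply: (dep_comp (fun t => t `^ p)); exact: dep_fmax.
Qed.

Theorem norlund_mean_unbounded : exists g : nat -> walsh_group -> R,
  [/\ hardy p g, (0 < hardy_norm p g)%E &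
    ereal_sup [set (weak_norm p (EFin \o norlund_mean q n g) / hardy_norm p g)%E
              | n in [set n | (1 <= n)%N]] = +oo%E].
Proof.
have hn : hardy_norm p f = (hardy_integral p f `^ p^-1)%E by rewrite /hardy_norm unlock.
have n0 : (0 < hardy_norm p f)%E by rewrite hn; exact: poweR_gt0 hump_hardy_integral_gt0.
have n1 : (hardy_norm p f < +oo)%E.
  by rewrite hn; apply: poweR_lty; apply: le_lt_trans hump_hardy_integral_le1 _; rewrite ltry.
exists f; split => //; first by split => //; exact/dyadic_tree_martingale.
have [r r0 er] : exists2 r : R, 0 < r & hardy_norm p f = r%:E.
  by move: n0 n1; case: hardy_norm => // r; rewrite lte_fin => r0 _; exists r.
rewrite er; apply: eq_infty => A.
have [k kA k0] : exists2 k : nat, A * r <= k%:R & (0 < k)%N.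
  exists (Num.bound `|A * r|).+1 => //; apply: le_trans (ler_norm _) _.
  by apply: le_trans (ltW (archi_boundP (normr_ge0 _))) _; rewrite ler_nat.
have [M Mk hM] := hump_count k.
apply: (@le_trans _ _ (weak_norm p (EFin \o norlund_mean q (2 ^ M).+1 f) / r%:E)%E); last first.
  by apply: ereal_sup_ubound; exists (2 ^ M).+1.
(* [hump_wins] asks for k + 1 beyond the mass of the earlier humps, so the strict inequality holds
   at every point and the level set is the whole group. *)
have big x : k%:R < `|norlund_mean q (2 ^ M).+1 f x|.
  apply: lt_le_trans (norlund_mean_atom_series q_ge0 q0_gt0 hump_coef_ge0 M x).
  rewrite -hump_state_sum /hump_coef hM ltrBrDr.
  by apply: lt_le_trans hM; rewrite ltrD2r Mk ltr_nat.
have kp : 0 < k%:R :> R by rewrite ltr0n.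
have hT : [set x | (k%:R%:E < `|(EFin \o norlund_mean q (2 ^ M).+1 f) x|)%E] = setT.
  by apply/seteqP; split => // x _ /=; rewrite lte_fin.
have weak : (k%:R%:E <= weak_norm p (EFin \o norlund_mean q (2 ^ M).+1 f))%E.
  have -> : (k%:R%:E = ((k%:R `^ p)%:E `^ p^-1) :> \bar R)%E.
    by rewrite poweR_EFin -powRrM mulfV ?gt_eqF // powRr1.
  have h : ((k%:R `^ p)%:E <= ereal_sup [set (l `^ p)%:E *
      haar [set x | l%:E < `|(EFin \o norlund_mean q (2 ^ M).+1 f) x|]
      | l in [set l : R | (0 < l)%R]])%E.
    apply: ereal_sup_ubound; exists k%:R => //=; rewrite hT.
    by rewrite -[RHS]mule1; congr (_ * _)%E; exact: (@probability_setT _ _ _ haar).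
  apply: gt0_ler_poweR => //; rewrite ?invr_ge0 ?(ltW p_gt0) // in_itv /= leey andbT.
    by rewrite lee_fin powR_ge0.
  by apply: le_trans h; rewrite lee_fin powR_ge0.
have -> : ((r%:E)^-1 = (r^-1)%:E)%E by rewrite inver gt_eqF.
apply: (@le_trans _ _ (k%:R%:E * (r^-1)%:E)%E).
  by rewrite -EFinM lee_fin ler_pdivlMr.
by apply: lee_wpmul2r => //; rewrite lee_fin invr_ge0 ltW.
Qed.

End GlidingHump.

(** * Unbounded hump ratios from the hypotheses of parts (b) and (c) *)

Section Exponents.
Context {R : realType}.
Variables (q : nat -> R).
Hypothesis q_ge0 : forall k, 0 <= q k.
Hypothesis q_noninc : nonincreasing_seq q.
Hypothesis q0_gt0 : 0 < q 0%N.

Lemma powR_two_mul (alpha : R) : 0 < alpha ->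
  (2 * 2 `^ alpha) `^ (1 / (1 + alpha)) = 2.
Proof.
move=> a0; have a1 : 1 + alpha != 0 by rewrite gt_eqF // addr_gt0.
have h : 2 * 2 `^ alpha = 2 `^ (1 + alpha) :> R.
  have c : (1 + alpha == 0) ==> ((2 : R) != 0) by rewrite pnatr_eq0 implybT.
  by rewrite (powRD c) powRr1.
by rewrite h -powRrM mulrCA mulfV // mulr1 powRr1.
Qed.

Lemma geometric_unbounded (r : R) : 1 < r ->
  forall (C : R) m0, exists2 m, (m0 <= m)%N & C <= r ^+ m.
Proof.
move=> r1 C m0; have d0 : 0 < r - 1 by rewrite subr_gt0.
have bern m : m%:R * (r - 1) <= r ^+ m.
  elim: m => [|m IH]; first by rewrite mul0r expr0.
  have : 1 <= r ^+ m by rewrite exprn_ege1 // ltW.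
  by rewrite exprS -natr1; move: (r ^+ m) IH => t; nra.
pose n := Num.bound (`|C| / (r - 1)).
exists (m0 + n)%N; first exact: leq_addr.
apply: le_trans (bern _); apply: le_trans (ler_norm _) _.
rewrite -ler_pdivrMr //.
apply: le_trans (ltW (archi_boundP _)) _; first by rewrite divr_ge0 ?normr_ge0 // ltW.
by rewrite ler_nat leq_addl.
Qed.

(** The condition p < 1 / (1 + alpha) means 1/p - 1 > alpha, so the hump factor outgrows 2^(alpha m)
    geometrically. *)
Lemma hump_ratio_unbounded_of_lower_bound (alpha p c : R) :
  0 < p -> p < 1 / (1 + alpha) -> 0 < alpha -> 0 < c ->
  (\forall n \near \oo, c / n%:R `^ alpha <= q 0%N / norlund_weight q n) ->
  forall (C : R) m0, exists2 m, (m0 <= m)%N &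
    C <= q 0%N * (2 `^ (p^-1 - 1)) ^+ m / norlund_weight q (2 ^ m).+1.
Proof.
move=> p0 pa a0 c0 [n0 _ hn] C m0.
set rho := 2 `^ _; pose beta : R := 2 `^ alpha.
have b0 : 0 < beta by exact: powR_gt0.
have r0 : 0 < rho by exact: powR_gt0.
have r1 : 1 < rho / beta.
  rewrite ltr_pdivlMr // mul1r /rho /beta.
  have e : 0 < p^-1 - 1 - alpha.
    have : 1 + alpha < p^-1.
      by rewrite -[ltLHS]invrK ltf_pV2 ?posrE ?invr_gt0 ?addr_gt0 // -[_^-1]mul1r.
    by lra.
  have c' : (alpha + (p^-1 - 1 - alpha) == 0) ==> ((2 : R) != 0) by rewrite pnatr_eq0 implybT.
  have -> : p^-1 - 1 = alpha + (p^-1 - 1 - alpha) by ring.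
  by rewrite (powRD c') ltr_pMr ?powR_gt0 // powR2_gt1.
have [m hm hC] := geometric_unbounded r1 (C * beta / c) (maxn m0 n0).
exists m; first by apply: leq_trans hm; exact: leq_maxl.
have nm : (n0 <= (2 ^ m).+1)%N.
  apply: leq_trans (leq_trans (leq_maxr m0 n0) hm) _.
  by apply: leq_trans (ltnW (ltn_expl m (ltnSn 1))) _.
have := hn _ nm; rewrite /=; set n := (2 ^ m).+1 => h.
have npos : 0 < n%:R `^ alpha :> R by rewrite powR_gt0 // ltr0n.
have nle : n%:R `^ alpha <= beta * beta ^+ m.
  rewrite -exprS /beta -powR_pow2 ge0_ler_powR ?nnegrE ?exprn_ge0 ?(ltW a0) //.
  by rewrite -natrX ler_nat ltn_exp2l.
apply: le_trans (_ : rho ^+ m * (c / n%:R `^ alpha) <= _); last first.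
  by rewrite -mulrA [q 0%N * _]mulrC -mulrA ler_wpM2l ?exprn_ge0 ?(ltW r0) // mulrC.
apply: le_trans (_ : rho ^+ m * (c / (beta * beta ^+ m)) <= _); last first.
  rewrite ler_wpM2l ?exprn_ge0 ?(ltW r0) // ler_pM2l // lef_pV2 ?posrE //.
  by rewrite mulr_gt0 // exprn_gt0.
move: hC; rewrite expr_div_n ler_pdivrMr // => hC.
have -> : rho ^+ m * (c / (beta * beta ^+ m)) = rho ^+ m / beta ^+ m * c / beta.
  by rewrite invfM; ring.
by rewrite ler_pdivlMr.
Qed.

(** For 2^m < n <= 2^(m+1), monotonicity of the weights makes the ratio at n at most 2^alpha times
    the hump ratio at m. A bound along the dyadic orders would therefore bound the upper limit. *)
Lemma hump_ratio_unbounded_of_limsup (alpha : R) : 0 < alpha ->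
  limn_esup (fun n : nat => (q 0%N * n%:R `^ alpha / norlund_weight q n)%:E) = +oo%E ->
  forall (C : R) m0, exists2 m, (m0 <= m)%N &
    C <= q 0%N * (2 `^ alpha) ^+ m / norlund_weight q (2 ^ m).+1.
Proof.
move=> a0 hsup C m0; apply: contrapT => hno.
have lt m : (m0 <= m)%N -> q 0%N * (2 `^ alpha) ^+ m / norlund_weight q (2 ^ m).+1 < C.
  by move=> mm; rewrite ltNge; apply/negP => h; apply: hno; exists m.
have b0 : 0 < 2 `^ alpha :> R by exact: powR_gt0.
have bound n : (2 ^ m0 < n)%N ->
    q 0%N * n%:R `^ alpha / norlund_weight q n <= 2 `^ alpha * C.
  move=> hn; have n1 : (0 < n.-1)%N.
    by have : (0 < 2 ^ m0)%N by [rewrite expn_gt0]; move: hn; lia.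
  have n0 : (0 < n)%N by exact: leq_ltn_trans hn.
  have /andP[h1 h2] := trunc_log_bounds (ltnSn 1) n1.
  set m := trunc_log 2 n.-1 in h1 h2.
  have hm : (2 ^ m < n <= 2 ^ m.+1)%N by rewrite -(prednK n0) !ltnS h1.
  have mm : (m0 <= m)%N.
    rewrite -ltnS -(ltn_exp2l _ _ (ltnSn 1)); apply: leq_trans hn _.
    by case/andP: hm.
  apply: le_trans (_ : 2 `^ alpha * (q 0%N * (2 `^ alpha) ^+ m / norlund_weight q (2 ^ m).+1) <= _);
    last by rewrite ler_wpM2l ?(ltW b0) // ltW // lt.
  case/andP: hm => hm1 hm2.
  have Q1 := norlund_weight_gt0 q_ge0 q0_gt0 (ltn0Sn (2 ^ m)).
  have Q2 := norlund_weight_gt0 q_ge0 q0_gt0 n0.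
  rewrite mulrA; apply: ler_pM.
  - by rewrite mulr_ge0 ?powR_ge0 // ltW.
  - by rewrite invr_ge0 ltW.
  - rewrite mulrCA ler_wpM2l // -exprS -powR_pow2 ge0_ler_powR ?nnegrE ?exprn_ge0 ?(ltW a0) //.
    by rewrite -natrX ler_nat.
  - by rewrite lef_pV2 ?posrE // norlund_weight_le.
have : (limn_esup (fun n : nat => (q 0%N * n%:R `^ alpha / norlund_weight q n)%:E)
    <= (2 `^ alpha * C)%:E)%E.
  rewrite /limn_esup /limf_esup.
  apply: le_trans (ereal_inf_lbound _) _.
    exists [set n | (2 ^ m0 < n)%N] => //; by exists (2 ^ m0).+1.
  by apply: ge_ereal_sup => _ [n hn <-]; rewrite lee_fin bound.
by rewrite hsup leye_eq.
Qed.

End Exponents.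

Theorem theorem2 (R : realType) (q : nat -> R)
    (q_ge0 : forall k : nat, 0 <= q k)
    (q_noninc : nonincreasing_seq q)
    (q0_gt0 : 0 < q 0%N) :
  [/\ forall alpha : R, 0 < alpha -> alpha < 1 ->
        (fun n : nat => q 0%N * n%:R `^ alpha / norlund_weight q n)
          =O_\oo (fun _ : nat => 1 : R) ->
        (fun n : nat => (q n - q n.+1) / n%:R `^ (alpha - 2))
          =O_\oo (fun _ : nat => 1 : R) ->
        bounded_hardy_weak (1 / (1 + alpha)) (norlund_max q),
      forall alpha p : R, 0 < alpha -> alpha <= 1 ->
        0 < p -> p < 1 / (1 + alpha) ->
        (exists2 c : R, 0 < c &
           \forall n \near \oo, c / n%:R `^ alpha <= q 0%N / norlund_weight q n) ->
        exists f : nat -> walsh_group -> R,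
          [/\ hardy p f, (0 < hardy_norm p f)%E &
            ereal_sup [set (weak_norm p (EFin \o norlund_mean q n f)
                             / hardy_norm p f)%E | n in [set n | (1 <= n)%N]]
              = +oo%E]
    & forall alpha : R, 0 < alpha -> alpha <= 1 ->
        limn_esup (fun n : nat =>
          (q 0%N * n%:R `^ alpha / norlund_weight q n)%:E) = +oo%E ->
        exists f : nat -> walsh_group -> R,
          [/\ hardy (1 / (1 + alpha)) f, (0 < hardy_norm (1 / (1 + alpha)) f)%E &
            ereal_sup [set (weak_norm (1 / (1 + alpha))
                               (EFin \o norlund_mean q n f)
                             / hardy_norm (1 / (1 + alpha)) f)%E
                      | n in [set n | (1 <= n)%N]]
              = +oo%E]
  ].
Proof.
have p_bounds (alpha : R) : 0 < alpha -> 0 < 1 / (1 + alpha) < 1.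
  move=> a0; have a1 : 0 < 1 + alpha by rewrite addr_gt0.
  by rewrite divr_gt0 //= ltr_pdivrMr // mul1r ltrDl.
split=> [alpha a0 a1 h1 h2|alpha p a0 a1 p0 pa [c c0 hc]|alpha a0 a1 hsup].
- have [K K0 hK] := weight_growth q_ge0 q_noninc q0_gt0 a0 a1 h1 h2.
  have /andP[p0 p1] := p_bounds _ a0.
  exact: (norlund_max_bounded q_ge0 q_noninc q0_gt0 (powR2_gt1 a0) (powR2_lt2 a1) K0 hK
    p0 (ltW p1) (powR_two_mul a0)).
- have /andP[_ p1] := p_bounds _ a0.
  apply: (norlund_mean_unbounded q_ge0 q0_gt0 p0 (lt_trans pa p1)).
  exact: hump_ratio_unbounded_of_lower_bound p0 pa a0 c0 hc.
- have /andP[p0 p1] := p_bounds _ a0.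
  apply: (norlund_mean_unbounded q_ge0 q0_gt0 p0 p1).
  have -> : (1 / (1 + alpha))^-1 - 1 = alpha.
    by rewrite div1r invrK; ring.
  exact: hump_ratio_unbounded_of_limsup a0 hsup.
Qed.
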